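(* Let $m,n\ge 1$. For $w\in(\mathbb{C}^* )^{m\times n}$ let $X_w$ be the scaled Segre embedding of $\mathbb{P}^{m-1}\times\mathbb{P}^{n-1}$ with scaling $w$ and let $M_w$ be the linear matroid on the columns of $[I_m\mid w]$. The ML degree of $X_w$ is a matroid invariant: if $v,w\in(\mathbb{C}^* )^{m\times n}$ and the matroids $M_v$ and $M_w$ are isomorphic, then $\operatorname{mldeg}(X_v)=\operatorname{mldeg}(X_w)$. Moreover, for every $w\in(\mathbb{C}^* )^{m\times n}$, $\operatorname{mldeg}(X_w)$ is equal to the beta invariant of $M_w$.
   Context: For $w\in(\mathbb{C}^* )^{m\times n}$, $X_w\subseteq\mathbb{P}^{mn-1}$ is the Zariski closure of the image of $\mathbb{P}^{m-1}\times\mathbb{P}^{n-1}\to\mathbb{P}^{mn-1}$, $(s,t)\mapsto(w_{ij}s_it_j)_{i\in[m],j\in[n]}$. ML degree: $\operatorname{mldeg}(X_w)$ is the number of complex critical points of the log-likelihood function $\sum_{i,j}u_{ij}\log p_{ij}$ (with the normalization $\sum p_{ij}=1$, i.e. of $\sum u_{ij}\log p_{ij}-(\sum u_{ij})\log(\sum p_{ij})$ on the projective variety) on the regular locus of $X_w$ minus the hypersurface $\{(\prod p_{ij})(\sum p_{ij})=0\}$, for generic data $u\in\mathbb{N}^{m\times n}$. Equivalently, it is the number, for generic $u$, of complex matrices $p=(p_{ij})$ in the affine cone over $X_w$ (i.e. $p_{ij}=w_{ij}s_it_j$ for some $s\in\mathbb{C}^m$, $t\in\mathbb{C}^n$) having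 the same row sums and the same column sums as $u$. $\widehat w=[I_m\mid w]\in\mathbb{C}^{m\times(m+n)}$ is the juxtaposition of the identity matrix with $w$, and $M_w$ is the linear matroid over $\mathbb{C}$ on $[m+n]$ defined by the columns of $\widehat w$. The beta invariant of a matroid $M$ on ground set $E$ with rank function $r$ is $\beta(M)=(-1)^{r(E)}\sum_{S\subseteq E}(-1)^{|S|}r(S)$. *)

(* Defs.v *)
From HB Require Import structures.
From mathcomp Require Import all_boot all_order all_algebra.
From mathcomp Require Import complex mpoly.
From mathcomp Require Import boolp classical_sets cardinality reals.

Set Implicit Arguments.
Unset Strict Implicit.
Unset Printing Implicit Defensive.

Import Order.TTheory GRing.Theory Num.Theory.

Local Open Scope ring_scope.

Record matroid (E : finType) := Matroid {
  mrank :> {set E} -> nat;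
  mrank_le_card : forall S, (mrank S <= #|S|)%N;
  mrank_mono : forall S T : {set E}, S \subset T -> (mrank S <= mrank T)%N;
  mrank_submod : forall S T,
    (mrank (S :|: T) + mrank (S :&: T) <= mrank S + mrank T)%N }.

Definition matroid_iso (E1 E2 : finType) (M1 : matroid E1) (M2 : matroid E2) :
    Prop :=
  exists2 f : E1 -> E2, bijective f & forall S : {set E1}, M2 (f @: S) = M1 S.

Definition beta (E : finType) (M : matroid E) : int :=
  (-1) ^+ M [set: E] * \sum_(S : {set E}) (-1) ^+ #|S| * (M S)%:Z.

Section LinearMatroid.
Context (F : fieldType) (k e : nat) (A : 'M[F]_(k, e)).

Definition col_span (S : {set 'I_e}) : 'M[F]_k :=
  (\sum_(j in S) <<(col j A)^T>>)%MS.

Definition col_rank (S : {set 'I_e}) : nat := \rank (col_span S).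

Lemma col_span_mono (S T : {set _}) : S \subset T -> (col_span S <= col_span T)%MS.
Proof.
move=> /fintype.subsetP sST; apply/sumsmx_subP => j jS.
exact: (sumsmx_sup j (sST j jS)).
Qed.

Lemma col_rank_le_card (S : {set _}) : (col_rank S <= #|S|)%N.
Proof.
rewrite /col_rank /col_span -sum1_card.
elim/big_ind2: _ => [|a x b y ax byy|j _]; first by rewrite mxrank0.
  exact: leq_trans (mxrank_adds_leqif _ _) (leq_add ax byy).
by rewrite genmxE rank_leq_row.
Qed.

Lemma col_rank_mono (S T : {set _}) : S \subset T -> (col_rank S <= col_rank T)%N.
Proof. by move=> sST; apply/mxrankS/col_span_mono. Qed.

Lemma col_rank_submod (S T : {set _}) :
  (col_rank (S :|: T) + col_rank (S :&: T) <= col_rank S + col_rank T)%N.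
Proof.
rewrite -[in leqRHS]mxrank_sum_cap leq_add //; apply: mxrankS.
  apply/sumsmx_subP => j; rewrite inE => /orP[jS|jT].
    by apply: submx_trans (addsmxSl _ _); apply: (sumsmx_sup j).
  by apply: submx_trans (addsmxSr _ _); apply: (sumsmx_sup j).
by rewrite sub_capmx !col_span_mono // ?finset.subsetIl ?finset.subsetIr.
Qed.

Definition linear_matroid : matroid 'I_e :=
  Matroid col_rank_le_card col_rank_mono col_rank_submod.

End LinearMatroid.

Definition segre_matroid (F : fieldType) (m n : nat) (w : 'M[F]_(m, n)) :
    matroid 'I_(m + n) :=
  linear_matroid (row_mx 1%:M w).

Local Open Scope classical_set_scope.

Section ScaledSegre.
Context (C : fieldType) (m n : nat) (w : 'M[C]_(m, n)).

(* The coordinates of P^(mn-1) are indexed by 'I_(m * n) through mxvec; a point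
   of P^(mn-1) is given by any nonzero matrix of homogeneous coordinates. *)
Definition coords (p : 'M[C]_(m, n)) : 'I_(m * n) -> C := mxvec p 0.

Definition segre_map (s : 'rV[C]_m) (t : 'rV[C]_n) : 'M[C]_(m, n) :=
  \matrix_(i, j) (w i j * s 0 i * t 0 j).

Definition segre_ideal : set {mpoly C[m * n]} :=
  [set f | (exists d : nat, f \is d.-homog) /\
    forall s t, s != 0 -> t != 0 -> f.@[coords (segre_map s t)] = 0].

Definition segre_variety : set 'M[C]_(m, n) :=
  [set p | p != 0 /\ forall f, segre_ideal f -> f.@[coords p] = 0].

(* Tangent space at p of the affine cone over the variety. *)
Definition tangent (p : 'M[C]_(m, n)) : set 'M[C]_(m, n) :=
  [set v | forall f, segre_ideal f ->
    \sum_(k < m * n) f^`M(k).@[coords p] * coords v k = 0].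

(* The variety is irreducible (it is the closure of the image of an irreducible
   one), so its regular points are those whose tangent space has the least
   dimension. *)
Definition regular_locus : set 'M[C]_(m, n) :=
  [set p | segre_variety p /\
    forall (q : 'M[C]_(m, n)) (V W : {vspace 'M[C]_(m, n)}), segre_variety q ->
      [set` V] = tangent p -> [set` W] = tangent q -> (\dim V <= \dim W)%N].

Definition total (V : nmodType) (p : 'M[V]_(m, n)) : V := \sum_i \sum_j p i j.

(* Differential at p, in the direction v, of
   sum_ij u_ij log p_ij - (sum_ij u_ij) log (sum_ij p_ij);
   it does not depend on the branches of the logarithm. *)
Definition dloglik (u : 'M[nat]_(m, n)) (p v : 'M[C]_(m, n)) : C :=
  \sum_i \sum_j (u i j)%:R * (v i j / p i j)
    - (total u)%:R * (total v / total p).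

(* Each point of P^(mn-1) off the hyperplane sum_ij p_ij = 0 is represented by
   its unique matrix of coordinates with sum 1. *)
Definition critical_points (u : 'M[nat]_(m, n)) : set 'M[C]_(m, n) :=
  [set p | [/\ regular_locus p, forall i j, p i j != 0, total p = 1 &
    forall v, tangent p v -> dloglik u p v = 0]].

(* Generic u: every u outside the zero set of some nonzero polynomial g.  In
   characteristic 0 the natural points are Zariski dense, so that at most one d
   qualifies. *)
Definition is_mldeg (d : nat) : Prop :=
  exists2 g : {mpoly C[m * n]}, g != 0 &
    forall u : 'M[nat]_(m, n), g.@[coords (map_mx (fun x => x%:R) u)] != 0 ->
      (critical_points u #= `I_d)%card.

Definition mldeg : nat := xget 0%N is_mldeg.

End ScaledSegre.

(* Main.v *)
(* Let [L] be the row space of [I_m | w].  Up to scaling, a matrix [w_ij s_i t_j] is a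
   pair of vectors [x = (s, s w)] of [L] and [y = (- t w^T, t)] of the orthogonal of [L],
   and prescribing its row and column sums is prescribing the products [x_e y_e] on
   [E = [m + n]], subject to [sum_e x_e y_e = 0].  For an arbitrary subspace [L] of [C^E],
   the number of solutions [(x, y)], up to [(c x, y / c)], of [x_e y_e = lam_e] for generic
   [lam] of sum zero is the beta invariant of the matroid of [L], by deletion-contraction.
   When [lam_0 = 0] and the rest is generic, the solutions with [x_0 = 0] are those of the
   contraction of [0] and the solutions with [y_0 = 0] are those of its deletion; they are
   all nondegenerate, and solutions stay in a compact set as long as no relevant partial sum
   of [lam] vanishes, so the inverse function theorem preserves their number when [lam_0] is
   perturbed.  The degenerate [lam] lie in a hypersurface, by algebraic dependence, and a
   hypersurface does not disconnect a complex line, so the number is generically constant.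
   If both deletion and contraction have generic number zero then the matroid is
   disconnected, and a separator [F] forces [sum_(e in F) lam_e = 0]. *)

Require Import Defs.
From HB Require Import structures.
From mathcomp Require Import all_boot all_order all_algebra.
From mathcomp Require Import finmap complex mpoly.
From mathcomp Require Import boolp classical_sets cardinality reals.
From mathcomp Require Import zify ring lra.

Set Implicit Arguments.
Unset Strict Implicit.
Unset Printing Implicit Defensive.

Import Order.TTheory GRing.Theory Num.Theory.
Local Open Scope ring_scope.
Local Open Scope complex_scope.

(** * Fields with an absolute value *)

(** The equations become a square system by fixing an index [f0], requiring [x_f0 = 1] and dropping
    the product equation at [f0], which follows from the others because both sides sum to zero. The
    recursion must therefore never remove [f0]: it always treats index 0, and [f0] is the last
    index. Two obstacles shape the perturbation from [lam_0 = 0]. The partial sum over the single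
    index 0 vanishes there, so the compactness estimate reaches only the other coordinates; [x_0]
    and [y_0] are then bounded by orthogonality to vectors of L and of its orthogonal with
    coordinate 1 at index 0, which exist as 0 is neither a loop nor a coloop. And generic
    nondegeneracy is deduced from one nondegenerate solution, which is available only if the
    expected number is positive. Hence the value zero is treated apart, and the induction carries
    the claim that it occurs only for disconnected matroids, apart from the case of one element. Of
    the topology of C only a form of Heine-Borel and the connectedness of the complement of finitely
    many points are used. *)

Record absval (R : realType) (C : fieldType) := AbsVal {
  av :> C -> R;
  av_ge0 : forall x, 0 <= av x;
  av_eq0 : forall x, (av x == 0) = (x == 0);
  avD : forall x y, av (x + y) <= av x + av y;
  avM : forall x y, av (x * y) = av x * av y;
  (* Stand-in for the reals of [0, 1] inside the field: it provides damped steps in the Newton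
     argument and infinitely many elements of small absolute value. *)
  av_unit_itv : forall s, 0 <= s <= 1 ->
    exists2 c, av c = s & av (1 - c) = 1 - s }.

Arguments avD {R C a}.
Arguments avM {R C a}.
Arguments av_ge0 {R C a}.
Arguments av_eq0 {R C a}.
Arguments av_unit_itv {R C a}.

Section Norm.
Variables (R : realType) (C : fieldType) (nc : absval R C).

Lemma av_gt0 x : (0 < nc x) = (x != 0).
Proof. by rewrite lt_def av_ge0 andbT av_eq0. Qed.

Lemma av0 : nc 0 = 0. Proof. by apply/eqP; rewrite av_eq0. Qed.

Lemma av1 : nc 1 = 1.
Proof.
have /mulfI : nc 1 != 0 by rewrite av_eq0 oner_eq0.
by apply; rewrite -avM !mulr1.
Qed.

Lemma avN x : nc (- x) = nc x.
Proof.
have N1 : nc (-1) = 1.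
  apply/eqP; rewrite -(@eqrXn2 _ 2) ?av_ge0 // expr1n expr2 -avM.
  by rewrite mulrNN mulr1 av1.
by rewrite -mulN1r avM N1 mul1r.
Qed.

Lemma av_sum (I : Type) (s : seq I) (P : pred I) (F : I -> C) :
  nc (\sum_(i <- s | P i) F i) <= \sum_(i <- s | P i) nc (F i).
Proof.
elim/big_ind2: _ => [|x a y b xa yb|//]; first by rewrite av0.
exact: le_trans (avD _ _) (lerD xa yb).
Qed.

Definition nrm m n (v : 'M[C]_(m, n)) : R := \sum_i \sum_j nc (v i j).

Lemma nrm_ge0 m n (v : 'M[C]_(m, n)) : 0 <= nrm v.
Proof. by rewrite !sumr_ge0 // => *; rewrite sumr_ge0 // => *; apply: av_ge0. Qed.

Lemma nrm0 m n : nrm (0 : 'M_(m, n)) = 0.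
Proof. by rewrite /nrm !big1 // => i _; rewrite big1 // => j _; rewrite mxE av0. Qed.

Lemma av_le_nrm m n (v : 'M[C]_(m, n)) i j : nc (v i j) <= nrm v.
Proof.
rewrite /nrm (bigD1 i) //= (bigD1 j) //= -addrA lerDl addr_ge0 ?sumr_ge0 // => *.
  exact: av_ge0.
by rewrite sumr_ge0 // => *; apply: av_ge0.
Qed.

Lemma nrm_eq0 m n (v : 'M[C]_(m, n)) : (nrm v == 0) = (v == 0).
Proof.
apply/eqP/eqP => [v0|->]; last exact: nrm0.
apply/matrixP => i j; rewrite mxE; apply/eqP; rewrite -(@av_eq0 R C nc) eq_le av_ge0 andbT.
by rewrite -v0 av_le_nrm.
Qed.

Lemma nrmD m n (u v : 'M[C]_(m, n)) : nrm (u + v) <= nrm u + nrm v.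
Proof.
rewrite /nrm -big_split ler_sum // => i _; rewrite -big_split ler_sum // => j _.
by rewrite mxE avD.
Qed.

Lemma nrmN m n (u : 'M[C]_(m, n)) : nrm (- u) = nrm u.
Proof. by apply: eq_bigr => i _; apply: eq_bigr => j _; rewrite mxE avN. Qed.

Lemma nrmZ m n a (u : 'M[C]_(m, n)) : nrm (a *: u) = nc a * nrm u.
Proof.
rewrite mulr_sumr; apply: eq_bigr => i _; rewrite mulr_sumr.
by apply: eq_bigr => j _; rewrite mxE avM.
Qed.

Lemma nrmB m n (u v : 'M[C]_(m, n)) : nrm (u - v) <= nrm u + nrm v.
Proof. by rewrite -[nrm v]nrmN nrmD. Qed.

Lemma nrm_distrC m n (u v : 'M[C]_(m, n)) : nrm (u - v) = nrm (v - u).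
Proof. by rewrite -nrmN opprB. Qed.

Lemma nrmBrev m n (u v : 'M[C]_(m, n)) : nrm u - nrm v <= nrm (u - v).
Proof. by rewrite lerBlDr -{1}[u](subrK v) nrmD. Qed.

Lemma nrmM m n p (u : 'M[C]_(m, n)) (v : 'M[C]_(n, p)) :
  nrm (u *m v) <= nrm u * nrm v.
Proof.
rewrite /nrm mulr_suml ler_sum // => i _.
under eq_bigr do rewrite mxE.
apply: (@le_trans _ _ (\sum_j \sum_k nc (u i k) * nc (v k j))).
  apply: ler_sum => j _; apply: le_trans (av_sum _ _ _) _.
  by apply: ler_sum => k _; rewrite avM.
rewrite exchange_big mulr_suml ler_sum // => k _ /=.
rewrite -mulr_sumr ler_wpM2l ?av_ge0 //.
by rewrite [leRHS](bigD1 k) //= lerDl sumr_ge0 // => *; rewrite sumr_ge0 // => *; apply: av_ge0.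
Qed.

Lemma nrm_rV n (u : 'rV[C]_n) : nrm u = \sum_j nc (u 0 j).
Proof. by rewrite /nrm big_ord1. Qed.

End Norm.
Arguments nrmB {R C nc m n}.
Arguments nrmD {R C nc m n}.
Arguments nrmN {R C nc m n}.
Arguments nrm_ge0 {R C nc m n}.
Arguments nrmBrev {R C nc m n}.
Arguments nrmM {R C nc m n p}.
Arguments av_le_nrm {R C nc m n}.
Arguments nrm_distrC {R C nc m n}.

(** * Compactness and connectedness of the complex plane *)

Definition antitone (R : realType) T (P : R -> T -> Prop) :=
  forall r r' x, r' <= r -> P r x -> P r' x.

(** Heine-Borel without covers: [P r z] reads as the radius, or margin, [r] being good at [z], and
    locally good values of [r] are replaced by a single one. *)
Definition locally_compact (R : realType) (C : fieldType) (nc : absval R C) :=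
  forall n (B : R) (P : R -> 'rV[C]_n -> Prop), antitone P ->
  (forall z, nrm nc z <= B ->
     exists2 r, 0 < r & forall z', nrm nc (z' - z) < r -> P r z') ->
  exists2 r, 0 < r & forall z, nrm nc z <= B -> P r z.

(** In the application [q] is the restriction to a line of the polynomial that cuts out the
    degenerate [lam], and [Q] says that the number of solutions is [n]. *)
Definition punctured_connected (R : realType) (C : fieldType) (nc : absval R C) :=
  forall (q : {poly C}) (Q : C -> Prop),
  (forall z, q.[z] != 0 -> exists2 r, 0 < r &
     forall z', nc (z' - z) < r -> q.[z'] != 0 -> Q z <-> Q z') ->
  forall a b, q.[a] != 0 -> q.[b] != 0 -> Q a -> Q b.

Section Compact.
Variable R : realType.
Local Notation C := R[i].

Lemma complex_av_unit_itv (s : R) : 0 <= s <= 1 ->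
  exists2 c : C, ComplexField.Normc.normc c = s & ComplexField.Normc.normc (1 - c) = 1 - s.
Proof.
have nc_real (x : R) : 0 <= x -> ComplexField.Normc.normc x%:C = x.
  by move=> x0; rewrite /= expr0n /= addr0 sqrtr_sqr ger0_norm.
move=> /andP[s0 s1]; exists s%:C; first exact: nc_real.
by rewrite -[1]/(1%:C) -rmorphB nc_real // subr_ge0.
Qed.

Lemma complex_av_ge0 (x : C) : 0 <= ComplexField.Normc.normc x.
Proof. by case: x => a b; apply: sqrtr_ge0. Qed.

Lemma complex_av_eq0 (x : C) : (ComplexField.Normc.normc x == 0) = (x == 0).
Proof.
apply/eqP/eqP => [/ComplexField.Normc.eq0_normc //|->].
exact: ComplexField.Normc.normc0.
Qed.

Definition complex_absval : absval R C :=
  AbsVal complex_av_ge0 complex_av_eq0 (@le_normcD R) (@ComplexField.Normc.normcM R)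
    complex_av_unit_itv.
Local Notation nc := complex_absval.
Local Notation nrm := (nrm complex_absval).

(** Let [s] be the supremum of the points up to which a common radius works. The radius good near
    [s] carries the common one past [s], unless [s = b]. *)
Lemma itv_compact (a b : R) (P : R -> R -> Prop) : antitone P ->
  (forall x, a <= x <= b -> exists2 r, 0 < r & forall y, `|y - x| < r -> P r y) ->
  exists2 r, 0 < r & forall x, a <= x <= b -> P r x.
Proof.
move=> Pa loc; have [ab|] := leP a b; last first.
  by move=> ba; exists 1 => // x /andP[/le_trans /[apply]]; rewrite leNgt ba.
pose S := [set x | a <= x <= b /\ exists2 r, 0 < r & forall y, a <= y <= x -> P r y]%classic.
have Sa : S a.
  split; first by rewrite lexx.
  have [|r r0 rP] := loc a; first by rewrite lexx.
  by exists r => // y; rewrite -eq_le => /eqP <-; apply: rP; rewrite subrr normr0.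
have Ssup : has_sup S.
  by split; [exists a|exists b => x [/andP[]]].
set s := sup S.
have sab : a <= s <= b.
  by rewrite ub_le_sup /=; [|case: Ssup|by []] => //; apply: ge_sup; [exists a|move=> x [/andP[]]].
have [r0 r00 r0P] := loc s sab.
have [x Sx sx] := sup_adherent r00 Ssup.
have [/andP[ax xb] [r1 r10 r1P]] := Sx.
have xs : x <= s by apply: ub_le_sup => //; case: Ssup.
pose t := Num.min b (s + r0 / 2).
have tP y : a <= y <= t -> P (Num.min r0 r1) y.
  move=> /andP[ay yt]; have [yx|xy] := leP y x.
    by apply: Pa (r1P _ _); rewrite ?ge_min ?lexx ?orbT // ay.
  apply: Pa (r0P _ _); first by rewrite ge_min lexx.
  move: yt; rewrite le_min => /andP[_ yt].
  by rewrite ltr_norml; apply/andP; split; rewrite -/s in sx; lra.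
have St : S t.
  split; last by exists (Num.min r0 r1) => //; rewrite lt_min r00.
  rewrite /t le_min ge_min lexx ab /=; move: sab => /andP[as_ _]; rewrite andbT; lra.
have ts : t <= s by apply: ub_le_sup => //; case: Ssup.
have tb : t = b.
  move: ts; rewrite /t; case: (leP b (s + r0 / 2)) => //; move=> *; lra.
by exists (Num.min r0 r1); rewrite ?lt_min ?r00 // => y yab; apply: tP; rewrite tb.
Qed.

(** Tube lemma: compactness is applied on each vertical segment, with a neighbourhood in the real
    part as parameter, and then to the real part. *)
Lemma square_compact (B : R) (P : R -> C -> Prop) : antitone P ->
  (forall x, `|complex.Re x| <= B -> `|complex.Im x| <= B ->
     exists2 r, 0 < r & forall y, nc (y - x) < r -> P r y) ->
  exists2 r, 0 < r & forall x, `|complex.Re x| <= B -> `|complex.Im x| <= B -> P r x.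
Proof.
move=> Pa loc.
have [|x xB|r r0 rP] := @itv_compact (- B) B
   (fun r x => forall y, -B <= y <= B -> P r (x +i* y)).
- by move=> r r' x rr' Pr y yB; apply: Pa (Pr _ yB).
- have [|y yB|r r0 rP] := @itv_compact (- B) B
     (fun r y => forall x', `|x' - x| < r -> P r (x' +i* y)).
  + by move=> r r' y rr' Pr x' xx'; apply: Pa (Pr _ _) => //; apply: lt_le_trans xx' _.
  + have [||r r0 rP] := loc (x +i* y); rewrite /= ?ler_norml //.
    exists (r / 2); rewrite ?divr_gt0 // => y' yy' x' xx'.
    apply: Pa (rP _ _); first by lra.
    apply: le_lt_trans (_ : _ <= nc ((x' - x)%:C) + nc (0 +i* (y' - y))) _.
      apply: le_trans ((@avD R C nc) _ _); rewrite le_eqVlt; apply/orP; left; apply/eqP.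
      by congr (nc _); apply/eqP; rewrite eq_complex /= addr0 add0r !eqxx.
    by rewrite /= !expr0n /= addr0 add0r !sqrtr_sqr; lra.
  + by exists r => // x' xx' y yB; apply: rP.
- by exists r => // -[x y] /=; rewrite !ler_norml => xB yB; apply: rP.
Qed.

Definition in_box n (B : R) (z : 'rV[C]_n) :=
  forall j, `|complex.Re (z 0 j)| <= B /\ `|complex.Im (z 0 j)| <= B.

Lemma box_compact n (B : R) (P : R -> 'rV[C]_n -> Prop) : antitone P ->
  (forall z, in_box B z ->
     exists2 r, 0 < r & forall z', nrm (z' - z) < r -> P r z') ->
  exists2 r, 0 < r & forall z, in_box B z -> P r z.
Proof.
elim: n P => [|n IH] P Pa loc.
  have [|r r0 rP] := loc 0; first by case.
  by exists r => // z _; apply: rP; rewrite [z - 0]thinmx0 nrm0.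
have [|x xB yB|r r0 rP] := @square_compact B
   (fun r x => forall z, in_box B z -> P r (row_mx (x%:M : 'M_1) z : 'rV_(1 + n))).
- by move=> r r' x rr' Pr y yB'; apply: Pa (Pr _ yB').
- have [|z zB|r r0 rP] := IH (fun r z => forall x', nc (x' - x) < r ->
                        P r (row_mx (x'%:M : 'M_1) z : 'rV_(1 + n))).
  + by move=> r r' y rr' Pr x' xx'; apply: Pa (Pr _ _) => //; apply: lt_le_trans xx' _.
  + have [|r r0 rP] := loc (row_mx (x%:M : 'M_1) z : 'rV_(1 + n)).
      move=> j; case: (@split_ordP 1 n j) => k ->.
        by rewrite (@row_mxEl _ 1 1 n) !mxE ord1 eqxx.
      by rewrite (@row_mxEr _ 1 1 n).
    exists (r / 2); rewrite ?divr_gt0 // => z' zz' x' xx'.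
    apply: Pa (rP _ _); first by lra.
    rewrite (@opp_row_mx _ 1 1 n) (@add_row_mx _ 1 1 n) /nrm big_ord1 (@big_split_ord _ _ _ 1 n) big_ord1.
    rewrite (@row_mxEl _ 1 1 n).
    under eq_bigr do rewrite (@row_mxEr _ 1 1 n).
    move: zz'; rewrite /nrm big_ord1 !mxE eqxx !mulr1n => zz'.
    by apply: lt_le_trans (ltrD xx' zz') _; lra.
  + by exists r => // x' xx' z zB; apply: rP.
- exists r => // z zB; rewrite -(@hsubmxK _ 1 1 n (z : 'rV_(1 + n))) [lsubmx _]mx11_scalar.
  apply: rP => [||j]; rewrite !mxE; last exact: zB (@rshift 1 n j).
    by have [] := zB (@lshift 1 n 0).
  by have [] := zB (@lshift 1 n 0).
Qed.

Lemma complex_locally_compact : locally_compact complex_absval.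
Proof.
(* The ball lies in the box of the same size. Around a point of the box outside the ball the new
   predicate holds vacuously, so [loc] is only needed in the ball. *)
move=> n B P Pa loc; have [|z _|r r0 rP] := @box_compact n B (fun r z => nrm z <= B -> P r z).
- by move=> r r' z rr' Pr /Pr; apply: Pa.
- have [/loc[r r0 rP]|Bz] := leP (nrm z) B; first by exists r => // z' /rP.
  exists (nrm z - B); first by rewrite subr_gt0.
  move=> z' zz' z'B; have := nrmBrev (nc:=complex_absval) z z'; rewrite nrm_distrC; lra.
- exists r => // z zB; apply: rP => // j; have := av_le_nrm (nc:=complex_absval) z 0 j.
  case: (z 0 j) => a b /= => /le_trans /(_ zB) abB; split; apply: le_trans abB;
   by rewrite -sqrtr_sqr ler_wsqrtr // ?lerDl ?lerDr sqr_ge0.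
Qed.

(** Once a common radius [r] is found, [N] steps of length [1 / N < r] lead from 0 to 1. *)
Lemma locally_constant_itv (Q : R -> Prop) :
  (forall x, 0 <= x <= 1 -> exists2 r, 0 < r &
     forall y, 0 <= y <= 1 -> `|y - x| < r -> Q x <-> Q y) ->
  Q 0 -> Q 1.
Proof.
move=> loc Q0.
have [||r r0 rP] := @itv_compact 0 1 (fun r x => 0 <= x <= 1 ->
    forall y, 0 <= y <= 1 -> `|y - x| < r -> Q x <-> Q y).
- by move=> r r' x rr' H /H{}H y /H{}H yr; apply: H; apply: lt_le_trans yr _.
- move=> x /loc[r r0 rP]; exists (r / 2); first by rewrite divr_gt0.
  move=> y; rewrite ltr_norml => yx y01 z z01; rewrite ltr_norml => zy.
  apply: iff_trans (iff_sym (rP y y01 _)) (rP z z01 _);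
    by rewrite ltr_norml; apply/andP; split; lra.
pose N := (Num.bound r^-1); have N0 : 0 < N%:R :> R.
  by apply: le_lt_trans (archi_boundP _); rewrite ?invr_ge0 ltW // invr_gt0.
have Nr : N%:R^-1 < r.
  by rewrite -[r]invrK ltf_pV2 ?posrE ?invr_gt0 // archi_boundP // invr_ge0 ltW.
have step n : (n <= N)%N -> Q (n%:R / N%:R).
  elim: n => [|n IH] nN; first by rewrite mul0r.
  have in01 m : (m <= N)%N -> 0 <= m%:R / N%:R :> R /\ m%:R / N%:R <= 1 :> R.
    by move=> mN; rewrite divr_ge0 ?ler0n // ler_pdivrMr // mul1r ler_nat.
  have [a1 a2] := in01 n (ltnW nN); have [b1 b2] := in01 _ nN.
  apply: (rP (n%:R / N%:R) _ _ _ _ _).1; rewrite ?a1 ?b1 //.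
  - by rewrite -mulrBl -natrB // subSnn mul1r gtr0_norm ?invr_gt0.
  - exact: IH (ltnW nN).
by have := step N (leqnn _); rewrite divff // gt_eqF.
Qed.

(** The arcs [a + (b - a) (t + i c t (1 - t))], for real [c], meet only at [a] and [b], so each root
    of [q] rules out at most one value of [c]. *)
Lemma complex_punctured_connected : punctured_connected complex_absval.
Proof.
move=> q Q loc a b qa qb Qa; have [<- //|ab] := eqVneq a b.
have ba0 : b - a != 0 by rewrite subr_eq0 eq_sym.
have [s sP] : exists s : seq C, forall z, q.[z] = 0 -> z \in s.
  have [s E] := closed_field_poly_normal q; exists s => z qz.
  have q0 : lead_coef q != 0.
    by rewrite lead_coef_eq0; apply: contraNneq qa => ->; rewrite horner0.
  by rewrite -root_prod_XsubC -(rootZ _ _ q0) -E; apply/eqP.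
pose u z := (z - a) / (b - a).
(* [slope] recovers [c] from a point of the arc other than its ends; at the ends, where its
   denominator is zero, [q] is nonzero by hypothesis. A [c] above the slopes of all roots gives a
   good arc. *)
pose slope z := complex.Im (u z) / (complex.Re (u z) * (1 - complex.Re (u z))).
have [c cP] : exists c, forall z, z \in s -> slope z < c.
  elim: s {sP} => [|z s [c cP]]; first by exists 0.
  exists (Num.max (slope z + 1) c) => z'; rewrite inE lt_max => /orP[/eqP->|/cP->].
    by rewrite ltrDl ltr01.
  by rewrite orbT.
pose g t : C := a + (b - a) * (t +i* (c * t * (1 - t))).
have g0 : g 0 = a by rewrite /g mulr0 mul0r mulr0 addr0.
have g1 : g 1 = b by rewrite /g subrr mulr0 mulr1 addrC subrK.
have qg t : q.[g t] != 0.
  apply/negP => /eqP qt; have := cP _ (sP _ qt).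
  have uE : u (g t) = t +i* (c * t * (1 - t)).
    by rewrite /u /g [a + _]addrC addrK mulrC mulKf.
  rewrite /slope uE /=.
  have [t0|t0] := eqVneq t 0; first by move: qa; rewrite -g0 -t0 qt eqxx.
  have [t1|t1] := eqVneq t 1; first by move: qb; rewrite -g1 -t1 qt eqxx.
  by rewrite -mulrA mulfK ?ltxx // mulf_neq0 // subr_eq0 eq_sym.
have ncIm (x y : R) : nc (x +i* y) <= `|x| + `|y|.
  rewrite -[x +i* y]/(x +i* y : C); have -> : x +i* y = x +i* 0 + 0 +i* y :> C.
    by apply/eqP; rewrite eq_complex /= addr0 add0r !eqxx.
  apply: le_trans (avD _ _) _.
  by rewrite /= !expr0n /= addr0 add0r !sqrtr_sqr.
pose L := nc (b - a) * (1 + `|c|).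
have L0 : 0 <= L by rewrite mulr_ge0 ?av_ge0 // addr_ge0.
have gL t t' : 0 <= t <= 1 -> 0 <= t' <= 1 -> nc (g t' - g t) <= L * `|t' - t|.
  move=> t01 t'01.
  have -> : g t' - g t = (b - a) * ((t' - t) +i* (c * (t' - t) * (1 - t - t'))).
    rewrite /g opprD addrACA subrr add0r -mulrBr; congr (_ * _).
    by apply/eqP; rewrite eq_complex /= eqxx /=; apply/eqP; ring.
  rewrite /L avM -[leRHS]mulrA ler_wpM2l ?av_ge0 //; apply: le_trans (ncIm _ _) _.
  rewrite mulrDl mul1r lerD2l !normrM ler_piMr // ?mulr_ge0 // ler_norml; lra.
rewrite -g1; apply: (@locally_constant_itv (fun t => Q (g t))); last by rewrite g0.
move=> t t01; have [r r0 rP] := loc _ (qg t).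
exists (r / (L + 1)); first by rewrite divr_gt0 // ltr_wpDl.
move=> t' t'01 tt'; apply: rP => //; apply: le_lt_trans (gL _ _ t01 t'01) _.
have : `|t' - t| * (L + 1) < r by rewrite -ltr_pdivlMr // ltr_wpDl.
have := normr_ge0 (t' - t); lra.
Qed.

End Compact.

Lemma addmxE (V : nmodType) m n (u v : 'M[V]_(m, n)) i j : (u + v) i j = u i j + v i j.
Proof. by rewrite mxE. Qed.

(** * Newton's method for quadratic maps *)

Section BallMin.
Variables (R : realType) (C : fieldType) (nc : absval R C).
Hypothesis nc_compact : locally_compact nc.
Local Notation nrm := (nrm nc).

(** The last hypothesis is lower semicontinuity. If the infimum were not attained, [f] would exceed
    it locally by a margin, and by compactness by a uniform one. *)
Lemma ball_min n (B : R) (f : 'rV[C]_n -> R) : 0 <= B -> (forall z, 0 <= f z) ->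
  (forall z e, 0 < e -> exists2 r, 0 < r & forall z', nrm (z' - z) < r -> f z - e <= f z') ->
  exists2 z, nrm z <= B & forall z', nrm z' <= B -> f z <= f z'.
Proof.
move=> B0 f0 fl.
pose S := [set x | exists2 z, nrm z <= B & f z = x]%classic.
have Sinf : has_inf S.
  split; first by exists (f 0), 0; rewrite ?nrm0.
  by exists 0 => x [z _ <-].
apply: contrapT => nomin.
have mlt z : nrm z <= B -> inf S < f z.
  move=> zB; rewrite lt_neqAle; apply/andP; split; last first.
    by apply: ge_inf; [case: Sinf|exists z].
  apply/eqP => fz; apply: nomin; exists z => // z' z'B; rewrite -fz.
  by apply: ge_inf; [case: Sinf|exists z'].
have [||r r0 rP] := @nc_compact n B (fun r z => inf S + r <= f z).
- by move=> r r' x rr'; apply: le_trans; rewrite lerD2l.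
- move=> z zB; pose g := f z - inf S; have g0 : 0 < g by rewrite subr_gt0 mlt.
  have [|r r0 rP] := fl z (g / 2); first by rewrite divr_gt0.
  exists (Num.min r (g / 2)); first by rewrite lt_min r0 divr_gt0.
  move=> z'; rewrite lt_min => /andP[/rP fz _].
  have : Num.min r (g / 2) <= g / 2 by rewrite ge_min lexx orbT.
  rewrite /g in fz *; lra.
have : inf S + r <= inf S.
  apply: lb_le_inf; first by case: Sinf.
  by move=> x [z zB <-]; apply: rP.
by rewrite gerDl leNgt r0.
Qed.

End BallMin.

Section Newton.
Variables (R : realType) (C : fieldType) (nc : absval R C) (n : nat).
Hypothesis nc_compact : locally_compact nc.
Local Notation nrm := (nrm nc).
Variables (P Q T : 'M[C]_n).

Implicit Types (z h k u v : 'rV[C]_n).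

Definition bil (u v : 'rV[C]_n) : 'rV[C]_n :=
  \row_j ((u *m P) 0 j * (v *m Q) 0 j).

(** Each coordinate is a linear form plus a product of two linear forms, which covers both
    [x_j y_j = lam_j] and [x_f0 = 1]. The Taylor expansion stops at degree two, so the estimates
    below have explicit constants. *)
Definition quad (z : 'rV[C]_n) := z *m T + bil z z.

Definition jac (z : 'rV[C]_n) : 'M[C]_n :=
  \matrix_(i, j) (T i j + (z *m P) 0 j * Q i j + P i j * (z *m Q) 0 j).

Let K := nrm P * nrm Q.

Lemma bil_const_ge0 : 0 <= K. Proof. by rewrite mulr_ge0 ?nrm_ge0. Qed.

Lemma nrm_bil u v : nrm (bil u v) <= K * (nrm u * nrm v).
Proof.
apply: (@le_trans _ _ (nrm (u *m P) * nrm (v *m Q))); last first.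
  rewrite /K mulrACA [nrm P * _]mulrC [nrm Q * _]mulrC.
  by rewrite ler_pM ?nrm_ge0 ?nrmM.
rewrite nrm_rV [nrm (u *m P)]nrm_rV mulr_suml ler_sum // => j _.
by rewrite mxE avM ler_wpM2l ?av_ge0 ?av_le_nrm.
Qed.

Lemma mul_jac h z : h *m jac z = h *m T + (bil z h + bil h z).
Proof.
apply/rowP => j.
have hE (M : 'M[C]_n) : (h *m M) 0 j = \sum_i h 0 i * M i j by rewrite mxE.
have bE u v : bil u v 0 j = (u *m P) 0 j * (v *m Q) 0 j by rewrite mxE.
rewrite hE [RHS]mxE [(bil _ _ + _) 0 j]mxE !bE.
under eq_bigr do rewrite mxE mulrDr mulrDr.
rewrite !big_split /= -addrA -hE; congr (_ + (_ + _)); rewrite hE.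
  by rewrite mulr_sumr; apply: eq_bigr => i _; rewrite mulrCA.
by rewrite mulr_suml; apply: eq_bigr => i _; rewrite mulrA.
Qed.

Lemma bilDl u v w : bil (u + v) w = bil u w + bil v w.
Proof. by apply/rowP => j; rewrite [RHS]mxE ![bil _ _ _ _]mxE mulmxDl mxE mulrDl. Qed.

Lemma bilDr u v w : bil w (u + v) = bil w u + bil w v.
Proof. by apply/rowP => j; rewrite [RHS]mxE ![bil _ _ _ _]mxE mulmxDl [X in _ * X]mxE mulrDr. Qed.

Lemma quadD z h : quad (z + h) = quad z + h *m jac z + bil h h.
Proof.
rewrite mul_jac /quad mulmxDl bilDl !bilDr.
by apply/rowP => j; rewrite !addmxE; ring.
Qed.

Lemma mul_jacD h z k : h *m jac (z + k) = h *m jac z + (bil k h + bil h k).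
Proof. rewrite !mul_jac bilDl bilDr.
by apply/rowP => j; rewrite !addmxE; ring.
 Qed.

(** Quantitative invertibility of the Jacobian: the constant drops by at most [2 K nrm h] under a
    displacement [h], which makes the radii below uniform. *)
Definition nondeg (c : R) z := forall h : 'rV[C]_n, c * nrm h <= nrm (h *m jac z).

Lemma nondeg_unit c z : 0 < c -> nondeg c z -> jac z \in unitmx.
Proof.
move=> c0 cz; rewrite -row_free_unit; apply/inj_row_free => h hz.
have := cz h; rewrite hz nrm0 pmulr_rle0 // => h0; apply/eqP.
by rewrite -(nrm_eq0 nc) eq_le h0 nrm_ge0.
Qed.

Lemma unit_nondeg z : jac z \in unitmx -> exists2 c, 0 < c & nondeg c z.
Proof.
move=> uz; exists (nrm (invmx (jac z)) + 1)^-1.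
  by rewrite invr_gt0 ltr_wpDl ?nrm_ge0.
move=> h; rewrite mulrC ler_pdivrMr ?ltr_wpDl ?nrm_ge0 //.
rewrite -{1}(mulmxK uz h); apply: le_trans (nrmM _ _) _.
by rewrite ler_wpM2l ?nrm_ge0 // lerDl.
Qed.

Lemma nondegD c z h k : nondeg c z ->
  (c - 2 * K * nrm h) * nrm k <= nrm (k *m jac (z + h)).
Proof.
move=> /(_ k) cz; rewrite mul_jacD.
have := nrmBrev (nc:=nc) (k *m jac z) (- (bil h k + bil k h)).
rewrite nrmN opprK; have := nrmD (nc:=nc) (bil h k) (bil k h).
have := nrm_bil h k; have := nrm_bil k h.
rewrite [nrm k * nrm h]mulrC mulrBl -!mulrA.
set x := nrm h * nrm k; lra.
Qed.

Lemma nondeg_near c d z h : nondeg c z -> d <= c - 2 * K * nrm h -> nondeg d (z + h).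
Proof.
move=> cz dc k; apply: le_trans (nondegD h k cz).
by rewrite ler_wpM2r ?nrm_ge0.
Qed.

(** For [h = z1 - z2], equality of the values means [h *m jac z2 = - bil h h]. The left side has
    norm at least [(c - 2 K rho) nrm h], the right side at most [2 K rho nrm h]; hence the factor
    4. *)
Lemma quad_inj c rho z z1 z2 : nondeg c z -> 4 * K * rho < c ->
  nrm (z1 - z) <= rho -> nrm (z2 - z) <= rho -> quad z1 = quad z2 -> z1 = z2.
Proof.
move=> cz Kc z1z z2z; pose h := z1 - z2.
have z1E : z1 = z2 + h by rewrite addrC subrK.
rewrite z1E quadD -[RHS](addr0 (quad z2)) -addrA.
move/addrI/eqP; rewrite addr_eq0 => /eqP hz.
have [|h0] := boolP (nrm h == 0); first by rewrite nrm_eq0 => /eqP ->; rewrite addr0.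
have {}h0 : 0 < nrm h by rewrite lt_def h0 nrm_ge0.
have := nondegD (z2 - z) h cz; rewrite [z + _]addrC subrK hz nrmN => le1.
have := le_trans le1 (nrm_bil h h); rewrite mulrA ler_pM2r // => le2.
have hrho : nrm h <= 2 * rho.
  have -> : h = (z1 - z) - (z2 - z) by rewrite opprB addrA subrK.
  by apply: le_trans (nrmB _ _) _; lra.
have Khrho : K * nrm h <= K * (2 * rho) by rewrite ler_wpM2l ?bil_const_ge0.
have Kz2 : K * nrm (z2 - z) <= K * rho by rewrite ler_wpM2l ?bil_const_ge0.
by exfalso; lra.
Qed.

Lemma quad_lipschitz z : exists2 L, 0 <= L &
  forall z', nrm (z' - z) <= 1 -> nrm (quad z' - quad z) <= L * nrm (z' - z).
Proof.
exists (nrm (jac z) + K); first by rewrite addr_ge0 ?nrm_ge0 ?bil_const_ge0.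
move=> z' z1; rewrite -{1}(subrK z z') [_ + z]addrC quadD addrAC [quad z + _]addrC addrK.
set h := z' - z in z1 *; apply: le_trans (nrmD _ _) _; rewrite mulrDl lerD //.
  by rewrite mulrC nrmM.
apply: le_trans (nrm_bil _ _) _; rewrite ler_wpM2l ?bil_const_ge0 //.
by rewrite ler_piMr ?nrm_ge0.
Qed.

(** Minimize the residual over the ball of radius [rho]. On the sphere it exceeds
    [c rho - c rho / 4 - c rho / 4], more than at the centre, so the minimum is interior; there a
    damped Newton step would decrease a positive residual. *)
Lemma quad_surj c rho z mu : 0 < c -> 0 < rho -> nondeg c z -> 4 * K * rho < c ->
  nrm (mu - quad z) < c * rho / 4 -> exists2 z', nrm (z' - z) <= rho & quad z' = mu.
Proof.
move=> c0 rho0 cz Kc muz.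
pose f h := nrm (quad (z + h) - mu).
have [| | |h hrho hmin] := @ball_min R C nc nc_compact n rho f.
- exact: ltW.
- by move=> h; apply: nrm_ge0.
- move=> h e e0; have [L L0 LP] := quad_lipschitz (z + h).
  exists (Num.min 1 (e / (L + 1))).
    by rewrite lt_min ltr01 divr_gt0 // ltr_wpDl.
  move=> h'; rewrite lt_min => /andP[h'1 h'e].
  have zE : z + h' - (z + h) = h' - h by rewrite opprD addrACA subrr add0r.
  have := LP (z + h'); rewrite zE => /(_ (ltW h'1)) le1.
  have := nrmBrev (nc:=nc) (quad (z + h) - mu) (quad (z + h') - mu).
  rewrite opprB addrA subrK [leRHS]nrm_distrC => le2.
  have : L * nrm (h' - h) <= e.
    apply: (@le_trans _ _ ((L + 1) * nrm (h' - h))).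
      by rewrite ler_wpM2r ?nrm_ge0 // lerDl.
    by rewrite mulrC -ler_pdivlMr ?ltW // ltr_wpDl.
  rewrite /f; lra.
exists (z + h); first by rewrite addrC addKr.
apply/eqP; rewrite -subr_eq0 -(nrm_eq0 nc) -/(f h); apply: contraT => fh0.
have {}fh0 : 0 < f h by rewrite lt_def fh0 nrm_ge0.
have fle : f h < c * rho / 4.
  by apply: le_lt_trans (hmin 0 _) _; rewrite ?nrm0 ?ltW // /f addr0 nrm_distrC.
have hlt : nrm h < rho.
  rewrite lt_neqAle hrho andbT; apply/negP => /eqP hE.
  have := cz h; have := nrm_bil h h; rewrite hE.
  have : K * (rho * rho) <= c / 4 * rho.
    by rewrite mulrA ler_wpM2r ?ltW //; lra.
  have := nrmBrev (nc:=nc) (h *m jac z + bil h h) (mu - quad z).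
  have := nrmBrev (nc:=nc) (h *m jac z) (- bil h h).
  rewrite nrmN opprK.
  have -> : h *m jac z + bil h h - (mu - quad z) = quad (z + h) - mu.
    by rewrite quadD; apply/rowP => j; rewrite !mxE; ring.
  rewrite -/(f h). lra.
have cz2 : nondeg (c / 2) (z + h).
  apply: nondeg_near cz _; have : K * nrm h <= K * rho by rewrite ler_wpM2l ?bil_const_ge0.
  rewrite /f; lra.
have ujac := nondeg_unit (divr_gt0 c0 (ltr0Sn _ 1)) cz2.
pose k := (mu - quad (z + h)) *m invmx (jac (z + h)).
pose M := K * (nrm k * nrm k).
have M0 : 0 <= M by rewrite !mulr_ge0 ?nrm_ge0.
(* The three bounds make [s] a damping factor, keep the step in the ball, and make the quadratic
   error [s ^ 2 M] at most half of the gain [s (f h)]. *)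
pose s := Num.min 1 (Num.min ((rho - nrm h) / (nrm k + 1)) (f h / (2 * (M + 1)))).
have s0 : 0 < s.
  rewrite !lt_min ltr01 !divr_gt0 ?subr_gt0 ?mulr_gt0 ?ltr_wpDl ?nrm_ge0 //.
have s1 : s <= 1 by rewrite ge_min lexx.
have sk : s * nrm k <= rho - nrm h.
  apply: (@le_trans _ _ (s * (nrm k + 1))); first by rewrite ler_wpM2l ?ltW // ltrDl.
  by rewrite -ler_pdivlMr ?ltr_wpDl ?nrm_ge0 // !ge_min lexx orbT.
have sM : s * M <= f h / 2.
  apply: (@le_trans _ _ (s * (M + 1))); first by rewrite ler_wpM2l ?ltW // ltrDl.
  have : s <= f h / (2 * (M + 1)) by rewrite !ge_min lexx !orbT.
  rewrite ler_pdivlMr ?mulr_gt0 ?ltr_wpDl //; lra.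
have [sc ncs nc1s] : exists2 c, nc c = s & nc (1 - c) = 1 - s.
  by apply: av_unit_itv; rewrite s1 ltW.
have : f h <= f (h + sc *: k).
  apply: hmin; apply: le_trans (nrmD _ _) _; rewrite nrmZ ncs; lra.
have -> : f (h + sc *: k) =
    nrm ((1 - sc) *: (quad (z + h) - mu) + bil (sc *: k) (sc *: k)).
  rewrite /f addrA (quadD (z + h)) -scalemxAl /k mulmxKV // scalerBl scale1r.
  by congr nrm; apply/rowP => j; rewrite !mxE; ring.
move=> /le_trans /(_ (nrmD _ _)); rewrite nrmZ nc1s -/(f h).
move=> /le_trans /(_ (lerD (lexx _) (nrm_bil _ _))); rewrite !nrmZ ncs.
have -> : K * (s * nrm k * (s * nrm k)) = s * (s * M) by rewrite /M; ring.
have : s * (s * M) <= s * (f h / 2) by rewrite ler_wpM2l ?(ltW s0).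
  have := mulr_gt0 s0 fh0; lra.
Qed.

End Newton.

(** * Algebraic dependence *)

Lemma horner_mmap (C : fieldType) n (h : 'I_n -> {poly C}) (p : {mpoly C[n]}) t :
  (mmap polyC h p).[t] = p.@[fun i => (h i).[t]].
Proof.
rewrite mevalE /mmap horner_sum; apply: eq_bigr => m _.
rewrite hornerCM; congr (_ * _); rewrite /mmap1 horner_prod.
by apply: eq_bigr => i _; rewrite horner_exp.
Qed.

Lemma mpoly_line (C : fieldType) n (p : {mpoly C[n]}) (v w : 'I_n -> C) :
  exists q : {poly C}, forall t, q.[t] = p.@[fun i => v i + t * w i].
Proof.
exists (mmap polyC (fun i => (v i)%:P + (w i)%:P * 'X) p) => t.
by rewrite horner_mmap; apply: meval_eq => i; rewrite !hornerE mulrC.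
Qed.

Lemma digits_inj D n (a b : 'I_n -> nat) :
  (forall i, a i < D)%N -> (forall i, b i < D)%N ->
  (\sum_i a i * D ^ i = \sum_i b i * D ^ i)%N -> a =1 b.
Proof.
elim: n a b => [|n IH] a b aD bD; first by move=> _ [].
have shift (c : 'I_n.+1 -> nat) :
    (\sum_i c i * D ^ i = (\sum_i c (lift ord0 i) * D ^ i) * D + c ord0)%N.
  rewrite big_ord_recl expn0 muln1 addnC big_distrl /=; congr (_ + _)%N.
  by apply: eq_bigr => i _; rewrite -mulnA -expnSr.
rewrite !shift => E; have D0 : (0 < D)%N by exact: leq_ltn_trans (aD ord0).
have E0 : a ord0 = b ord0.
  by move/(congr1 (fun x => x %% D)%N): E; rewrite !modnMDl !modn_small.
have E1 : a \o lift ord0 =1 b \o lift ord0.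
  apply: IH => [i|i|]; [exact: aD|exact: bD|].
  by move/eqP: E; rewrite E0 eqn_add2r eqn_pmul2r // => /eqP.
by move=> i; case: (unliftP ord0 i) => [j ->|->] //; apply: E1.
Qed.

(* Kronecker's substitution sends distinct monomials of degree less than [D] to
   distinct powers of one variable. *)
Lemma mpoly_kronecker (C : fieldType) n (p : {mpoly C[n]}) : p != 0 ->
  exists D (q : {poly C}), q != 0 /\
    forall t, q.[t] = p.@[fun i : 'I_n => t ^+ (D ^ i)].
Proof.
move=> p0; pose D := msize p.
exists D, (mmap polyC (fun i : 'I_n => 'X^(D ^ i)) p); split; last first.
  by move=> t; rewrite horner_mmap; apply: meval_eq => i; rewrite hornerXn.
have [m mp] : exists m, m \in msupp p.
  by exists (mlead p); apply: mlead_supp.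
pose e (m : 'X_{1..n}) := (\sum_i m i * D ^ i)%N.
apply: contraTneq mp => /(congr1 (fun q : {poly C} => q`_(e m))).
have mmapE' m' : mmap1 (fun i : 'I_n => 'X^(D ^ i)) m' = 'X^(e m') :> {poly C}.
  rewrite /mmap1 /e; elim/big_rec2: _ => [|i x y _ ->]; first by rewrite expr0.
  by rewrite -exprM -exprD mulnC.
rewrite coef0 /mmap coef_sum; under eq_bigr do rewrite mmapE' coefCM coefXn.
have bound m' : m' \in msupp p -> forall i, (m' i < D)%N.
  move=> /msize_mdeg_lt m'D i; apply: leq_ltn_trans m'D.
  by rewrite mdegE (bigD1 i) //= leq_addr.
case: (boolP (m \in msupp p)) => // mp.
rewrite (bigD1_seq m) //= eqxx mulr1 big_seq_cond big1 ?addr0 => [pm|m' /andP[m'p m'm]].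
  by move: mp; rewrite mcoeff_msupp pm eqxx.
case: eqP => [|_]; last by rewrite mulr0.
move=> /(digits_inj (bound _ mp) (bound _ m'p)) mm'.
by case/eqP: m'm; apply/mnmP => i; rewrite mm'.
Qed.

(** Counting for the next lemma: [N ^ n] products with exponents below [N] of [n] polynomials of
    size at most [d] only involve [(n N d + 1) ^ k] monomials in [k] variables, and this grows like
    [N ^ k]. *)
Lemma expn_gt_box n k d : (k < n)%N ->
  exists N, ((n * N * d).+1 ^ k < N ^ n)%N.
Proof.
move=> kn; pose N := ((n * d).+1 ^ k).+1; exists N.
apply: (@leq_ltn_trans (N ^ k * (n * d).+1 ^ k)); last first.
  apply: (@leq_trans (N ^ k.+1)).
    by rewrite expnSr ltn_pmul2l ?expn_gt0.
  by rewrite leq_pexp2l.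
rewrite -expnMn; case: (posnP k) => [->|k0]; rewrite ?expn0 // leq_exp2r //.
by rewrite mulnS -add1n mulnAC [(N * _)%N]mulnC leq_add.
Qed.

Lemma msizeM_leq (C : fieldType) n (p q : {mpoly C[n]}) :
  (msize (p * q) <= (msize p + msize q).-1)%N.
Proof.
have [->|p0] := eqVneq p 0; first by rewrite mul0r msize0.
have [->|q0] := eqVneq q 0; first by rewrite mulr0 msize0.
by rewrite msizeM.
Qed.

Section AlgebraicDependence.
Variables (C : fieldType) (n k : nat) (psi : 'I_n -> {mpoly C[k]}).
Hypothesis kn : (k < n)%N.

Let sub (m : 'X_{1..n}) : {mpoly C[k]} := \prod_i psi i ^+ m i.

(** There are more products of the [psi i] than monomials for them to involve, so the matrix of
    their coefficients has a nonzero left kernel vector, whose entries are the coefficients of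
    [h]. *)
Lemma mpoly_relation : exists2 h : {mpoly C[n]}, h != 0 & mmap (@mpolyC k C) psi h = 0.
Proof.
pose d := (\max_i msize (psi i))%N.
have [N HN] := expn_gt_box d kn.
pose I := {ffun 'I_n -> 'I_N}; pose J := {ffun 'I_k -> 'I_(n * N * d).+1}.
pose mI (a : I) := [multinom (a i : nat) | i < n].
pose mJ (a : J) := [multinom (a i : nat) | i < k].
have size_exp (p : {mpoly C[k]}) j : (msize p <= d)%N -> (msize (p ^+ j) <= (j * d).+1)%N.
  move=> pd; elim: j => [|j IH]; first by rewrite expr0 msize1.
  rewrite exprS; apply: leq_trans (msizeM_leq _ _) _.
  by rewrite mulSn; lia.
have size_sub (a : I) : (msize (sub (mI a)) <= (n * N * d).+1)%N.
  apply: (@leq_trans (\sum_i (mI a i * d)).+1).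
    rewrite /sub; elim/big_rec2: _ => [|i x y _ yx]; first by rewrite msize1.
    apply: leq_trans (msizeM_leq _ _) _.
    by have := @size_exp (psi i) (mI a i) (leq_bigmax i); lia.
  rewrite ltnS -big_distrl /= leq_mul2r; apply/orP; right.
  apply: (@leq_trans (\sum_(i < n) N)); last by rewrite sum_nat_const card_ord.
  by apply: leq_sum => i _; rewrite mnmE ltnW.
pose M : 'M[C]_(#|I|, #|J|) := \matrix_(a, b) (sub (mI (enum_val a)))@_(mJ (enum_val b)).
have kM0 : kermx M != 0.
  rewrite -mxrank_eq0 mxrank_ker -lt0n subn_gt0.
  apply: leq_ltn_trans (rank_leq_col M) _.
  by rewrite !card_ffun !card_ord.
pose v := nz_row (kermx M).
have v0 : v != 0 by rewrite nz_row_eq0.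
have vM : v *m M = 0 by apply: sub_kermxP; apply: nz_row_sub.
pose h : {mpoly C[n]} := \sum_a v 0 a *: 'X_[mI (enum_val a)].
have mI_inj : injective mI.
  by move=> a b /mnmP ab; apply/ffunP => i; apply: val_inj; have := ab i; rewrite !mnmE.
have hE a : h@_(mI (enum_val a)) = v 0 a.
  rewrite /h raddf_sum (bigD1 a) //= mcoeffZ mcoeffX eqxx mulr1 big1 ?addr0 // => b ba.
  rewrite mcoeffZ mcoeffX; case: eqP => [/mI_inj /enum_val_inj E|_]; last by rewrite mulr0.
  by rewrite E eqxx in ba.
exists h.
  apply: contraNneq v0 => h0; apply/eqP/rowP => a.
  by rewrite -hE h0 mcoeff0 mxE.
have -> : mmap (@mpolyC k C) psi h = \sum_a v 0 a *: sub (mI (enum_val a)).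
  rewrite /h raddf_sum; apply: eq_bigr => a _ /=.
  by rewrite mmapZ mmapX mul_mpolyC.
apply/mpolyP => m; rewrite mcoeff0 raddf_sum /=.
under eq_bigr do rewrite mcoeffZ.
have [mK | [i ni] ] : (forall i, m i < (n * N * d).+1)%N \/ exists i, ~~ (m i < (n * N * d).+1)%N.
- have [mK|nmK] := pselect (forall i, m i < (n * N * d).+1)%N; first by left.
  by right; apply: contrapT => nex; apply: nmK => i; apply: contraT => ni; case: nex; exists i.
- pose b : J := [ffun i => Ordinal (mK i)].
  have -> : m = mJ (enum_val (enum_rank b)).
    by rewrite enum_rankK; apply/mnmP => i; rewrite mnmE ffunE.
  have /rowP/(_ (enum_rank b)) := vM; rewrite !mxE => {2}<-.
  by apply: eq_bigr => a _; rewrite mxE.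
- move: ni; rewrite -leqNgt => mi; apply: big1 => a _.
  rewrite [X in _ * X]memN_msupp_eq0 ?mulr0 // msize_mdeg_ge //.
  apply: leq_trans (size_sub _) (leq_trans mi _).
  by rewrite mdegE (bigD1 i) //= leq_addr.
Qed.

(* Dividing a relation by the largest possible power of the variable [f0] leaves
   a relation which stays nontrivial at [X_f0 = 0]. *)
Lemma mpoly_elimination (f0 : 'I_n) : psi f0 != 0 ->
  exists G : {mpoly C[n]}, [/\ G != 0,
    forall v w : 'I_n -> C, (forall i, i != f0 -> v i = w i) -> G.@[v] = G.@[w] &
    forall z : 'I_k -> C, (psi f0).@[z] = 0 -> G.@[fun i => (psi i).@[z]] = 0].
Proof.
move=> psi0; have [h h0 hpsi] := mpoly_relation.
have [m0 m0h m0min] : exists2 m0, m0 \in msupp h & forall m, m \in msupp h -> (m0 f0 <= m f0)%N.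
  have ex : exists c, has (fun m : 'X_{1..n} => m f0 == c) (msupp h).
    exists (mlead h f0); apply/hasP; exists (mlead h) => //; exact: mlead_supp.
  have [c /hasP[m mh /eqP mc] cmin] := ex_minnP ex.
  exists m => // m' m'h; rewrite mc; apply: cmin; apply/hasP; by exists m'.
set c := m0 f0 in m0min.
pose red (m : 'X_{1..n}) : 'X_{1..n} := (m - U_(f0) *+ c)%MM.
have redE m i : red m i = if i == f0 then (m i - c)%N else m i.
  rewrite mnmBE mulmnE mnm1E eq_sym; case: eqP => _; first by rewrite mul1n.
  by rewrite mul0n subn0.
have redK m : m \in msupp h -> (red m + U_(f0) *+ c = m)%MM.
  move=> mh; apply/mnmP => i; rewrite mnmDE redE mulmnE mnm1E eq_sym.
  by have [<-|_] := eqVneq f0 i; rewrite ?mul1n ?mul0n ?addn0 // subnK // m0min.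
pose h' : {mpoly C[n]} := \sum_(m <- msupp h) h@_m *: 'X_[red m].
pose G : {mpoly C[n]} := \sum_(m <- msupp h | m f0 == c) h@_m *: 'X_[red m].
have hE : h = h' * 'X_f0 ^+ c.
  rewrite {1}[h]mpolyE mulr_suml big_seq [RHS]big_seq; apply: eq_bigr => m mh.
  by rewrite -scalerAl mpolyXn -mpolyXD redK.
have h'psi : mmap (@mpolyC k C) psi h' = 0.
  move: hpsi; rewrite hE rmorphM rmorphXn /= mmapX mmap1U => /eqP.
  by rewrite mulf_eq0 expf_eq0 (negPf psi0) andbF orbF => /eqP.
exists G; split.
- have : G@_(red m0) != 0.
    rewrite raddf_sum /= big_mkcond (bigD1_seq m0) //= -/c eqxx mcoeffZ mcoeffX eqxx mulr1.
    rewrite big_seq_cond big1 ?addr0 -?mcoeff_msupp // => m /andP[mh mm0].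
    case: eqP => // mc; rewrite mcoeffZ mcoeffX; case: eqP => [E|_]; last by rewrite mulr0.
    by case/eqP: mm0; rewrite -(redK _ mh) -(redK _ m0h) E.
  by apply: contraNneq => ->; rewrite mcoeff0.
- move=> v w vw; rewrite !raddf_sum; apply: eq_bigr => m /eqP mc /=.
  rewrite !mevalZ !mevalX; congr (_ * _); apply: eq_bigr => i _.
  have [->|/vw -> //] := eqVneq i f0.
  by rewrite redE eqxx mc subnn !expr0.
- move=> z z0; transitivity (mmap (@mpolyC k C) psi h').@[z]; last by rewrite h'psi meval0.
  have -> : (mmap (@mpolyC k C) psi h').@[z] = h'.@[fun i => (psi i).@[z]].
    rewrite [RHS]mevalE /mmap raddf_sum /=; apply: eq_bigr => m _.
    rewrite mevalM mevalC /mmap1 rmorph_prod; congr (_ * _).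
    by apply: eq_bigr => i _; rewrite rmorphXn.
  rewrite !raddf_sum /= big_mkcond big_seq [RHS]big_seq; apply: eq_bigr => m mh.
  case: eqP => // /eqP mc; rewrite mevalZ mevalX (bigD1 f0) //= redE eqxx z0.
  have : (0 < m f0 - c)%N by rewrite subn_gt0 ltn_neqAle eq_sym mc m0min.
  by case: (m f0 - c)%N => // j _; rewrite expr0n mul0r mulr0.
Qed.

End AlgebraicDependence.

(** * The equations x_e y_e = lam_e *)

Section Solutions.
Variables (C : fieldType) (k e : nat) (A : 'M[C]_(k, e)) (f0 : 'I_e).

(** [x_f0 = 1] picks one pair in a class [(c x, y / c)]. It also balances the count: the two
    subspaces have total dimension [e], while the [e] product equations are dependent once [lam] has
    sum zero. *)
Definition sol (lam : 'rV[C]_e) (p : 'rV[C]_e * 'rV[C]_e) :=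
  [/\ (p.1 <= A)%MS, p.2 *m A^T = 0, p.1 0 f0 = 1 &
      forall i, p.1 0 i * p.2 0 i = lam 0 i].

(** Nondegeneracy as injectivity of the linearized system, free of coordinates so that it passes
    between a matrix, its deletion and its contraction. *)
Definition simple (p : 'rV[C]_e * 'rV[C]_e) := forall dx dy : 'rV[C]_e,
  (dx <= A)%MS -> dy *m A^T = 0 -> dx 0 f0 = 0 ->
  (forall i, p.1 0 i * dy 0 i + dx 0 i * p.2 0 i = 0) -> dx = 0 /\ dy = 0.

Lemma mulmx_sum_eq0 (x y : 'rV[C]_e) : (x <= A)%MS -> y *m A^T = 0 ->
  \sum_i x 0 i * y 0 i = 0.
Proof.
move=> /submxP[u ->] yA; transitivity ((u *m A *m y^T) 0 0).
  by rewrite [RHS]mxE; apply: eq_bigr => i _; rewrite [y^T _ _]mxE.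
by rewrite -mulmxA -[A *m _]trmxK trmx_mul trmxK yA trmx0 mulmx0 mxE.
Qed.

Let r := \rank A.
Let S := row_ebase A.
(** The first [r] rows of [S] span L, and the remaining vectors of the dual basis span its
    orthogonal; [z] thus parametrizes pairs [(x, y)] bijectively by [(z *m par1, z *m par2)]. *)
Definition par1 : 'M[C]_e := pid_mx r *m S.
Definition par2 : 'M[C]_e := copid_mx r *m (invmx S)^T.

Let uS : S \in unitmx. Proof. exact: row_ebase_unit. Qed.
Let re : (r <= e)%N. Proof. exact: rank_leq_col. Qed.
Let rk : (r <= k)%N. Proof. exact: rank_leq_row. Qed.

Lemma par1_sub (z : 'rV[C]_e) : (z *m par1 <= A)%MS.
Proof.
have -> : par1 = (pid_mx r : 'M_(e, k)) *m invmx (col_ebase A) *m A.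
  rewrite -{2}(mulmx_ebase A) !mulmxA mulmxKV ?col_ebase_unit // /par1.
  by rewrite mul_pid_mx minnn (minn_idPr _).
by rewrite !mulmxA submxMl.
Qed.

Lemma par2_orth (z : 'rV[C]_e) : z *m par2 *m A^T = 0.
Proof.
rewrite -[A in A^T](mulmx_ebase A) !trmx_mul /par2 tr_pid_mx -/r -/S !mulmxA.
rewrite -[_ *m (invmx S)^T *m S^T]mulmxA -trmx_mul mulmxV // trmx1 mulmx1.
by rewrite -[z *m copid_mx r *m _]mulmxA mul_copid_mx_pid // mulmx0 mul0mx.
Qed.

Lemma par_surj (x y : 'rV[C]_e) : (x <= A)%MS -> y *m A^T = 0 ->
  exists2 z, z *m par1 = x & z *m par2 = y.
Proof.
move=> /submxP[u xE] yA.
have yS : y *m S^T *m (pid_mx r : 'M_e) = 0.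
  have -> : (pid_mx r : 'M[C]_e) = (pid_mx r : 'M_(e, k)) *m (pid_mx r : 'M_(k, e)).
    by rewrite mul_pid_mx minnn (minn_idPr rk).
  rewrite mulmxA; suff -> : y *m S^T *m (pid_mx r : 'M_(e, k)) = 0 by rewrite mul0mx.
  move: yA; rewrite -[A in A^T](mulmx_ebase A) !trmx_mul tr_pid_mx -/r -/S !mulmxA.
  move/(congr1 (mulmx^~ (invmx (col_ebase A)^T))).
  by rewrite mulmxK ?mul0mx // unitmx_tr col_ebase_unit.
exists (x *m invmx S + y *m S^T).
  have xS : x *m invmx S *m pid_mx r = x *m invmx S.
    rewrite xE -{1 2}(mulmx_ebase A) -/r -/S !mulmxA mulmxK //.
    by rewrite -[_ *m pid_mx r *m pid_mx r]mulmxA mul_pid_mx minnn (minn_idPr re).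
  by rewrite mulmxDl /par1 !mulmxA xS yS mul0mx addr0 mulmxKV.
have xS : x *m invmx S *m copid_mx r = 0.
  rewrite xE -{1}(mulmx_ebase A) -/r -/S !mulmxA mulmxK //.
  by rewrite -[_ *m pid_mx r *m _]mulmxA mul_pid_mx_copid // mulmx0.
rewrite mulmxDl /par2 !mulmxA xS mul0mx add0r /copid_mx mulmxBr mulmx1 yS subr0.
by rewrite -mulmxA -trmx_mul mulVmx // trmx1 mulmx1.
Qed.

Lemma par_inj (z : 'rV[C]_e) : z *m par1 = 0 -> z *m par2 = 0 -> z = 0.
Proof.
rewrite /par1 /par2 !mulmxA => /(congr1 (mulmx^~ (invmx S))).
rewrite mulmxK // mul0mx => z1.
move/(congr1 (mulmx^~ S^T)); rewrite -mulmxA -trmx_mul mulmxV // trmx1 mulmx1 mul0mx.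
by rewrite /copid_mx mulmxBr z1 mulmx1 subr0.
Qed.

(** The product in column [f0] is blanked here, and [sysT] puts the linear form [x_f0] in its
    place. *)
Definition sysP : 'M[C]_e := \matrix_(i, j) if j == f0 then 0 else par1 i j.
Definition sysT : 'M[C]_e := \matrix_(i, j) if j == f0 then par1 i j else 0.
Definition target (lam : 'rV[C]_e) : 'rV[C]_e :=
  \row_j if j == f0 then 1 else lam 0 j.

Lemma mul_sysP (z : 'rV[C]_e) j : (z *m sysP) 0 j = if j == f0 then 0 else (z *m par1) 0 j.
Proof.
rewrite !mxE; under eq_bigr do rewrite mxE.
by case: eqP => // _; rewrite big1 // => i _; rewrite mulr0.
Qed.

Lemma mul_sysT (z : 'rV[C]_e) j : (z *m sysT) 0 j = if j == f0 then (z *m par1) 0 j else 0.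
Proof.
rewrite !mxE; under eq_bigr do rewrite mxE.
by case: eqP => // _; rewrite big1 // => i _; rewrite mulr0.
Qed.

Lemma quadE (z : 'rV[C]_e) j : quad sysP par2 sysT z 0 j =
  if j == f0 then (z *m par1) 0 j else (z *m par1) 0 j * (z *m par2) 0 j.
Proof.
rewrite [LHS]mxE [bil _ _ _ _ _ _]mxE mul_sysP mul_sysT.
by case: eqP => _; rewrite ?mul0r ?addr0 ?add0r.
Qed.

Lemma mul_jacE (h z : 'rV[C]_e) j : (h *m jac sysP par2 sysT z) 0 j =
  if j == f0 then (h *m par1) 0 j else
  (z *m par1) 0 j * (h *m par2) 0 j + (h *m par1) 0 j * (z *m par2) 0 j.
Proof.
rewrite mul_jac [LHS]mxE [X in _ + X]mxE ![bil _ _ _ _ _ _]mxE !mul_sysP !mul_sysT.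
by case: eqP => _; rewrite ?mul0r ?addr0 ?add0r.
Qed.

(** The dropped equation at [f0] is recovered from the others: the [x_i y_i] sum to zero by
    orthogonality, and so do the [lam_i]. *)
Lemma sol_quad (lam z : 'rV[C]_e) : \sum_i lam 0 i = 0 ->
  sol lam (z *m par1, z *m par2) <-> quad sysP par2 sysT z = target lam.
Proof.
move=> lam0; split => [[_ _ /= x1 xy]|zE].
  by apply/rowP => j; rewrite quadE [X in _ = X]mxE; case: eqP => [->|_]; [exact: x1|exact: xy].
have zE' j := congr1 (fun v : 'rV[C]_e => v 0 j) zE.
have x1 : (z *m par1) 0 f0 = 1 by have := zE' f0; rewrite quadE [X in _ = X]mxE eqxx.
have xy j : j != f0 -> (z *m par1) 0 j * (z *m par2) 0 j = lam 0 j.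
  by move=> jf0; have := zE' j; rewrite quadE [X in _ = X]mxE (negPf jf0).
split; rewrite /= ?par1_sub ?par2_orth // => i.
have [->|/xy //] := eqVneq i f0.
have := mulmx_sum_eq0 (par1_sub z) (par2_orth z).
rewrite (bigD1 f0) //= (eq_bigr _ xy) => /eqP; rewrite addr_eq0 => /eqP ->.
by move/eqP: lam0; rewrite (bigD1 f0) //= addr_eq0 => /eqP ->.
Qed.

Lemma simple_jac (z : 'rV[C]_e) : (z *m par1) 0 f0 = 1 ->
  simple (z *m par1, z *m par2) <-> jac sysP par2 sysT z \in unitmx.
Proof.
move=> x1; split => [sz|uz dx dy dxA dyA dx0 /= dxy].
  rewrite -row_free_unit; apply/inj_row_free => h hz.
  have hE j := congr1 (fun v : 'rV[C]_e => v 0 j) hz.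
  have h0 : (h *m par1) 0 f0 = 0 by have := hE f0; rewrite mul_jacE [X in _ = X]mxE eqxx.
  have xy j : j != f0 ->
    (z *m par1) 0 j * (h *m par2) 0 j + (h *m par1) 0 j * (z *m par2) 0 j = 0.
    by move=> jf0; have := hE j; rewrite mul_jacE [X in _ = X]mxE (negPf jf0).
  suff [] : h *m par1 = 0 /\ h *m par2 = 0 by apply: par_inj.
  apply: sz; rewrite ?par1_sub ?par2_orth //= => i.
  have [->|/xy //] := eqVneq i f0.
  have : \sum_j ((z *m par1) 0 j * (h *m par2) 0 j +
                 (h *m par1) 0 j * (z *m par2) 0 j) = 0.
    rewrite big_split /= !mulmx_sum_eq0 ?addr0 //;
      by [exact: par1_sub|exact: par2_orth].
  by rewrite (bigD1 f0) //= (eq_bigr _ xy) big1 ?addr0.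
have [h hx hy] := par_surj dxA dyA.
suff h0 : h = 0 by rewrite -hx -hy h0 !mul0mx.
apply: (row_free_inj (A := jac sysP par2 sysT z)); first by rewrite row_free_unit.
rewrite mul0mx; apply/rowP => j; rewrite mul_jacE [RHS]mxE hx hy.
by case: eqP => [->|_]; rewrite ?dx0.
Qed.

(* Off a proper hypersurface of [lam]'s, no solution lies on [q = 0]: restricted to
   the affine space [x_f0 = 1], of dimension [e - 1], the polynomials
   [x_i y_i] ([i != f0]) and [q] are algebraically dependent. *)
Lemma generic_nonvanishing (q : {mpoly C[e]}) (z1 : 'rV[C]_e) :
  (forall p : {poly C}, p != 0 -> exists t, p.[t] != 0) ->
  (z1 *m par1) 0 f0 = 1 -> q.@[z1 0] != 0 ->
  exists G : {mpoly C[e]},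
    (exists2 lam : 'rV[C]_e, \sum_i lam 0 i = 0 & G.@[lam 0] != 0) /\
    forall lam : 'rV[C]_e, G.@[lam 0] != 0 ->
      forall z, sol lam (z *m par1, z *m par2) -> q.@[z 0] != 0.
Proof.
move=> Cinf z11 qz1.
pose K := kermx (col f0 par1); pose B := row_base K.
have z10 : col f0 par1 != 0.
  apply/eqP => c0; move/eqP: z11.
  have -> : (z1 *m par1) 0 f0 = (z1 *m col f0 par1) 0 0.
    by rewrite [LHS]mxE [RHS]mxE; apply: eq_bigr => i _; rewrite [col _ _ _ _]mxE.
  by rewrite c0 mulmx0 mxE eq_sym oner_eq0.
have rK : (\rank K < e)%N.
  rewrite mxrank_ker; have : (0 < \rank (col f0 par1))%N by rewrite lt0n mxrank_eq0.
  have := rank_leq_row (col f0 par1); lia.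
pose L i : {mpoly C[\rank K]} := (z1 0 i)%:MP + \sum_j B j i *: 'X_j.
have LE (v : 'rV[C]_(\rank K)) i : (L i).@[v 0] = (z1 + v *m B) 0 i.
  rewrite mevalD mevalC raddf_sum [RHS]mxE [(v *m B) 0 i]mxE; congr (_ + _).
  by apply: eq_bigr => j _; rewrite /= mevalZ mevalXU mulrC.
have Lsum (M : 'M[C]_e) j (v : 'rV[C]_(\rank K)) :
   (\sum_i M i j *: L i).@[v 0] = ((z1 + v *m B) *m M) 0 j.
  rewrite raddf_sum [RHS]mxE; apply: eq_bigr => i _.
  by rewrite /= mevalZ LE mulrC.
pose psi i : {mpoly C[\rank K]} := if i == f0 then mmap (@mpolyC _ C) L q else
  (\sum_l par1 l i *: L l) * (\sum_l par2 l i *: L l).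
have psi0E (v : 'rV[C]_(\rank K)) : (psi f0).@[v 0] = q.@[(z1 + v *m B) 0].
  rewrite /psi eqxx [RHS]mevalE /mmap raddf_sum /=; apply: eq_bigr => m _.
  rewrite mevalM mevalC /mmap1 rmorph_prod; congr (_ * _).
  by apply: eq_bigr => i _; rewrite rmorphXn /= LE.
have [|G [G0 Gind Gvan]] := @mpoly_elimination _ _ _ psi rK f0.
  apply: contraNneq qz1 => psi0; have := psi0E 0.
  by rewrite psi0 meval0 mul0mx addr0 => <-.
exists G; split.
  have [D [p [p0 pE]]] := mpoly_kronecker G0.
  have [t] := Cinf _ p0; rewrite pE => Gt.
  (* [G] does not depend on the coordinate [f0], which is thus free to make the sum zero. *)
  pose lam : 'rV[C]_e := \row_i if i == f0 then - \sum_(j | j != f0) t ^+ (D ^ j)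
                                else t ^+ (D ^ i).
  exists lam.
    rewrite (bigD1 f0) //= mxE eqxx addrC; apply/eqP; rewrite subr_eq0; apply/eqP.
    by apply: eq_bigr => i /negPf if0; rewrite mxE if0.
  by rewrite (Gind _ (fun i : 'I_e => t ^+ (D ^ i))) // => i /negPf if0; rewrite mxE if0.
move=> lam Glam z [/= xA yA x1 xy]; apply: contraNneq Glam => qz.
have /submxP[v vE] : (z - z1 <= B)%MS.
  rewrite eq_row_base; apply/sub_kermxP; apply/rowP => j; rewrite ord1 mulmxBl.
  have E (u : 'rV[C]_e) : (u *m col f0 par1) 0 0 = (u *m par1) 0 f0.
    by rewrite [LHS]mxE [RHS]mxE; apply: eq_bigr => i _; rewrite [col _ _ _ _]mxE.
  by rewrite [LHS]mxE [X in _ + X]mxE !E x1 z11 subrr mxE.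
have zE : z1 + v *m B = z by rewrite -vE addrC subrK.
rewrite -(Gvan (v 0)); last by rewrite psi0E zE.
apply/eqP; apply: Gind => i if0.
by rewrite /psi (negPf if0) mevalM !Lsum zE -xy.
Qed.

End Solutions.

(** * Local constancy of the number of solutions *)

Definition counted (T : eqType) (P : T -> Prop) (d : nat) :=
  exists s : seq T, [/\ uniq s, size s = d & forall x, x \in s <-> P x].

(** Solutions for two neighbouring values of [lam] are matched by closeness, a relation rather than
    a function; the four conditions make it a bijection. *)
Lemma counted_transfer (T U : eqType) (P : T -> Prop) (Q : U -> Prop)
    (r : T -> U -> Prop) d :
  (forall x, P x -> exists2 y, Q y & r x y) ->
  (forall y, Q y -> exists2 x, P x & r x y) ->
  (forall x y y', P x -> Q y -> Q y' -> r x y -> r x y' -> y = y') ->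
  (forall x x' y, P x -> P x' -> Q y -> r x y -> r x' y -> x = x') ->
  counted P d -> counted Q d.
Proof.
move=> PQ QP rfun rinj [s [us sd sP]].
have [[y0 _]|noU] := pselect (exists y : U, True); last first.
  exists [::]; split=> // [|y]; last by split=> // _; case: noU; exists y.
  case: s us sd sP => // x s _ _ /(_ x) [] /(_ (mem_head _ _)) /PQ[y] _ _ _.
  by case: noU; exists y.
have [f fP] : {f : T -> U & forall x, P x -> Q (f x) /\ r x (f x)}.
  apply: (@boolp.choice _ _ (fun x y => P x -> Q y /\ r x y)) => x; have [/PQ[y]|] := pselect (P x); first by exists y.
  by exists y0.
exists [seq f x | x <- s]; split; rewrite ?size_map //.
  rewrite map_inj_in_uniq // => x x' /sP Px /sP Px' E.
  have [Qx rx] := fP x Px; have [Qx' rx'] := fP x' Px'.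
  by apply: (rinj x x' (f x)) => //; rewrite E.
move=> y; split=> [/mapP[x /sP /fP[Qx _] ->] // | Qy].
have [x Px rx] := QP y Qy; apply/mapP; exists x; first exact/sP.
by have [? ?] := fP x Px; apply: (rfun x).
Qed.

Lemma counted0 (T : eqType) (P : T -> Prop) : (forall x, ~ P x) -> counted P 0.
Proof. by move=> nP; exists [::]; split=> // x; split=> // /nP. Qed.

Lemma counted_sum (T U V : eqType) (P : T -> Prop) (Q : U -> Prop) (W : V -> Prop)
    (f : T -> V) (g : U -> V) d1 d2 :
  injective f -> injective g ->
  (forall x y, P x -> Q y -> f x <> g y) ->
  (forall v, W v <-> (exists2 x, P x & v = f x) \/ (exists2 y, Q y & v = g y)) ->
  counted P d1 -> counted Q d2 -> counted W (d1 + d2).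
Proof.
move=> fI gI fg WE [s [us <- sP]] [s' [us' <- s'P]].
exists ([seq f x | x <- s] ++ [seq g x | x <- s']); split.
- rewrite cat_uniq !map_inj_uniq // us us' andbT /=; apply/hasPn => v /mapP[y /s'P Qy ->].
  by apply/mapP => -[x /sP Px /esym /(fg _ _ Px Qy)].
- by rewrite size_cat !size_map.
- move=> v; rewrite WE mem_cat; split.
    by case/orP => /mapP[x] => [/sP Px ->|/s'P Px ->]; [left|right]; exists x.
  by case=> -[x Px ->]; apply/orP; [left|right]; apply: map_f; [apply/sP|apply/s'P].
Qed.

(** * Polynomials generic on the hyperplane of sum zero *)

Section Generic.
Variables (R : realType) (C : fieldType) (nc : absval R C).
Local Notation nrm := (nrm nc).

(** Elements of absolute values [m / (j + 1)] are distinct and small, and [q] has finitely many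
    roots. *)
Lemma small_nonroot (q : {poly C}) (r : R) : q != 0 -> 0 < r ->
  exists2 t, nc t < r & q.[t] != 0.
Proof.
move=> q0 r0; pose m := Num.min (r / 2) 1.
have m0 : 0 < m by rewrite lt_min divr_gt0 /=.
have m1 : m <= 1 by rewrite ge_min lexx orbT.
have mr : m < r.
  by apply: le_lt_trans (_ : m <= r / 2) _; [rewrite ge_min lexx|lra].
have [f fE] : {f : nat -> C & forall j, nc (f j) = m / j.+1%:R}.
  apply: (@boolp.choice _ _ (fun j t => nc t = m / j.+1%:R)) => j.
  have [|t tE _] := @av_unit_itv _ _ nc (m / j.+1%:R); last by exists t.
  apply/andP; split; first by rewrite divr_ge0 ?ler0n // ltW.
  rewrite ler_pdivrMr ?ltr0n // mul1r.
  by apply: le_trans m1 _; rewrite ler1n.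
apply: contrapT => noroot.
have fr j : root q (f j).
  apply/rootP/eqP; apply: contraT => qj; case: noroot; exists (f j) => //.
  rewrite fE; apply: le_lt_trans mr; rewrite ler_pdivrMr ?ltr0n //.
  by apply: ler_peMr; rewrite ?ler1n // ltW.
have f_inj : injective f.
  move=> i j /(congr1 nc); rewrite !fE => /mulfI; rewrite gt_eqF // => /(_ isT) /invr_inj.
  by move/eqP; rewrite eqr_nat eqSS => /eqP.
have := @max_poly_roots _ q [seq f j | j <- iota 0 (size q)] q0.
rewrite map_inj_uniq // iota_uniq size_map size_iota ltnn => H.
by have : false by apply: H => //; apply/allP => x /mapP[j _ ->].
Qed.

Lemma nonroot_exists (q : {poly C}) : q != 0 -> exists t, q.[t] != 0.
Proof. by move=> /small_nonroot /(_ ltr01)[t _ qt]; exists t. Qed.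

(** Nonvanishing is required on the hyperplane of sum zero, and not just of the polynomial, because
    only such [lam] have solutions. *)
Definition generic e (G : {mpoly C[e]}) :=
  exists2 lam : 'rV[C]_e, \sum_i lam 0 i = 0 & G.@[lam 0] != 0.

Lemma line_poly e (G : {mpoly C[e]}) (lam lam' : 'rV[C]_e) :
  exists q : {poly C}, forall t, q.[t] = G.@[(lam + t *: lam') 0].
Proof.
have [q qE] := mpoly_line G (lam 0) (lam' 0); exists q => t.
by rewrite qE; apply: meval_eq => i; rewrite !mxE.
Qed.

Lemma sum_line e (lam lam' : 'rV[C]_e) t : \sum_i lam 0 i = 0 ->
  \sum_i lam' 0 i = 0 -> \sum_i (lam + t *: (lam' - lam)) 0 i = 0.
Proof.
move=> l0 l0'; under eq_bigr do rewrite !mxE.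
by rewrite big_split /= -mulr_sumr sumrB l0 l0' subrr mulr0 addr0.
Qed.

Lemma generic_near e (G : {mpoly C[e]}) (lam0 : 'rV[C]_e) (c : R) :
  generic G -> \sum_i lam0 0 i = 0 -> 0 < c ->
  exists lam : 'rV[C]_e, [/\ \sum_i lam 0 i = 0, nrm (lam - lam0) < c & G.@[lam 0] != 0].
Proof.
move=> [lam1 l1 G1] l0 c0; have [q qE] := line_poly G lam0 (lam1 - lam0).
have q0 : q != 0.
  apply: contraNneq G1 => q0; have := qE 1.
  by rewrite q0 horner0 scale1r addrC subrK => <-.
have [|t tc qt] := small_nonroot q0 (r := c / (nrm (lam1 - lam0) + 1)).
  by rewrite divr_gt0 // ltr_wpDl ?nrm_ge0.
exists (lam0 + t *: (lam1 - lam0)); split; rewrite -?qE ?sum_line //.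
rewrite addrC addKr nrmZ.
apply: (@le_lt_trans _ _ (nc t * (nrm (lam1 - lam0) + 1))).
  by rewrite ler_wpM2l ?av_ge0 // lerDl.
by rewrite -ltr_pdivlMr // ltr_wpDl ?nrm_ge0.
Qed.

(** On the line joining the two witnesses both factors restrict to nonzero polynomials in one
    variable. *)
Lemma genericM e (G1 G2 : {mpoly C[e]}) : generic G1 -> generic G2 -> generic (G1 * G2).
Proof.
move=> [lam1 l1 H1] [lam2 l2 H2].
have [q1 q1E] := line_poly G1 lam1 (lam2 - lam1).
have [q2 q2E] := line_poly G2 lam1 (lam2 - lam1).
have q10 : q1 != 0.
  by apply: contraNneq H1 => q0; have := q1E 0; rewrite q0 horner0 scale0r addr0 => <-.
have q20 : q2 != 0.
  apply: contraNneq H2 => q0; have := q2E 1.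
  by rewrite q0 horner0 scale1r addrC subrK => <-.
have [t] : exists t, (q1 * q2).[t] != 0 by apply: nonroot_exists; rewrite mulf_neq0.
rewrite hornerM q1E q2E -mevalM => Gt.
by exists (lam1 + t *: (lam2 - lam1)); rewrite ?sum_line.
Qed.

End Generic.

Section LocalConstancy.
Variables (R : realType) (C : fieldType) (nc : absval R C).
Hypothesis nc_compact : locally_compact nc.
Local Notation nrm := (nrm nc).
Variables (k e : nat) (A : 'M[C]_(k, e)) (f0 : 'I_e).
Local Notation sys := (quad (sysP A f0) (par2 A) (sysT A f0)).
Local Notation sol := (sol A f0).
Local Notation simple := (simple A f0).
Local Notation nondeg := (nondeg nc (sysP A f0) (par2 A) (sysT A f0)).

Implicit Types (lam z : 'rV[C]_e) (B : R).

Definition proper_at (lam0 : 'rV[C]_e) := exists B (d : R), 0 < d /\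
  forall lam (z : 'rV[C]_e), \sum_i lam 0 i = 0 -> nrm (lam - lam0) < d ->
    sol lam (z *m par1 A, z *m par2 A) -> nrm z <= B.

Lemma nrm_target (lam lam' : 'rV[C]_e) :
  nrm (target f0 lam - target f0 lam') <= nrm (lam - lam').
Proof.
rewrite !nrm_rV ler_sum // => j _; rewrite !mxE.
by case: eqP => _ //; rewrite subrr av0 av_ge0.
Qed.

(** A point of the ball either misses the target at [lam0] by a positive amount or is a
    nondegenerate solution. Both alternatives persist nearby, so one [c] serves the whole ball; for
    [lam] closer than [c] to [lam0] a solution cannot fall under the first. *)
Lemma uniform_nondeg (lam0 : 'rV[C]_e) : \sum_i lam0 0 i = 0 -> proper_at lam0 ->
  (forall p, sol lam0 p -> simple p) ->
  exists2 c, 0 < c & forall lam (z : 'rV[C]_e), \sum_i lam 0 i = 0 ->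
    nrm (lam - lam0) < c -> sol lam (z *m par1 A, z *m par2 A) -> nondeg c z.
Proof.
move=> lam00 [B [d [d0 dB]]] simp.
have [||c c0 cP] := @nc_compact e B (fun r z => r <= nrm (sys z - target f0 lam0) \/ nondeg r z).
- move=> r r' z rr' [/(le_trans rr')|zr]; [by left|right => h].
  by apply: le_trans (zr h); rewrite ler_wpM2r ?nrm_ge0.
- move=> z zB; have [E|NE] := eqVneq (sys z) (target f0 lam0).
    have sz := (sol_quad A f0 z lam00).2 E.
    have [_ _ x1 _] := sz.
    have [c c0 cz] := unit_nondeg nc ((simple_jac x1).1 (simp _ sz)).
    set K := nrm (sysP A f0) * nrm (par2 A).
    have K0 : 0 <= K by rewrite mulr_ge0 ?nrm_ge0.
    exists (Num.min (c / 2) (c / (4 * (K + 1)))).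
      by rewrite lt_min !divr_gt0 // mulr_gt0 // ltr_wpDl.
    move=> z' zz'; right; rewrite -(subrK z z') [_ + z]addrC.
    apply: nondeg_near cz _; rewrite -/K.
    set m := Num.min _ _ in zz' *.
    have mc : m <= c / 2 by rewrite ge_min lexx.
    have : m * (4 * (K + 1)) <= c.
      by rewrite -ler_pdivlMr ?mulr_gt0 ?ltr_wpDl // ge_min lexx orbT.
    have := ler_wpM2l K0 (ltW zz'); have : 0 <= m by apply: le_trans (ltW zz'); apply: nrm_ge0.
    lra.
  have [L L0 LP] := quad_lipschitz nc (sysP A f0) (par2 A) (sysT A f0) z.
  set g := nrm (sys z - target f0 lam0).
  have g0 : 0 < g by rewrite lt_def nrm_ge0 nrm_eq0 subr_eq0 NE.
  exists (Num.min 1 (Num.min (g / 2) (g / (2 * (L + 1))))).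
    by rewrite !lt_min ltr01 !divr_gt0 // mulr_gt0 // ltr_wpDl.
  move=> z' zz'; left.
  set m := Num.min _ _ in zz' *.
  have m1 : m <= 1 by rewrite ge_min lexx.
  have mg : m <= g / 2 by rewrite !ge_min lexx !orbT.
  have mL : m * (2 * (L + 1)) <= g.
    by rewrite -ler_pdivlMr ?mulr_gt0 ?ltr_wpDl // !ge_min lexx !orbT.
  have := LP z' (le_trans (ltW zz') m1).
  have := nrmBrev (nc:=nc) (sys z - target f0 lam0) (sys z' - target f0 lam0).
  rewrite opprB addrA subrK [leRHS]nrm_distrC -/g.
  have := ler_wpM2l L0 (ltW zz'); lra.
exists (Num.min d c); first by rewrite lt_min d0.
move=> lam z lam1; rewrite lt_min => /andP[ld lc] sz.
have zB := dB _ _ lam1 ld sz.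
have [|zc h] := cP z zB; last first.
  by apply: le_trans (zc h); rewrite ler_wpM2r ?nrm_ge0 // ge_min lexx orbT.
by rewrite ((sol_quad A f0 z lam1).1 sz) leNgt (le_lt_trans (nrm_target _ _)).
Qed.

Lemma counted_par (lam : 'rV[C]_e) d :
  counted (sol lam) d <-> counted (fun z => sol lam (z *m par1 A, z *m par2 A)) d.
Proof.
split.
  apply: (@counted_transfer _ _ _ _ (fun p z => p = (z *m par1 A, z *m par2 A))).
  - move=> [x y] [/= xA yA x1 xy]; have [z zx zy] := par_surj xA yA.
    by exists z; rewrite zx zy.
  - by move=> z sz; exists (z *m par1 A, z *m par2 A).
  - move=> p z z' _ _ _ -> [E1 E2]; apply/eqP; rewrite -subr_eq0; apply/eqP.
    by apply: (@par_inj _ _ _ A); rewrite mulmxBl ?E1 ?E2 subrr.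
  - by move=> p p' z _ _ _ -> ->.
apply: (@counted_transfer _ _ _ _ (fun z p => p = (z *m par1 A, z *m par2 A))).
- by move=> z sz; exists (z *m par1 A, z *m par2 A).
- move=> [x y] [/= xA yA x1 xy]; have [z zx zy] := par_surj xA yA.
  by exists z; rewrite zx zy.
- by move=> p p' z _ _ _ -> ->.
- move=> z z' p _ _ _ -> [E1 E2]; apply/eqP; rewrite -subr_eq0; apply/eqP.
  by apply: (@par_inj _ _ _ A); rewrite mulmxBl ?E1 ?E2 subrr.
Qed.

(** The Jacobian bound holds at the solutions for every [lam] near [lam0], so being within [rho]
    matches solutions in both directions: [quad_surj] gives existence, [quad_inj] uniqueness. *)
Lemma locally_constant (lam0 : 'rV[C]_e) : \sum_i lam0 0 i = 0 -> proper_at lam0 ->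
  (forall p, sol lam0 p -> simple p) ->
  exists2 c, 0 < c & forall lam lam' n, \sum_i lam 0 i = 0 -> \sum_i lam' 0 i = 0 ->
    nrm (lam - lam0) < c -> nrm (lam' - lam0) < c ->
    counted (sol lam) n -> counted (sol lam') n.
Proof.
move=> lam00 prop simp; have [c c0 cP] := uniform_nondeg lam00 prop simp.
set K := nrm (sysP A f0) * nrm (par2 A).
have K0 : 0 <= K by rewrite mulr_ge0 ?nrm_ge0.
pose rho := c / (4 * (K + 1)).
have rho0 : 0 < rho by rewrite divr_gt0 // mulr_gt0 // ltr_wpDl.
have Krho : 4 * K * rho < c.
  have : rho * (4 * (K + 1)) = c by rewrite divfK // lt0r_neq0 // mulr_gt0 // ltr_wpDl.
  by lra.
(* Two values within [c rho / 8] of [lam0] are within [c rho / 4] of each other, as [quad_surj]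
   demands. *)
exists (Num.min c (c * rho / 8)); first by rewrite lt_min c0 divr_gt0 // mulr_gt0.
have near lam lam' (z : 'rV[C]_e) : \sum_i lam 0 i = 0 -> \sum_i lam' 0 i = 0 ->
    nrm (lam - lam0) < Num.min c (c * rho / 8) ->
    nrm (lam' - lam0) < Num.min c (c * rho / 8) ->
    sol lam (z *m par1 A, z *m par2 A) ->
    exists2 z', sol lam' (z' *m par1 A, z' *m par2 A) & nrm (z - z') <= rho.
  rewrite !lt_min => l0 l0' /andP[lc ld] /andP[lc' ld'] sz.
  have [|z' zz' zE] := @quad_surj _ _ _ _ nc_compact _ _ _ _ _ _ (target f0 lam') c0 rho0 (cP _ _ l0 lc sz) Krho.
    rewrite ((sol_quad A f0 z l0).1 sz); apply: le_lt_trans (nrm_target _ _) _.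
    have -> : lam' - lam = (lam' - lam0) - (lam - lam0) by rewrite opprB addrA subrK.
    by apply: le_lt_trans (nrmB _ _) _; lra.
  by exists z'; [apply/(sol_quad A f0 z' l0')|rewrite nrm_distrC].
have inj lam lam' (z z1 z2 : 'rV[C]_e) : \sum_i lam 0 i = 0 -> \sum_i lam' 0 i = 0 ->
    nrm (lam - lam0) < Num.min c (c * rho / 8) ->
    sol lam (z *m par1 A, z *m par2 A) ->
    sol lam' (z1 *m par1 A, z1 *m par2 A) -> sol lam' (z2 *m par1 A, z2 *m par2 A) ->
    nrm (z1 - z) <= rho -> nrm (z2 - z) <= rho -> z1 = z2.
  rewrite lt_min => l0 l0' /andP[lc _] sz s1 s2 z1z z2z.
  apply: (quad_inj (cP _ _ l0 lc sz) Krho z1z z2z).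
  by rewrite ((sol_quad A f0 z1 l0').1 s1) ((sol_quad A f0 z2 l0').1 s2).
move=> lam lam' n l0 l0' lc lc' /counted_par cl; apply/counted_par.
apply: (counted_transfer (r := fun z z' => nrm (z - z') <= rho)) _ _ _ _ cl.
- by move=> z; apply: near.
- move=> z' /(near _ lam)[] // z sz zz'; exists z => //.
  by rewrite nrm_distrC.
- move=> z z1 z2 sz s1 s2; rewrite nrm_distrC => z1z; rewrite nrm_distrC => z2z.
  exact: (inj lam lam' z).
- by move=> z1 z2 z s1 s2 sz; apply: (inj lam' lam z).
Qed.

Hypothesis nc_connected : punctured_connected nc.

Lemma generic_count_constant (G : {mpoly C[e]}) n lam lam' :
  (forall lam0, \sum_i lam0 0 i = 0 -> G.@[lam0 0] != 0 ->
     proper_at lam0 /\ forall p, sol lam0 p -> simple p) ->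
  \sum_i lam 0 i = 0 -> \sum_i lam' 0 i = 0 -> G.@[lam 0] != 0 -> G.@[lam' 0] != 0 ->
  counted (sol lam) n -> counted (sol lam') n.
Proof.
move=> loc l0 l0' Gl Gl'.
have [q qE] := line_poly G lam (lam' - lam).
pose g t := lam + t *: (lam' - lam).
have g0 : g 0 = lam by rewrite /g scale0r addr0.
have g1 : g 1 = lam' by rewrite /g scale1r addrC subrK.
have sg t : \sum_i g t 0 i = 0 by apply: sum_line.
rewrite -[in X in X -> _]g0 -g1.
apply: (nc_connected (q := q) (Q := fun t => counted (sol (g t)) n));
  rewrite ?qE -/(g _) ?g0 ?g1 // => t; rewrite qE -/(g t) => Gt.
have [prop simp] := loc _ (sg t) Gt.
have [c c0 cP] := locally_constant (sg t) prop simp.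
exists (c / (nrm (lam' - lam) + 1)); first by rewrite divr_gt0 // ltr_wpDl ?nrm_ge0.
move=> t' tt' _.
have near : nrm (g t' - g t) < c.
  rewrite /g opprD addrACA subrr add0r -scalerBl nrmZ.
  apply: (@le_lt_trans _ _ (nc (t' - t) * (nrm (lam' - lam) + 1))).
    by rewrite ler_wpM2l ?av_ge0 // lerDl.
  by rewrite -ltr_pdivlMr // ltr_wpDl ?nrm_ge0.
by split; apply: cP; rewrite ?sg ?subrr ?nrm0.
Qed.

End LocalConstancy.

(** * Properness *)

Section Properness.
Variables (R : realType) (C : fieldType) (nc : absval R C).
Local Notation nrm := (nrm nc).
Variables (k e : nat) (A : 'M[C]_(k, e)) (f0 : 'I_e).
Implicit Types (x y z lam : 'rV[C]_e) (F : {set 'I_e}).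

Lemma finite_pos_lbound (T : finType) (f : T -> R) :
  exists2 c, 0 < c & forall t, 0 < f t -> c <= f t.
Proof.
pose s := \sum_(t | 0 < f t) (f t)^-1.
have s0 : 0 <= s by apply: sumr_ge0 => t /ltW; rewrite invr_ge0.
exists (s + 1)^-1; first by rewrite invr_gt0 ltr_wpDl.
move=> t t0; rewrite -[f t]invrK lef_pV2 ?posrE ?invr_gt0 ?ltr_wpDl //.
apply: (@le_trans _ _ s); last by rewrite lerDl.
rewrite /s (bigD1 t) //= lerDl; apply: sumr_ge0 => i /andP[/ltW].
by rewrite invr_ge0.
Qed.

Definition mask F : 'M[C]_e := diag_mx (\row_j (j \in F)%:R).

Lemma mul_mask m (x : 'M[C]_(m, e)) F i j : (x *m mask F) i j = if j \in F then x i j else 0.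
Proof. by rewrite mul_mx_diag !mxE; case: ifP => _; rewrite ?mulr1 ?mulr0. Qed.

(** A pseudo-inverse of the projection of L to the coordinates in [F] gives the lift; as there are
    finitely many [F], one constant suffices. *)
Lemma bounded_lift : exists2 K, 0 <= K & forall F x, (x <= A)%MS ->
  exists x', [/\ (x' <= A)%MS, forall i, i \in F -> x' 0 i = x 0 i &
     nrm x' <= K * \sum_(i in F) nc (x 0 i)].
Proof.
pose L F := pinvmx (A *m mask F) *m A.
exists (\sum_F nrm (L F)); first by rewrite sumr_ge0 // => F _; apply: nrm_ge0.
move=> F x xA; exists (x *m mask F *m L F); split.
- by rewrite mulmxA submxMl.
- move=> i iF; have : (x *m mask F <= A *m mask F)%MS by apply: submxMr.
  move/mulmxKpV => E; transitivity ((x *m mask F *m L F *m mask F) 0 i).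
    by rewrite mul_mask iF.
  by rewrite /L -mulmxA -(mulmxA _ A) mulmxA E mul_mask iF.
- apply: le_trans (nrmM _ _) _; rewrite mulrC.
  have -> : nrm (x *m mask F) = \sum_(i in F) nc (x 0 i).
    rewrite nrm_rV [RHS]big_mkcond; apply: eq_bigr => i _.
    by rewrite mul_mask; case: ifP => // _; rewrite av0.
  rewrite ler_wpM2r ?sumr_ge0 // => [i _|]; first exact: av_ge0.
  by rewrite (bigD1 F) //= lerDl sumr_ge0 // => *; apply: nrm_ge0.
Qed.

(* If the coordinates of [x] on [F] are much smaller than the others, replace [x] by a
   small vector of [L] with the same coordinates on [F]: orthogonality to [y] turns the
   sum over [F] into a sum over the complement, all of whose terms are small. *)
Lemma gap_bound : exists2 K, 0 <= K & forall F x y (eps : R),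
  (x <= A)%MS -> y *m A^T = 0 -> 0 <= eps ->
  (forall i j, i \in F -> j \notin F -> nc (x 0 i) <= eps * nc (x 0 j)) ->
  nc (\sum_(i in F) x 0 i * y 0 i) <= K * eps * \sum_i nc (x 0 i * y 0 i).
Proof.
have [K K0 KP] := bounded_lift.
exists (K * e%:R); first by rewrite mulr_ge0.
move=> F x y eps xA yA eps0 gap; have [x' [x'A x'F x'K]] := KP F x xA.
have : \sum_(i in F) x 0 i * y 0 i = - \sum_(i | i \notin F) x' 0 i * y 0 i.
  have := mulmx_sum_eq0 x'A yA; rewrite (bigID (mem F)) /= => /eqP.
  by rewrite addr_eq0 => /eqP <-; apply: eq_bigr => i /x'F ->.
move->; rewrite avN; apply: le_trans (av_sum _ _ _ _) _.
rewrite mulr_sumr [leRHS](bigID (mem F)) /= -[leLHS]add0r lerD //.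
  by apply: sumr_ge0 => i _; rewrite !mulr_ge0 ?av_ge0.
apply: ler_sum => j jF; rewrite !avM mulrA ler_wpM2r ?av_ge0 //.
apply: le_trans (av_le_nrm _ _ _) _; apply: le_trans x'K _.
rewrite -!mulrA ler_wpM2l //.
apply: (@le_trans _ _ (\sum_(i in F) eps * nc (x 0 j))).
  by apply: ler_sum => i iF; apply: gap.
rewrite sumr_const -[leLHS]mulr_natl ler_wpM2r ?mulr_ge0 ?av_ge0 // ler_nat.
by rewrite -[X in (_ <= X)%N]card_ord max_card.
Qed.

(** If [x_i] were below [eps ^ e] times [x_j], the decreasing sets [F n] of coordinates below
    [eps ^ n] times [x_j] would all contain [i] and omit [j]. Two consecutive ones coincide by
    cardinality, which leaves a gap of ratio [eps]; then [gap_bound] makes the partial sum over that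
    set smaller than [c]. *)
Lemma ratio_bound (B c : R) : 0 <= B -> 0 < c -> exists2 eta, 0 < eta <= 1 &
  forall x y i j, (x <= A)%MS -> y *m A^T = 0 -> \sum_i nc (x 0 i * y 0 i) <= B ->
  (forall F, i \in F -> j \notin F -> c <= nc (\sum_(i in F) x 0 i * y 0 i)) ->
  eta * nc (x 0 j) <= nc (x 0 i).
Proof.
move=> B0 c0; have [K K0 KP] := gap_bound.
pose eps := Num.min 1 (c / (2 * (K * B + 1))).
have eps0 : 0 < eps by rewrite lt_min ltr01 divr_gt0 // mulr_gt0 // ltr_wpDl // mulr_ge0.
have eps1 : eps <= 1 by rewrite ge_min lexx.
have epsK : K * eps * B < c.
  have : eps * (2 * (K * B + 1)) <= c.
    by rewrite -ler_pdivlMr ?ge_min ?lexx ?orbT // mulr_gt0 // ltr_wpDl // mulr_ge0.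
  have := mulr_ge0 K0 B0; nra.
exists (eps ^+ e); first by rewrite exprn_gt0 //= exprn_ile1 // ltW.
move=> x y i j xA yA xyB xyc; rewrite leNgt; apply/negP => xij.
pose F n : {set 'I_e} := [set l | nc (x 0 l) < eps ^+ n * nc (x 0 j)].
have jF n : j \notin F n.
  by rewrite inE -leNgt ler_piMl ?av_ge0 // exprn_ile1 // ltW.
have Fsub n : F n.+1 \subset F n.
  apply/fintype.subsetP => l; rewrite !inE => /lt_le_trans; apply.
  by rewrite ler_wpM2r ?av_ge0 // exprS ler_piMl // exprn_ge0 // ltW.
have iF n : (n <= e)%N -> i \in F n.
  move=> ne; rewrite inE; apply: lt_le_trans xij _.
  by rewrite ler_wpM2r ?av_ge0 // ler_wiXn2l // ltW.
have card n : (n <= e)%N -> (#|F n| + n < e)%N.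
  elim: n => [|n IH] ne.
    rewrite addn0 -[X in (_ < X)%N]card_ord; apply: proper_card.
    by apply/properP; split; [exact/fintype.subsetP|exists j].
  apply: leq_trans (IH (ltnW ne)); rewrite addnS ltnS -addSn leq_add2r.
  apply: proper_card; rewrite finset.properEneq Fsub andbT; apply/eqP => FE.
  have := xyc _ (iF _ ne) (jF _); rewrite leNgt => /negP; apply.
  apply: le_lt_trans epsK; apply: (le_trans (KP _ x y eps xA yA (ltW eps0) _)).
    move=> a b; rewrite {2}FE !inE -leNgt exprS -mulrA => xa xb.
    by apply: le_trans (ltW xa) _; rewrite ler_wpM2l // ltW.
  by rewrite ler_wpM2l // mulr_ge0 // ltW.
by have := card e (leqnn _); rewrite ltnNge leq_addl.
Qed.

Lemma par_bound : exists2 K, 0 <= K & forall z,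
  nrm z <= K * (nrm (z *m par1 A) + nrm (z *m par2 A)).
Proof.
set U := invmx (row_ebase A); set V := (row_ebase A)^T.
exists (nrm U + nrm V); first by rewrite addr_ge0 ?nrm_ge0.
move=> z; have {1}-> : z = z *m par1 A *m U + z *m par2 A *m V.
  rewrite /par1 /par2 !mulmxA mulmxK ?row_ebase_unit // -[z *m _ *m _ *m V]mulmxA.
  rewrite -trmx_mul mulmxV ?row_ebase_unit // trmx1 mulmx1 -mulmxDr /copid_mx.
  by rewrite addrC subrK mulmx1.
apply: le_trans (nrmD _ _) _; rewrite mulrDr; apply: lerD.
  apply: le_trans (nrmM _ _) _; rewrite mulrC ler_wpM2r ?nrm_ge0 // lerDl nrm_ge0 //.
apply: le_trans (nrmM _ _) _; rewrite mulrC ler_wpM2r ?nrm_ge0 // lerDr nrm_ge0 //.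
Qed.

(** [X] collects the exceptional indices: none for generic [lam0], index 0 when [lam_0 = 0]. Off
    [X], [ratio_bound] compares each [x_j] with [x_f0 = 1] both ways, which bounds [x_j] above and
    below, and thereby [y_j = lam_j / x_j]. On [X], orthogonality to the vectors of the last two
    hypotheses expresses a coordinate through those off [X]. *)
Lemma solutions_proper (X : {set 'I_e}) (lam0 : 'rV[C]_e) :
  f0 \notin X ->
  (forall i j F, i \notin X -> j \notin X -> i \in F -> j \notin F ->
     \sum_(l in F) lam0 0 l != 0) ->
  (forall i, i \in X -> exists2 x : 'rV[C]_e, (x <= A)%MS &
     x 0 i = 1 /\ forall j, j \in X -> j != i -> x 0 j = 0) ->
  (forall i, i \in X -> exists2 y : 'rV[C]_e, y *m A^T = 0 &
     y 0 i = 1 /\ forall j, j \in X -> j != i -> y 0 j = 0) ->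
  proper_at nc A f0 lam0.
Proof.
move=> f0X sums xX yX.
have [c c0 cP] := finite_pos_lbound (fun F => nc (\sum_(l in F) lam0 0 l)).
pose B := nrm lam0 + 1; have B0 : 0 <= B by rewrite addr_ge0 ?nrm_ge0.
have [eta /andP[eta0 eta1] etaP] := ratio_bound B0 (divr_gt0 c0 (ltr0Sn R 1)).
have [K K0 KP] := par_bound.
have [xl [Kx Kx0 xlP]] : exists xl : 'I_e -> 'rV[C]_e, exists2 Kx, 0 <= Kx & forall i,
   i \in X -> [/\ (xl i <= A)%MS, xl i 0 i = 1, nrm (xl i) <= Kx &
     forall j, j \in X -> j != i -> xl i 0 j = 0].
  have [f fP] : {f : 'I_e -> 'rV[C]_e & forall i, i \in X -> (f i <= A)%MS /\
     (f i 0 i = 1 /\ forall j, j \in X -> j != i -> f i 0 j = 0)}.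
    apply: (@boolp.choice _ _ (fun i x => i \in X -> (x <= A)%MS /\
       (x 0 i = 1 /\ forall j, j \in X -> j != i -> x 0 j = 0))) => i.
    by have [/xX[x ? ?]|_] := boolP (i \in X); [exists x|exists 0].
  exists f, (\sum_i nrm (f i)); first by rewrite sumr_ge0 // => *; apply: nrm_ge0.
  move=> i /fP[? [? ?]]; split=> //.
  by rewrite (bigD1 i) //= lerDl sumr_ge0 // => *; apply: nrm_ge0.
have [yl [Ky Ky0 ylP]] : exists yl : 'I_e -> 'rV[C]_e, exists2 Ky, 0 <= Ky & forall i,
   i \in X -> [/\ yl i *m A^T = 0, yl i 0 i = 1, nrm (yl i) <= Ky &
     forall j, j \in X -> j != i -> yl i 0 j = 0].
  have [f fP] : {f : 'I_e -> 'rV[C]_e & forall i, i \in X -> f i *m A^T = 0 /\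
     (f i 0 i = 1 /\ forall j, j \in X -> j != i -> f i 0 j = 0)}.
    apply: (@boolp.choice _ _ (fun i x => i \in X -> x *m A^T = 0 /\
       (x 0 i = 1 /\ forall j, j \in X -> j != i -> x 0 j = 0))) => i.
    by have [/yX[x ? ?]|_] := boolP (i \in X); [exists x|exists 0].
  exists f, (\sum_i nrm (f i)); first by rewrite sumr_ge0 // => *; apply: nrm_ge0.
  move=> i /fP[? [? ?]]; split=> //.
  by rewrite (bigD1 i) //= lerDl sumr_ge0 // => *; apply: nrm_ge0.
have [M M0 [M1 MB]] : exists2 M, 0 <= M & 1 / eta <= M /\ B / eta <= M.
  exists ((B + 1) / eta); first by apply: divr_ge0; [apply: addr_ge0|apply: ltW].
  by split; rewrite ler_wpM2r ?invr_ge0 ?(ltW eta0) // ?lerDl ?lerDr.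
(* An exceptional coordinate is a bounded combination of the other ones. *)
have exc (u v : 'rV[C]_e) i Kv : \sum_j u 0 j * v 0 j = 0 -> v 0 i = 1 -> nrm v <= Kv ->
    (forall j, j \in X -> j != i -> v 0 j = 0) -> i \in X ->
    (forall j, j \notin X -> nc (u 0 j) <= M) -> nc (u 0 i) <= e%:R * (M * Kv).
  move=> uv vi vK vX iX uM; move: uv; rewrite (bigD1 i) //= vi mulr1 => /eqP.
  rewrite addr_eq0 => /eqP ->; rewrite avN; apply: le_trans (av_sum _ _ _ _) _.
  have Kv0 : 0 <= Kv by apply: le_trans vK; apply: nrm_ge0.
  apply: (@le_trans _ _ (\sum_(j : 'I_e) M * Kv)); last first.
    by rewrite sumr_const card_ord mulr_natl.
  rewrite big_mkcond; apply: ler_sum => j _; case: ifP => [ji|_]; last by rewrite mulr_ge0.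
  have [jX|jX] := boolP (j \in X); first by rewrite vX // mulr0 av0 mulr_ge0.
  rewrite avM; apply: ler_pM; rewrite ?av_ge0 ?uM //.
  by apply: le_trans vK; apply: av_le_nrm.
pose N := M + e%:R * (M * Kx) + e%:R * (M * Ky).
have Nx : e%:R * (M * Kx) <= N by rewrite /N addrAC lerDr addr_ge0 ?mulr_ge0.
have Ny : e%:R * (M * Ky) <= N by rewrite /N lerDr addr_ge0 ?mulr_ge0.
have NM : M <= N by rewrite /N -addrA lerDl addr_ge0 ?mulr_ge0.
have nrm_le (u : 'rV[C]_e) : (forall i, nc (u 0 i) <= N) -> nrm u <= e%:R * N.
  move=> uN; rewrite nrm_rV mulr_natl -[X in _ *+ X]card_ord -sumr_const.
  exact: ler_sum.
exists (K * (e%:R * N + e%:R * N)), (Num.min 1 (c / 2)).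
split; first by rewrite lt_min ltr01 divr_gt0.
move=> lam z _; rewrite lt_min => /andP[lam1 lamc] [/= xA yA x1 xy].
set x := z *m par1 A in xA x1 xy *; set y := z *m par2 A in yA xy *.
have lamB : nrm lam <= B.
  by have := nrmBrev (nc:=nc) lam lam0; rewrite /B; lra.
have xyB : \sum_i nc (x 0 i * y 0 i) <= B.
  by apply: le_trans lamB; rewrite nrm_rV; apply: ler_sum => i _; rewrite xy.
have ratio i j : i \notin X -> j \notin X -> eta * nc (x 0 j) <= nc (x 0 i).
  move=> iX jX; apply: (etaP x y) => // F iF jF.
  have := cP F; rewrite av_gt0 => /(_ (sums i j F iX jX iF jF)) cF.
  have -> : \sum_(l in F) x 0 l * y 0 l =
      \sum_(l in F) lam0 0 l - \sum_(l in F) (lam0 - lam) 0 l.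
    rewrite -sumrB; apply: eq_bigr => l _; rewrite xy !mxE; ring.
  have : nc (\sum_(l in F) (lam0 - lam) 0 l) <= nrm (lam - lam0).
    apply: le_trans (av_sum _ _ _ _) _; rewrite nrm_distrC nrm_rV.
    rewrite [leRHS](bigID (mem F)) /= lerDl sumr_ge0 // => *; exact: av_ge0.
  have := avD (a:=nc) (\sum_(l in F) lam0 0 l - \sum_(l in F) (lam0 - lam) 0 l)
                (\sum_(l in F) (lam0 - lam) 0 l).
  rewrite subrK; lra.
have xM j : j \notin X -> nc (x 0 j) <= M.
  move=> jX; have := ratio _ _ f0X jX; rewrite x1 av1 mulrC.
  by rewrite -ler_pdivlMr // => /le_trans; apply.
have yM j : j \notin X -> nc (y 0 j) <= M.
  move=> jX; have := ratio _ _ jX f0X; rewrite x1 av1 mulr1 => ej.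
  apply: le_trans MB; rewrite ler_pdivlMr //.
  have : nc (x 0 j * y 0 j) <= B.
    rewrite xy; apply: le_trans lamB; exact: av_le_nrm.
  rewrite avM; have : nc (y 0 j) * eta <= nc (y 0 j) * nc (x 0 j).
    by rewrite ler_wpM2l ?av_ge0.
  lra.
apply: le_trans (KP z) _; rewrite ler_wpM2l // lerD // nrm_le // => i.
  have [iX|/xM/le_trans-> //] := boolP (i \in X).
  have [vA vi vK vX] := ylP i iX.
  by apply: le_trans Ny; apply: (exc x (yl i)) => //; apply: mulmx_sum_eq0 vA.
have [iX|/yM/le_trans-> //] := boolP (i \in X).
have [vA vi vK vX] := xlP i iX.
apply: le_trans Nx; apply: (exc y (xl i)) => //.
by rewrite -[RHS](mulmx_sum_eq0 vA yA); apply: eq_bigr => l _; rewrite mulrC.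
Qed.

End Properness.

(** * Deletion and contraction *)

Section Matroids.
Variable C : fieldType.

(** Disconnectedness: the reverse inequality always holds by submodularity. *)
Definition separable e (M : matroid 'I_e) := exists F : {set 'I_e},
  [/\ F != finset.set0, F != [set: 'I_e]%SET & (M F + M (~: F) <= M [set: 'I_e]%SET)%N].

Lemma col_rankE k e (A : 'M[C]_(k, e)) (S : {set 'I_e}) :
  linear_matroid A S = \rank (A *m mask C S).
Proof.
rewrite /= /col_rank -[RHS]mxrank_tr trmx_mul tr_diag_mx; apply/eqP.
rewrite eqn_leq; apply/andP; split; apply: mxrankS.
  apply/sumsmx_subP => j jS; rewrite genmxE.
  have -> : (col j A)^T = row j (diag_mx (\row_j (j \in S)%:R) *m A^T).
    by apply/rowP => i; rewrite mul_diag_mx !mxE jS mul1r.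
  exact: row_sub.
apply/row_subP => j; have [jS|jS] := boolP (j \in S).
  rewrite (sumsmx_sup j) // genmxE.
  have -> // : row j (diag_mx (\row_j (j \in S)%:R) *m A^T) = (col j A)^T.
  by apply/rowP => i; rewrite mul_diag_mx !mxE jS mul1r.
have -> : row j (diag_mx (\row_j (j \in S)%:R) *m A^T) = 0.
  by apply/rowP => i; rewrite mul_diag_mx !mxE (negPf jS) mul0r.
exact: sub0mx.
Qed.

Lemma mask_setT e : mask C [set: 'I_e]%SET = 1%:M.
Proof. by apply/matrixP => i j; rewrite !mxE inE. Qed.

Lemma col_rank_eqmx k k' e (A : 'M[C]_(k, e)) (B : 'M[C]_(k', e)) S :
  (A :=: B)%MS -> linear_matroid A S = linear_matroid B S.
Proof. by move=> AB; rewrite !col_rankE (eqmxMr _ AB). Qed.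

Lemma beta_eq e (M M' : matroid 'I_e) : (forall S, M S = M' S) -> beta M = beta M'.
Proof. by move=> E; rewrite /beta E; congr (_ * _); apply: eq_bigr => S _; rewrite E. Qed.

Lemma separable_eq e (M M' : matroid 'I_e) : (forall S, M S = M' S) ->
  separable M -> separable M'.
Proof. by move=> E [F [F0 FT FM]]; exists F; rewrite -!E. Qed.

Definition shift e (S : {set 'I_e}) : {set 'I_(1 + e)} := [set rshift 1 i | i in S]%SET.

Definition unshift e (S : {set 'I_(1 + e)}) : {set 'I_e} := [set j | rshift 1 j \in S]%SET.

Lemma mem_shift e (S : {set 'I_e}) i : (rshift 1 i \in shift S) = (i \in S).
Proof. by rewrite finset.mem_imset //; apply: rshift_inj. Qed.

Lemma mem_shift0 e (S : {set 'I_e}) : (lshift e ord0 : 'I_(1 + e)) \in shift S = false.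
Proof. by apply/negP => /imsetP[i _ /eqP]; rewrite eq_lrshift. Qed.

Lemma card_shift e (S : {set 'I_e}) : #|shift S| = #|S|.
Proof. by rewrite card_imset //; apply: rshift_inj. Qed.

Lemma big_set_shift e (V : nmodType) (f : {set 'I_(1 + e)} -> V) :
  \sum_S f S = \sum_(S : {set 'I_e}) (f (shift S) + f (lshift e ord0 |: shift S)%SET).
Proof.
pose z := lshift e (ord0 : 'I_1).
have shiftK (S : {set 'I_(1 + e)}) : z \notin S -> shift (unshift S) = S.
  move=> zS; apply/finset.setP => i; case: (split_ordP i) => j ->.
    by rewrite ord1 mem_shift0 (negPf zS).
  by rewrite mem_shift inE.
have preK (S : {set 'I_e}) : unshift (shift S) = S.
  by apply/finset.setP => i; rewrite inE mem_shift.
rewrite big_split /= (bigID (fun S : {set 'I_(1 + e)} => z \in S)) /= addrC.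
congr (_ + _).
  rewrite (reindex_onto (@shift e) (@unshift e)) => [|S zS]; last exact: shiftK.
  by apply: eq_bigl => S; rewrite mem_shift0 preK eqxx.
rewrite (reindex_onto (fun S => z |: @shift e S)%SET (@unshift e)) => [|S zS].
  apply: eq_bigl => S; rewrite !inE eqxx /=; apply/eqP/finset.setP => i.
  by rewrite !inE mem_shift eq_rlshift.
rewrite -[RHS](finset.setD1K zS); congr (_ |: _)%SET; rewrite -[RHS]shiftK ?finset.setD11 //.
by congr shift; apply/finset.setP => i; rewrite !inE eq_rlshift.
Qed.

Lemma sum_sign_sets e : (0 < e)%N -> \sum_(S : {set 'I_e}) (-1) ^+ #|S| = 0 :> int.
Proof.
case: e => // e _; rewrite (@big_set_shift e) big1 // => S _.
by rewrite finset.cardsU1 mem_shift0 exprS mulN1r subrr.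
Qed.

Lemma shift_setT e : (lshift e ord0 |: shift [set: 'I_e])%SET = [set: 'I_(1 + e)]%SET.
Proof.
apply/finset.setP => i; rewrite !inE; case: (split_ordP i) => j ->; first by rewrite ord1 eqxx.
by rewrite mem_shift inE orbT.
Qed.

Section Block.
Variables (k e : nat) (a : 'rV[C]_e) (A2 : 'M[C]_(k, e)).
(** Normal form of a matrix in which index 0 is not a loop: [A2] represents the contraction of 0 and
    [col_mx a A2] the deletion, and 0 is a coloop exactly when [a] lies in the row space of [A2]. *)
Definition block := col_mx (row_mx 1%:M a) (row_mx 0 A2) : 'M[C]_(1 + k, 1 + e).

Lemma block_rank0 (S : {set 'I_e}) :
  linear_matroid block (shift S) = linear_matroid (col_mx a A2) S.
Proof.
have -> : linear_matroid block (shift S) = \rank (row_mx (0 : 'M_(1 + k, 1)) (col_mx a A2 *m mask C S)).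
  rewrite col_rankE; congr (\rank _); apply/matrixP => i j; rewrite mul_mask.
  case: (split_ordP j) => l ->; first by rewrite ord1 mem_shift0 row_mxEl mxE.
  rewrite mem_shift row_mxEr mul_mask /block.
  by case: ifP => // _; case: (split_ordP i) => i' ->;
    rewrite ?col_mxEu ?col_mxEd row_mxEr.
by rewrite rank_row_0mx col_rankE.
Qed.

Lemma block_rank1 (S : {set 'I_e}) :
  linear_matroid block (lshift e ord0 |: shift S)%SET = (linear_matroid A2 S).+1.
Proof.
rewrite !col_rankE.
have -> : block *m mask C (lshift e ord0 |: shift S)%SET =
    block_mx 1%:M (a *m mask C S) 0 (A2 *m mask C S) :> 'M_(1 + k, 1 + e).
  apply/matrixP => i j; rewrite mul_mask !inE.
  case: (split_ordP j) => l ->; case: (split_ordP i) => i' ->;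
    rewrite ?(ord1 l) ?eqxx ?eq_rlshift ?mem_shift /block ?col_mxEu ?col_mxEd ?row_mxEl ?row_mxEr
      ?block_mxEul ?block_mxEur ?block_mxEdl ?block_mxEdr ?mul_mask //=.
rewrite -[block_mx _ _ _ _]mulmx1.
have -> : (1%:M : 'M[C]_(1 + e)) = block_mx 1%:M (- (a *m mask C S)) 0 1%:M *m
   block_mx 1%:M (a *m mask C S) 0 1%:M.
  rewrite mulmx_block !mul1mx !mul0mx !mulmx1 !mulmx0 !addr0 ?add0r subrr.
  by rewrite -scalar_mx_block.
have uU (b : 'rV[C]_e) : block_mx 1%:M b 0 1%:M \in unitmx.
  by rewrite unitmxE det_ublock !det1 mulr1 unitr1.
rewrite mulmxA mxrankMfree ?row_free_unit ?uU // mulmx_block !mul1mx !mul0mx !mulmx1 !mulmx0.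
rewrite !addr0 addNr add0r rank_diag_block_mx mxrank1 //.
Qed.

Lemma beta_block : (0 < e)%N -> beta (linear_matroid block) =
  (-1) ^+ (linear_matroid A2 [set: 'I_e]%SET).+1 *
    (\sum_(S : {set 'I_e}) (-1) ^+ #|S| * (linear_matroid (col_mx a A2) S)%:Z -
     \sum_(S : {set 'I_e}) (-1) ^+ #|S| * (linear_matroid A2 S)%:Z).
Proof.
move=> e0; rewrite /beta -shift_setT block_rank1; congr (_ * _).
rewrite big_set_shift big_split; congr (_ + _).
  by apply: eq_bigr => S _; rewrite card_shift block_rank0.
(* The 1 added to each rank contributes an alternating sum over all subsets, which vanishes as
   [e > 0]. *)
transitivity (- (\sum_(S : {set 'I_e}) (-1) ^+ #|S| * (linear_matroid A2 S)%:Z) -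
  \sum_(S : {set 'I_e}) (-1) ^+ #|S|); last by rewrite sum_sign_sets // subr0.
rewrite -sumrN -sumrB; apply: eq_bigr => S _.
rewrite finset.cardsU1 mem_shift0 card_shift block_rank1 exprS mulN1r.
by rewrite -addn1 PoszD mulNr mulrDr mulr1 opprD.
Qed.

Lemma beta_block_coloop : (0 < e)%N -> (a <= A2)%MS -> beta (linear_matroid block) = 0.
Proof.
move=> e0 aA; rewrite beta_block //; apply/eqP; rewrite mulf_eq0 subr_eq0; apply/orP; right.
apply/eqP; apply: eq_bigr => S _; congr (_ * (_ : nat)%:Z); apply: col_rank_eqmx.
by apply/eqmxP; rewrite col_mx_sub aA submx_refl /= -addsmxE addsmxSr.
Qed.

Lemma rank_del : ~~ (a <= A2)%MS -> \rank (col_mx a A2) = (\rank A2).+1.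
Proof.
move=> aA; rewrite -addsmxE; apply/eqP; rewrite eqn_leq; apply/andP; split.
  apply: leq_trans (mxrank_adds_leqif _ _) _.
  by rewrite -[leqRHS]add1n leq_add2r rank_leq_row.
have [le eq] := mxrank_leqif_sup (addsmxSr a A2).
by rewrite ltn_neqAle le andbT eq addsmx_sub (negPf aA).
Qed.

(** The deletion keeps the rank while the contraction lowers it by one, so the signs turn the
    difference in [beta_block] into a sum. *)
Lemma beta_block_main : (0 < e)%N -> ~~ (a <= A2)%MS ->
  beta (linear_matroid block) = beta (linear_matroid A2) + beta (linear_matroid (col_mx a A2)).
Proof.
move=> e0 aA; rewrite beta_block // /beta !col_rankE !mask_setT !mulmx1 rank_del //.
by rewrite exprS mulN1r mulrBr !mulNr opprK addrC.
Qed.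

(* If both [M \ 0] and [M / 0] are separated, by [F] and [G], submodularity applied to
   the four sets [F], [~F], [G], [~G] separates [M] along one of the intersections. *)
Lemma separable_block : ~~ (a <= A2)%MS ->
  separable (linear_matroid A2) -> separable (linear_matroid (col_mx a A2)) ->
  separable (linear_matroid block).
Proof.
move=> aA [G [G0 GT GM]] [F [F0 FT FM]].
pose z := lshift e (ord0 : 'I_1).
pose M := linear_matroid block.
have MT : M [set: 'I_(1 + e)]%SET = (\rank A2).+1.
  by rewrite /M -shift_setT block_rank1 col_rankE mask_setT mulmx1.
(* Adding the two submodular inequalities bounds the sum of the ranks of both intersections and of
   their complements by [2 \rank A2 + 3]. One of the two pairs is thus at most [(\rank A2).+1], the
   rank of [M]. *)
have cross (F1 F2 G1 G2 : {set 'I_e}) : F2 = ~: F1 -> G2 = ~: G1 ->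
    F1 :&: G1 != finset.set0 -> F2 :&: G2 != finset.set0 ->
    (linear_matroid (col_mx a A2) F1 + linear_matroid (col_mx a A2) F2 <= (\rank A2).+1)%N ->
    (linear_matroid A2 G1 + linear_matroid A2 G2 <= \rank A2)%N -> separable M.
  move=> F2E G2E FG1 FG2; rewrite -!block_rank0 -/M => FR GR.
  have GR' : (M (z |: shift G1)%SET + M (z |: shift G2)%SET <= (\rank A2).+2)%N.
    by rewrite /M !block_rank1 addSn addnS !ltnS.
  have int (H K : {set 'I_e}) : shift H :&: (z |: shift K) = shift (H :&: K).
    apply/finset.setP => i; rewrite !inE; case: (split_ordP i) => j ->.
      by rewrite ord1 !mem_shift0.
    by rewrite !mem_shift !inE eq_rlshift.
  have cup (H1 H2 K1 K2 : {set 'I_e}) : H2 = ~: H1 -> K2 = ~: K1 ->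
      shift H2 :|: (z |: shift K2) = ~: shift (H1 :&: K1).
    move=> -> ->; apply/finset.setP => i; rewrite !inE; case: (split_ordP i) => j ->.
      by rewrite ord1 !mem_shift0 eqxx.
    by rewrite !mem_shift !inE eq_rlshift negb_and.
  have sub1 := mrank_submod M (shift F1) (z |: shift G1).
  have sub2 := mrank_submod M (shift F2) (z |: shift G2).
  rewrite int (cup F2 F1 G2 G1) ?F2E ?G2E ?finset.setCK // -?F2E -?G2E in sub1.
  rewrite int (cup F1 F2 G1 G2) // in sub2.
  have wit (H K : {set 'I_e}) : H :&: K != finset.set0 ->
      (M (shift (H :&: K)) + M (~: shift (H :&: K)) <= (\rank A2).+1)%N -> separable M.
    move=> HK le; exists (shift (H :&: K)); split; last by rewrite MT.
      by rewrite -card_gt0 card_shift card_gt0.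
    by apply/eqP => /finset.setP/(_ z); rewrite mem_shift0 inE.
  have [le|gt] := leqP (M (shift (F1 :&: G1)) + M (~: shift (F1 :&: G1))) (\rank A2).+1.
    exact: wit le.
  apply: (wit F2 G2) => //; lia.
rewrite !col_rankE !mask_setT !mulmx1 rank_del // -!col_rankE in GM FM.
have GM' : (linear_matroid A2 (~: G) + linear_matroid A2 G <= \rank A2)%N by rewrite addnC.
have disj (H K : {set 'I_e}) : H :&: K = finset.set0 -> H :&: ~: K = H.
  by move=> HK; rewrite -[RHS](finset.setID H K) HK finset.set0U finset.setDE.
have C0 (H : {set 'I_e}) : H != [set: 'I_e]%SET -> ~: H != finset.set0.
  by apply: contraNneq => H0; rewrite -[H]finset.setCK H0 finset.setC0.
(* [cross] needs two nonempty intersections. If [F] and [G], or their complements, are disjoint,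
   then exchanging [G] with its complement provides them. *)
have [FG1|FG1] := eqVneq (F :&: G) finset.set0.
  apply: (cross F (~: F) (~: G) G) => //; rewrite ?finset.setCK //; first by rewrite disj.
  by rewrite finset.setIC disj // finset.setIC.
have [FG2|FG2] := eqVneq (~: F :&: ~: G) finset.set0.
  apply: (cross F (~: F) (~: G) G) => //; rewrite ?finset.setCK //.
    by rewrite finset.setIC -[F]finset.setCK disj ?C0 // finset.setIC.
  by rewrite -[G]finset.setCK disj ?C0.
exact: (cross F (~: F) G (~: G)).
Qed.

End Block.
End Matroids.

(** * Loops, coloops and reduction to block form *)

Section LoopsColoops.
Variables (C : fieldType) (e : nat).

Let z : 'I_(1 + e) := lshift e ord0.

Lemma shift_set0 : (lshift e ord0 |: shift finset.set0)%SET = [set z]%SET.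
Proof.
apply/finset.setP => i; rewrite !inE; case: (split_ordP i) => j ->.
  by rewrite ord1 eqxx.
by rewrite mem_shift inE orbF.
Qed.

Lemma separable_singleton (M : matroid 'I_(1 + e)) : (0 < e)%N ->
  (M [set z]%SET + M (shift [set: 'I_e]) <= M [set: 'I_(1 + e)]%SET)%N -> separable M.
Proof.
move=> e0 le; exists [set z]%SET; split.
- by apply/set0Pn; exists z; rewrite inE.
- apply/eqP => /finset.setP/(_ (rshift 1 (Ordinal e0))).
  by rewrite !inE eq_rlshift.
- apply: leq_trans le; rewrite leq_add2l; apply: mrank_mono.
  apply/fintype.subsetP => i; rewrite !inE; case: (split_ordP i) => j ->.
    by rewrite ord1 eqxx.
  by rewrite mem_shift inE.
Qed.

Variables (k : nat).

Lemma loop_rank (A : 'M[C]_(k, 1 + e)) S : lsubmx A = 0 ->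
  linear_matroid A (z |: shift S)%SET = linear_matroid A (shift S).
Proof.
move=> A0; rewrite !col_rankE; congr (\rank _); apply/matrixP => i j; rewrite !mul_mask.
case: (split_ordP j) => l ->; last by rewrite !inE eq_rlshift.
have -> : A i (lshift e l) = 0 by have := congr1 (fun B : 'M_(k, 1) => B i l) A0; rewrite !mxE.
by do !case: ifP.
Qed.

Lemma beta_loop (A : 'M[C]_(k, 1 + e)) : lsubmx A = 0 -> beta (linear_matroid A) = 0.
Proof.
move=> A0; apply/eqP; rewrite mulf_eq0; apply/orP; right; apply/eqP.
rewrite big_set_shift big1 // => S _.
by rewrite loop_rank // cardsU1 mem_shift0 exprS mulN1r mulNr subrr.
Qed.

Lemma separable_loop (A : 'M[C]_(k, 1 + e)) : (0 < e)%N -> lsubmx A = 0 ->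
  separable (linear_matroid A).
Proof.
move=> e0 A0; apply: separable_singleton => //.
rewrite -shift_set0 loop_rank // -shift_setT loop_rank // -[leqRHS]add0n leq_add2r.
apply: leq_trans (mrank_le_card _ _) _.
by rewrite card_shift cards0.
Qed.

Lemma separable_coloop (a : 'rV[C]_e) (A2 : 'M[C]_(k, e)) : (0 < e)%N -> (a <= A2)%MS ->
  separable (linear_matroid (block a A2)).
Proof.
move=> e0 aA; apply: separable_singleton => //.
rewrite -shift_set0 -shift_setT !block_rank1 block_rank0 addSn ltnS.
have -> : linear_matroid (col_mx a A2) [set: 'I_e]%SET = linear_matroid A2 [set: 'I_e]%SET.
  apply: col_rank_eqmx.
  by apply/eqmxP; rewrite col_mx_sub aA submx_refl /= -addsmxE addsmxSr.
rewrite -[leqRHS]add0n leq_add2r.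
by apply: leq_trans (mrank_le_card _ _) _; rewrite cards0.
Qed.

(** One step of Gaussian elimination, with a pivot in column 0. *)
Lemma block_exists (A : 'M[C]_(k, 1 + e)) : lsubmx A != 0 ->
  exists (a : 'rV[C]_e) (A2 : 'M[C]_(k, e)), (A :=: block a A2)%MS.
Proof.
move=> A0; have [i Ai] : exists i, lsubmx A i 0 != 0.
  apply: contrapT => nA; case/eqP: A0; apply/matrixP => i j; rewrite ord1 !mxE.
  apply/eqP; apply: contraT => Aij; case: nA; exists i.
  by rewrite mxE.
pose c := lsubmx A i 0; pose a : 'rV[C]_e := c^-1 *: row i (rsubmx A).
pose A2 := rsubmx A - lsubmx A *m a.
have AE : A = lsubmx A *m row_mx 1%:M a + 1%:M *m row_mx 0 A2.
  by rewrite mul1mx mul_mx_row mulmx1 add_row_mx addr0 /A2 addrC subrK hsubmxK.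
have rowE : row_mx 1%:M a = c^-1 *: row i A.
  rewrite -[A in RHS]hsubmxK row_row_mx scale_row_mx; congr row_mx.
  apply/matrixP => x y; rewrite !ord1 /c !mxE mulVf //.
  by move: Ai; rewrite mxE.
have rA : (row_mx 1%:M a <= A)%MS by rewrite rowE scalemx_sub // row_sub.
exists a, A2; apply/eqmxP; apply/andP; split.
  rewrite {1}AE addmx_sub // mulmx_sub // /block -addsmxE; [exact: addsmxSl|exact: addsmxSr].
rewrite /block col_mx_sub rA /=.
have -> : row_mx 0 A2 = A - lsubmx A *m row_mx 1%:M a by rewrite {1}AE addrC addKr mul1mx.
by rewrite addmx_sub // eqmx_opp mulmx_sub.
Qed.

End LoopsColoops.

Section EqmxInvariance.
Variables (C : fieldType) (e k k' : nat) (A : 'M[C]_(k, e)) (B : 'M[C]_(k', e)) (f0 : 'I_e).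
Hypothesis AB : (A :=: B)%MS.

Lemma orth_eqmx m (y : 'M[C]_(m, e)) : (y *m A^T = 0) <-> (y *m B^T = 0).
Proof.
have aux k1 k2 (A1 : 'M[C]_(k1, e)) (A2 : 'M[C]_(k2, e)) : (A2 <= A1)%MS ->
  y *m A1^T = 0 -> y *m A2^T = 0.
  by move=> /submxP[U ->] yA; rewrite trmx_mul mulmxA yA mul0mx.
by split; apply: aux; rewrite AB.
Qed.

Lemma sol_eqmx lam p : sol A f0 lam p <-> sol B f0 lam p.
Proof. by split=> -[xA yA x1 xy]; split=> //; [rewrite -AB|apply/orth_eqmx|rewrite AB|apply/orth_eqmx]. Qed.

Lemma simple_eqmx p : simple A f0 p -> simple B f0 p.
Proof. by move=> H dx dy dxB /orth_eqmx dyB; apply: H; rewrite ?AB. Qed.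

End EqmxInvariance.

(** * Conditions that hold for generic products *)

Section GenericConditions.
Variables (R : realType) (C : fieldType) (nc : absval R C).

Lemma generic1 e : generic (1 : {mpoly C[e]}).
Proof. by exists 0; rewrite ?meval1 ?oner_eq0 // big1 // => i _; rewrite mxE. Qed.

Definition set_sum e (F : {set 'I_e}) : {mpoly C[e]} := \sum_(i in F) 'X_i.

Lemma set_sumE e (F : {set 'I_e}) (lam : 'rV[C]_e) :
  (set_sum F).@[lam 0] = \sum_(i in F) lam 0 i.
Proof. by rewrite /set_sum raddf_sum; apply: eq_bigr => i _; rewrite /= mevalXU. Qed.

Lemma generic_set_sum e (F : {set 'I_e}) : F != finset.set0 -> F != [set: 'I_e]%SET ->
  generic (set_sum F).
Proof.
move=> /set0Pn[i iF] FT.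
have [j jF] : exists j, j \notin F.
  apply: contrapT => nj; case/eqP: FT; apply/finset.setP => j; rewrite inE.
  by apply: contraT => jF; case: nj; exists j.
have dE m : (delta_mx 0 i - delta_mx 0 j : 'rV[C]_e) 0 m = (m == i)%:R - (m == j)%:R.
  by rewrite !mxE eqxx.
exists (delta_mx 0 i - delta_mx 0 j).
  under eq_bigr do rewrite dE.
  rewrite sumrB (bigD1 i) //= eqxx big1 => [|l /negPf-> //].
  by rewrite (bigD1 j) //= eqxx [X in _ - (_ + X)]big1 => [|l /negPf-> //]; rewrite !addr0 subrr.
rewrite set_sumE; under eq_bigr do rewrite dE.
rewrite sumrB (bigD1 i) //= eqxx big1 => [|l /andP[_ /negPf-> //]].
rewrite big1 => [|l lF]; first by rewrite addr0 subr0 oner_eq0.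
by case: eqP => // lj; rewrite -lj lF in jF.
Qed.

Lemma generic_nonresonant e : exists2 G : {mpoly C[e]}, generic G &
  forall lam : 'rV[C]_e, G.@[lam 0] != 0 -> forall F : {set 'I_e},
    F != finset.set0 -> F != [set: 'I_e]%SET -> \sum_(i in F) lam 0 i != 0.
Proof.
exists (\prod_(F : {set 'I_e} | (F != finset.set0) && (F != [set: 'I_e]%SET)) set_sum F).
  elim/big_ind: _ => [|x y|F /andP[]]; [exact: generic1|exact: (genericM nc)|exact: generic_set_sum].
move=> lam GF F F0 FT; rewrite -set_sumE; apply: contraNneq GF => F00.
by rewrite (bigD1 F) /= ?F0 // mevalM F00 mul0r.
Qed.

(** The rank inequality makes L the direct sum of its restrictions to [F] and to the complement, so
    cutting [x] down to [F] stays in L and is still orthogonal to [y]. *)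
Lemma separable_no_solution k e (A : 'M[C]_(k, e)) (f0 : 'I_e) :
  separable (linear_matroid A) -> exists2 G : {mpoly C[e]}, generic G &
  forall lam : 'rV[C]_e, G.@[lam 0] != 0 -> forall p, ~ sol A f0 lam p.
Proof.
move=> [F [F0 FT FM]]; exists (set_sum F); first exact: generic_set_sum.
move=> lam; rewrite set_sumE => lF [x y] [/= xA yA _ xy]; case/eqP: lF.
have sumA : (A <= A *m mask C F + A *m mask C (~: F))%MS.
  have {1}-> : A = A *m mask C F + A *m mask C (~: F).
    apply/matrixP => i j; rewrite mxE !mul_mask inE.
    by case: (j \in F); rewrite ?addr0 ?add0r.
  by apply: addmx_sub_adds; apply: submx_refl.
have [le eq] := mxrank_leqif_sup sumA.
have : (A *m mask C F <= A)%MS.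
  apply: submx_trans (addsmxSl _ (A *m mask C (~: F))) _; rewrite -eq eqn_leq le /=.
  apply: leq_trans (mxrank_adds_leqif _ _) _.
  by move: FM; rewrite !col_rankE mask_setT mulmx1.
move=> FA; have xF : (x *m mask C F <= A)%MS by apply: submx_trans (submxMr _ xA) FA.
rewrite -[RHS](mulmx_sum_eq0 xF yA) big_mkcond; apply: eq_bigr => i _.
by rewrite mul_mask; case: ifP => _; rewrite ?mul0r ?xy.
Qed.

(* [u] and [v] are the coefficients of a linear form in [(x, y)]. *)
Lemma generic_form k e (A : 'M[C]_(k, e)) (f0 : 'I_e) (u v : 'cV[C]_e) (x1 y1 : 'rV[C]_e) :
  (x1 <= A)%MS -> y1 *m A^T = 0 -> x1 0 f0 = 1 -> x1 *m u + y1 *m v != 0 ->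
  exists2 G : {mpoly C[e]}, generic G & forall lam : 'rV[C]_e, G.@[lam 0] != 0 ->
    forall p, sol A f0 lam p -> p.1 *m u + p.2 *m v != 0.
Proof.
move=> x1A y1A x11 uv.
pose w := par1 A *m u + par2 A *m v.
pose q : {mpoly C[e]} := \sum_i w i 0 *: 'X_i.
have qE (z : 'rV[C]_e) : q.@[z 0] = (z *m par1 A *m u + z *m par2 A *m v) 0 0.
  rewrite -(mulmxA z _ u) -(mulmxA z _ v) -mulmxDr -/w raddf_sum [RHS]mxE; apply: eq_bigr => i _.
  by rewrite /= mevalZ mevalXU mulrC.
have mx0 (M : 'M[C]_1) : (M 0 0 != 0) = (M != 0).
  congr (~~ _); apply/eqP/eqP => [M0|->]; last by rewrite mxE.
  by apply/matrixP => i j; rewrite !ord1 M0 mxE.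
have [z1 zx zy] := par_surj x1A y1A.
have [||G [[lam l0 Gl] GP]] := @generic_nonvanishing _ _ _ A f0 q z1 (@nonroot_exists _ _ nc).
- by rewrite zx.
- by rewrite qE mx0 zx zy.
exists G; first by exists lam.
move=> l Gl' [x y] sxy; have [/= xA yA _ _] := sxy.
have [z zx' zy'] := par_surj xA yA.
rewrite /= -mx0 -zx' -zy' -qE; apply: GP Gl' _ _.
by rewrite zx' zy'.
Qed.

(** The Jacobian determinant is a polynomial in the parameter [z]. The given solution shows that it
    is not zero on [x_f0 = 1], so [generic_nonvanishing] applies to it. *)
Lemma generic_simple k e (A : 'M[C]_(k, e)) (f0 : 'I_e) lam1 p1 :
  sol A f0 lam1 p1 -> simple A f0 p1 ->
  exists2 G : {mpoly C[e]}, generic G & forall lam : 'rV[C]_e, G.@[lam 0] != 0 ->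
    forall p, sol A f0 lam p -> simple A f0 p.
Proof.
case: p1 => x1 y1 [/= x1A y1A x11 _] simp.
have [z1 zx zy] := par_surj x1A y1A.
pose L (M : 'M[C]_e) j : {mpoly C[e]} := \sum_i M i j *: 'X_i.
have LE M j (z : 'rV[C]_e) : (L M j).@[z 0] = (z *m M) 0 j.
  by rewrite raddf_sum [RHS]mxE; apply: eq_bigr => i _; rewrite /= mevalZ mevalXU mulrC.
pose J : 'M[{mpoly C[e]}]_e := \matrix_(i, j) ((sysT A f0 i j)%:MP +
   L (sysP A f0) j * (par2 A i j)%:MP + (sysP A f0 i j)%:MP * L (par2 A) j).
have JE (z : 'rV[C]_e) : (\det J).@[z 0] = \det (jac (sysP A f0) (par2 A) (sysT A f0) z).
  rewrite -det_map_mx; congr (\det _); apply/matrixP => i j.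
  by rewrite [LHS]mxE [J _ _]mxE [RHS]mxE /= !mevalD !mevalM !mevalC !LE.
have [||G [[lam l0 Gl] GP]] := @generic_nonvanishing _ _ _ A f0 (\det J) z1 (@nonroot_exists _ _ nc).
- by rewrite zx.
- by rewrite JE -unitfE -unitmxE; apply/simple_jac; rewrite zx ?zy.
exists G; first by exists lam.
move=> l Gl' [x y] sxy; have [/= xA yA x1' _] := sxy.
have [z zx' zy'] := par_surj xA yA.
rewrite -zx' -zy' simple_jac ?zx' // unitmxE unitfE -JE; apply: GP Gl' _ _.
by rewrite zx' zy'.
Qed.

End GenericConditions.

(** * Solutions of the block system at [lam_0 = 0] *)

Section BlockSolutions.
Variables (C : fieldType) (k e : nat) (a : 'rV[C]_e) (A2 : 'M[C]_(k, e)).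
Local Notation B := (block a A2).
Local Notation A1 := (col_mx a A2).

Lemma block_sub (x0 : 'M[C]_1) (x : 'rV[C]_e) :
  (row_mx x0 x <= B)%MS <-> (x - x0 *m a <= A2)%MS.
Proof.
split=> [/submxP[u]|/submxP[u xE]].
  rewrite -[u]hsubmxK mul_row_col !mul_mx_row mulmx1 mulmx0 add_row_mx addr0.
  by move=> /eq_row_mx[-> ->]; rewrite addrC addKr submxMl.
apply/submxP; exists (row_mx x0 u).
rewrite mul_row_col !mul_mx_row mulmx1 mulmx0 add_row_mx addr0 -xE.
by rewrite addrC subrK.
Qed.

Lemma block_orth (y0 : 'M[C]_1) (y : 'rV[C]_e) :
  (row_mx y0 y *m B^T = 0) <-> (y0 = - (y *m a^T) /\ y *m A2^T = 0).
Proof.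
rewrite tr_col_mx !tr_row_mx mul_mx_row !mul_row_col trmx1 trmx0 mulmx1 mulmx0 add0r.
split=> [|[-> ->]]; last by rewrite addNr row_mx0.
by rewrite -[RHS]row_mx0 => /eq_row_mx[/eqP]; rewrite addr_eq0 => /eqP.
Qed.

Lemma del_orth (y : 'rV[C]_e) : (y *m A1^T = 0) <-> (y *m a^T = 0 /\ y *m A2^T = 0).
Proof.
rewrite tr_col_mx mul_mx_row; split=> [|[-> ->]]; last by rewrite row_mx0.
by rewrite -[RHS]row_mx0 => /eq_row_mx.
Qed.

(** The form [g] reads off the coordinate [x_0] of the unique vector of L that extends a given
    vector of the deletion. *)
Lemma dual_exists : ~~ (a <= A2)%MS -> exists2 g : 'cV[C]_e, A2 *m g = 0 & a *m g = 1%:M.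
Proof.
rewrite submxE; move: (cokermx A2) (mulmx_coker A2) => K AK /matrix0Pn[i [j]].
rewrite (ord1 i); set c := (a *m K) 0 j => c0; exists (c^-1 *: col j K).
  by rewrite -scalemxAr colE mulmxA AK mul0mx scaler0.
apply/matrixP => x y; rewrite !ord1 -scalemxAr colE mulmxA -colE [LHS]mxE [col _ _ _ _]mxE.
by rewrite mulVf ?mxE.
Qed.

Variables (g : 'cV[C]_e).
Hypotheses (A2g : A2 *m g = 0) (ag : a *m g = 1%:M).

Lemma del_sub (x : 'rV[C]_e) : (x <= A1)%MS <-> (x - x *m g *m a <= A2)%MS.
Proof.
split=> [/submxP[u ->]|xA].
  rewrite -[u]hsubmxK mul_row_col mulmxDl -!mulmxA A2g ag mulmx0 addr0 mulmx1.
  by rewrite addrC addKr submxMl.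
have : ((x *m g *m a + (x - x *m g *m a))%R <= a + A2)%MS.
  by rewrite addmx_sub_adds // submxMl.
by rewrite addrC subrK addsmxE.
Qed.

Variables (f0 : 'I_e) (lam : 'rV[C]_e).

(** The branch [x_0 = 0] of [x_0 y_0 = 0]; here [y_0] is forced by orthogonality to the row
    [(1, a)]. *)
Definition con_ext (p : 'rV[C]_e * 'rV[C]_e) : 'rV[C]_(1 + e) * 'rV[C]_(1 + e) :=
  (row_mx 0 p.1, row_mx (- (p.2 *m a^T)) p.2).

Definition del_ext (p : 'rV[C]_e * 'rV[C]_e) : 'rV[C]_(1 + e) * 'rV[C]_(1 + e) :=
  (row_mx (p.1 *m g) p.1, row_mx 0 p.2).

Lemma mx11P (M N : 'M[C]_1) : M 0 0 = N 0 0 -> M = N.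
Proof. by move=> E; apply/matrixP => i j; rewrite !ord1. Qed.

Lemma block_solP v : sol B (rshift 1 f0) (row_mx 0 lam) v <->
  (exists2 p, sol A2 f0 lam p & v = con_ext p) \/
  (exists2 p, sol A1 f0 lam p & v = del_ext p).
Proof.
have lamE i : (row_mx (0 : 'M_1) lam) 0 (rshift 1 i) = lam 0 i by rewrite row_mxEr.
split=> [|[[[x y] [/= xA yA x1 xy] ->]|[[x y] [/= xA yA x1 xy] ->]]].
- case: v => x y; rewrite -[x](@hsubmxK _ 1 1 e) -[y](@hsubmxK _ 1 1 e).
  set x0 := lsubmx x; set x' := rsubmx x; set y0 := lsubmx y; set y' := rsubmx y.
  move=> [/= /block_sub xA /block_orth[y0E yA]]; rewrite row_mxEr => x1 xy.
  have xy' i : x' 0 i * y' 0 i = lam 0 i by have := xy (rshift 1 i); rewrite !row_mxEr.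
  have /eqP : x0 0 0 * y0 0 0 = 0 by have := xy (lshift e 0); rewrite !row_mxEl [X in _ = X]mxE.
  rewrite mulf_eq0 => /orP[/eqP x00|/eqP y00].
    have {}x00 : x0 = 0 by apply: mx11P; rewrite x00 mxE.
    left; exists (x', y'); last by rewrite /con_ext /= x00 y0E.
    by split=> //=; move: xA; rewrite x00 mul0mx subr0.
  have {}y00 : y0 = 0 by apply: mx11P; rewrite y00 mxE.
  have ya : y' *m a^T = 0 by apply/eqP; rewrite -oppr_eq0 -y0E y00.
  have [u xE] := submxP xA.
  have x0g : x' *m g = x0.
    rewrite -[x'](subrK (x0 *m a)) xE mulmxDl -!mulmxA A2g ag mulmx0 add0r mulmx1 //.
  right; exists (x', y'); last by rewrite /del_ext /= x0g y00.
  by split=> //=; [apply/del_sub; rewrite x0g|apply/del_orth].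
- split; rewrite /con_ext /= ?row_mxEr //.
  + by apply/block_sub; rewrite mul0mx subr0.
  + exact/block_orth.
  + move=> i; case: (split_ordP i) => j ->; last by rewrite !row_mxEr.
    by rewrite !row_mxEl !mxE mul0r.
- have [ya yA2] := (del_orth y).1 yA.
  split; rewrite /del_ext /= ?row_mxEr //.
  + by apply/block_sub; apply/del_sub.
  + by apply/block_orth; rewrite ya oppr0.
  + move=> i; case: (split_ordP i) => j ->; last by rewrite !row_mxEr.
    by rewrite !row_mxEl [X in _ * X]mxE [RHS]mxE mulr0.
Qed.

Lemma con_ext_inj : injective con_ext.
Proof. by move=> [x y] [x' y'] [/eq_row_mx[_ ->] /eq_row_mx[_ ->]]. Qed.

Lemma del_ext_inj : injective del_ext.
Proof. by move=> [x y] [x' y'] [/eq_row_mx[_ ->] /eq_row_mx[_ ->]]. Qed.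

(** The linearized equation at index 0 reads [dx_0 y_0 = 0]. As [y_0] is nonzero, [dx_0 = 0], and
    what remains is the linearized system of the contraction. *)
Lemma con_ext_simple p : simple A2 f0 p -> p.2 *m a^T != 0 ->
  simple B (rshift 1 f0) (con_ext p).
Proof.
case: p => x y simp /= ya dx dy.
rewrite -[dx](@hsubmxK _ 1 1 e) -[dy](@hsubmxK _ 1 1 e).
set x0 := lsubmx dx; set x' := rsubmx dx; set y0 := lsubmx dy; set y' := rsubmx dy.
move=> /block_sub xA /block_orth[y0E yA]; rewrite row_mxEr => x1 xy.
have x00 : x0 = 0.
  have := xy (lshift e 0); rewrite !row_mxEl [(0 : 'M_1) _ _]mxE mul0r add0r => /eqP.
  rewrite mulf_eq0 => /orP[/eqP x00|/eqP E]; first by apply: mx11P; rewrite x00 mxE.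
  by case/eqP: ya; apply/eqP; rewrite -oppr_eq0; apply/eqP; apply: mx11P; rewrite E mxE.
have [|||i|-> y'0] := simp x' y' => //.
- by move: xA; rewrite x00 mul0mx subr0.
- by have := xy (rshift 1 i); rewrite !row_mxEr.
by rewrite x00 y0E y'0 mul0mx oppr0 !row_mx0.
Qed.

Lemma del_ext_simple p : simple A1 f0 p -> p.1 *m g != 0 ->
  simple B (rshift 1 f0) (del_ext p).
Proof.
case: p => x y simp /= xg dx dy.
rewrite -[dx](@hsubmxK _ 1 1 e) -[dy](@hsubmxK _ 1 1 e).
set x0 := lsubmx dx; set x' := rsubmx dx; set y0 := lsubmx dy; set y' := rsubmx dy.
move=> /block_sub xA /block_orth[y0E yA]; rewrite row_mxEr => x1 xy.
have y00 : y0 = 0.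
  have := xy (lshift e 0); rewrite !row_mxEl [(0 : 'M_1) _ _]mxE mulr0 addr0 => /eqP.
  rewrite mulf_eq0 => /orP[/eqP E|/eqP y00]; last by apply: mx11P; rewrite y00 mxE.
  by case/eqP: xg; apply: mx11P; rewrite E mxE.
have x0g : x' *m g = x0.
  have [u xE] := submxP xA.
  by rewrite -[x'](subrK (x0 *m a)) xE mulmxDl -!mulmxA A2g ag mulmx0 add0r mulmx1.
have [|||i|x'0 ->] := simp x' y' => //.
- by apply/del_sub; rewrite x0g.
- by apply/del_orth; split=> //; apply/eqP; rewrite -oppr_eq0 -y0E y00.
- by have := xy (rshift 1 i); rewrite !row_mxEr.
by rewrite -x0g x'0 y00 mul0mx !row_mx0.
Qed.

Lemma counted_block d1 d2 : (forall p, sol A1 f0 lam p -> p.1 *m g != 0) ->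
  counted (sol A2 f0 lam) d1 -> counted (sol A1 f0 lam) d2 ->
  counted (sol B (rshift 1 f0) (row_mx 0 lam)) (d1 + d2).
Proof.
move=> xg; apply: counted_sum con_ext_inj del_ext_inj _ block_solP => p q _ /xg qg [].
by move=> /eq_row_mx[E _] _; rewrite -E eqxx in qg.
Qed.

End BlockSolutions.

(** * The generic number of solutions *)

Section GenericCount.
Variables (R : realType) (C : fieldType) (nc : absval R C).
Hypothesis nc_compact : locally_compact nc.
Hypothesis nc_connected : punctured_connected nc.
Local Notation nrm := (nrm nc).

Definition generic_count k e (A : 'M[C]_(k, e)) (f0 : 'I_e) (d : nat) :=
  exists2 G : {mpoly C[e]}, generic G &
    forall lam : 'rV[C]_e, \sum_i lam 0 i = 0 -> G.@[lam 0] != 0 ->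
      counted (sol A f0 lam) d /\ forall p, sol A f0 lam p -> simple A f0 p.

Lemma generic_count_separable k e (A : 'M[C]_(k, e)) f0 :
  separable (linear_matroid A) -> generic_count A f0 0.
Proof.
move=> /(separable_no_solution f0)[G gG GP]; exists G => // lam _ /GP nosol.
by split=> [|p /nosol //]; apply: counted0.
Qed.

Lemma generic_count_eqmx k k' e (A : 'M[C]_(k, e)) (B : 'M[C]_(k', e)) f0 d :
  (A :=: B)%MS -> generic_count A f0 d -> generic_count B f0 d.
Proof.
move=> AB [G gG GP]; exists G => // lam l0 Gl; have [[s [us sd sP]] simp] := GP lam l0 Gl.
split=> [|p /(sol_eqmx f0 AB) /simp]; last exact: simple_eqmx.
by exists s; split=> // p; rewrite sP; apply: sol_eqmx.
Qed.

Lemma beta_one k e (A : 'M[C]_(k, e)) : e = 1%N -> beta (linear_matroid A) = (\rank A)%:Z.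
Proof.
move=> e1; subst e.
rewrite /beta; have := @big_set_shift 0 _ (fun S => (-1) ^+ #|S| * (linear_matroid A S)%:Z).
move=> /= ->; rewrite (bigD1 finset.set0) //= big1 => [|S]; last first.
  by move/set0Pn => [[]].
have -> : col_rank A (shift finset.set0) = 0%N.
  apply/eqP; rewrite -leqn0; apply: leq_trans (col_rank_le_card _ _) _.
  by rewrite card_shift cards0.
rewrite mulr0 add0r addr0 finset.cardsU1 mem_shift0 card_shift cards0.
have -> : (lshift 0 ord0 |: shift finset.set0)%SET = [set: 'I_1]%SET.
  by rewrite -(@shift_setT 0); congr (_ |: shift _)%SET; apply/finset.setP => -[].
have := col_rankE A [set: 'I_1]%SET; rewrite /= mask_setT mulmx1 => ->.
by have := rank_leq_col A; case: (\rank A) => [|[|]].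
Qed.

(** Sum zero means [lam = 0]: a coloop has the single solution [(1, 0)], a loop has none. *)
Lemma generic_count_one k (A : 'M[C]_(k, 1)) f0 : generic_count A f0 (\rank A).
Proof.
have f00 : f0 = 0 by rewrite ord1.
exists 1; first exact: generic1.
move=> lam lam0 _; have {}lam0 : lam 0 0 = 0 by move: lam0; rewrite big_ord1.
have [A0|A0] := eqVneq A 0.
  have nosol p : ~ sol A f0 lam p.
    case=> /submxP[u uE] _ + _; rewrite uE A0 mulmx0 mxE => /eqP.
    by rewrite eq_sym oner_eq0.
  by rewrite A0 mxrank0; split=> [|p]; [apply: counted0; rewrite -A0|rewrite -A0 => /nosol].
have rA : \rank A = 1%N.
  by apply/eqP; rewrite eqn_leq rank_leq_col lt0n mxrank_eq0.
have fullA (x : 'rV_1) : (x <= A)%MS by apply: submx_full; rewrite /row_full rA.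
have orth (y : 'rV_1) : y *m A^T = 0 -> y = 0.
  move=> yA; apply/eqP; apply: contraNT A0 => y0; apply/eqP/matrixP => i j.
  have /rowP/(_ i) := yA; rewrite !mxE big_ord1 !mxE (ord1 j) => /eqP.
  rewrite mulf_eq0 => /orP[/eqP E|/eqP E]; last exact: E.
  by case/eqP: y0; apply: mx11P; rewrite [RHS]mxE; exact: E.
split=> [|p _ dx dy _ /orth -> dx0 _]; last first.
  by split=> //; apply: mx11P; rewrite [RHS]mxE -dx0 f00.
rewrite rA; exists [:: (1%:M, 0)]; split=> // -[x y]; rewrite inE; split.
  by case/eqP => -> ->; split; rewrite /= ?f00 ?mxE ?mul0mx // => i; rewrite ord1 !mxE mulr0.
move=> [/= _ /orth -> x1 _]; apply/eqP; congr pair.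
by apply: mx11P; rewrite mxE -x1 f00.
Qed.

Section BlockStep.
Variables (k e : nat) (a : 'rV[C]_e) (A2 : 'M[C]_(k, e)) (f0 : 'I_e).
Hypothesis aA2 : ~~ (a <= A2)%MS.

Lemma generic_dual_nonzero : exists2 G : {mpoly C[e]}, generic G &
  forall lam : 'rV[C]_e, G.@[lam 0] != 0 -> forall p, sol A2 f0 lam p -> p.2 *m a^T != 0.
Proof.
have [g A2g ag] := dual_exists aA2.
have [[x xA x1]|nx] := pselect (exists2 x : 'rV[C]_e, (x <= A2)%MS & x 0 f0 = 1); last first.
  exists 1; first exact: generic1.
  by move=> lam _ p [xA _ x1 _]; case: nx; exists p.1.
have gA : g^T *m A2^T = 0 by rewrite -trmx_mul A2g trmx0.
have ga : x *m 0 + g^T *m a^T != 0.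
  by rewrite mulmx0 add0r -trmx_mul ag trmx1 -mxrank_eq0 mxrank1.
have [G gG GP] := generic_form nc xA gA x1 ga.
by exists G => // lam Gl p /(GP lam Gl); rewrite mulmx0 add0r.
Qed.

Lemma generic_coordinate_nonzero (g : 'cV[C]_e) : a *m g = 1%:M ->
  exists2 G : {mpoly C[e]}, generic G & forall lam : 'rV[C]_e, G.@[lam 0] != 0 ->
    forall p, sol (col_mx a A2) f0 lam p -> p.1 *m g != 0.
Proof.
move=> ag.
have [[x xA x1]|nx] := pselect (exists2 x : 'rV[C]_e, (x <= col_mx a A2)%MS & x 0 f0 = 1);
  last first.
  exists 1; first exact: generic1.
  by move=> lam _ p [xA _ x1 _]; case: nx; exists p.1.
have aA : (a <= col_mx a A2)%MS by rewrite -addsmxE addsmxSl.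
have one0 : (1%:M : 'M[C]_1) != 0 by rewrite -mxrank_eq0 mxrank1.
(* Two linear conditions must both be nonzero; one of [x], [x + a] and [a] satisfies both. *)
have [u uA [u0 ug]] : exists2 u : 'rV[C]_e, (u <= col_mx a A2)%MS & u 0 f0 != 0 /\ u *m g != 0.
  have [xg|xg] := eqVneq (x *m g) 0; last by exists x; rewrite ?x1 ?oner_eq0.
  have [a0|a0] := eqVneq (a 0 f0) 0.
    exists (x + a); first exact: addmx_sub.
    by rewrite mxE x1 a0 addr0 oner_eq0 mulmxDl xg ag add0r.
  by exists a; rewrite ?ag.
have [||||G gG GP] := @generic_form _ _ nc _ _ (col_mx a A2) f0 g 0 ((u 0 f0)^-1 *: u) 0.
- exact: scalemx_sub.
- by rewrite mul0mx.
- by rewrite mxE mulVf.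
- by rewrite mul0mx addr0 -scalemxAl scaler_eq0 invr_eq0 negb_or u0.
by exists G => // lam Gl p /(GP lam Gl); rewrite mulmx0 addr0.
Qed.

Lemma block_step d1 d2 : (0 < d1 + d2)%N ->
  generic_count A2 f0 d1 -> generic_count (col_mx a A2) f0 d2 ->
  generic_count (block a A2) (rshift 1 f0) (d1 + d2).
Proof.
move=> d0 [G1 gG1 GP1] [G2 gG2 GP2].
have [g A2g ag] := dual_exists aA2.
have [G3 gG3 GP3] := generic_dual_nonzero.
have [G4 gG4 GP4] := generic_coordinate_nonzero ag.
have [G5 gG5 GP5] := generic_nonresonant nc e.
have [lam l0] : generic (G1 * G2 * G3 * G4 * G5) by do !apply: (genericM nc).
rewrite !mevalM !mulf_eq0 !negb_or => /andP[/andP[/andP[/andP[H1 H2] H3] H4] H5].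
have [c1 s1] := GP1 lam l0 H1; have [c2 s2] := GP2 lam l0 H2.
have {}GP3 := GP3 lam H3; have {}GP4 := GP4 lam H4; have {}GP5 := GP5 lam H5.
set B := block a A2; set h0 := rshift 1 f0.
pose lam0 : 'rV[C]_(1 + e) := row_mx 0 lam.
have lam00 : \sum_i lam0 0 i = 0.
  rewrite big_split_ord big_ord1 /= row_mxEl mxE add0r -[RHS]l0.
  by apply: eq_bigr => i _; rewrite row_mxEr.
have cB : counted (sol B h0 lam0) (d1 + d2) by apply: counted_block A2g ag _ _ _ _ GP4 c1 c2.
have sB p : sol B h0 lam0 p -> simple B h0 p.
  case/(block_solP A2g ag) => -[q sq ->].
    by apply: con_ext_simple (s1 _ sq) (GP3 _ sq).
  exact: (del_ext_simple A2g ag (s2 _ sq) (GP4 _ sq)).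
have pB : proper_at nc B h0 lam0.
  (* Index 0 is exceptional, as its own partial sum is zero. The vectors [(1, a)] of L and
     [(1, - g^T)] of the orthogonal control [x_0] and [y_0]. *)
  apply: (@solutions_proper _ _ _ _ _ _ _ [set lshift e 0]%SET).
  - by rewrite inE eq_rlshift.
  - move=> i j F; rewrite !inE; case: (split_ordP i) => i' ->; first by rewrite ord1 eqxx.
    case: (split_ordP j) => j' ->; first by rewrite ord1 eqxx.
    move=> _ _ iF jF; pose F' := unshift F.
    have -> : \sum_(l in F) lam0 0 l = \sum_(l in F') lam 0 l.
      rewrite [LHS]big_mkcond big_split_ord big_ord1 /= row_mxEl mxE if_same add0r.
      rewrite [RHS]big_mkcond; apply: eq_bigr => l _.
      by rewrite row_mxEr inE.
    apply: GP5; first by apply/set0Pn; exists i'; rewrite inE.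
    by apply/eqP => /finset.setP/(_ j'); rewrite !inE (negPf jF).
  - move=> i; rewrite inE => /eqP ->; exists (row_mx 1%:M a).
      by rewrite /B /block -addsmxE addsmxSl.
    by split=> [|j]; [rewrite row_mxEl mxE|rewrite inE => /eqP ->; rewrite eqxx].
  - move=> i; rewrite inE => /eqP ->; exists (row_mx 1%:M (- g^T)).
      apply/block_orth; rewrite !mulNmx -!trmx_mul ag A2g trmx1 opprK trmx0 oppr0.
      by [].
    by split=> [|j]; [rewrite row_mxEl mxE|rewrite inE => /eqP ->; rewrite eqxx].
(* The hypothesis [0 < d1 + d2] enters here, to supply the solution that [generic_simple] starts
   from. *)
have [p1 sp1] : exists p1, sol B h0 lam0 p1.
  have [s [_ sd sP]] := cB; case: s sd sP => [sd|p s _ sP]; first by rewrite -sd in d0.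
  by exists p; apply/sP; rewrite mem_head.
have [G6 gG6 GP6] := generic_simple nc sp1 (sB _ sp1).
have [G7 gG7 GP7] := generic_nonresonant nc (1 + e).
have good (mu : 'rV[C]_(1 + e)) : (G6 * G7).@[mu 0] != 0 ->
    proper_at nc B h0 mu /\ forall p, sol B h0 mu p -> simple B h0 p.
  rewrite mevalM mulf_eq0 negb_or => /andP[H6 H7]; split; last exact: GP6.
  apply: (@solutions_proper _ _ _ _ _ _ _ finset.set0); rewrite ?inE //.
  - move=> i j F _ _ iF jF; apply: GP7 => //; first by apply/set0Pn; exists i.
    by apply/eqP => FT; rewrite FT inE in jF.
  - by move=> i; rewrite inE.
  - by move=> i; rewrite inE.
have gG : generic (G6 * G7) by apply: (genericM nc).
exists (G6 * G7) => // mu mu0 Gmu; split; last by have [] := good mu Gmu.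
(* The number passes from [lam0] to a nearby generic [nu] by local constancy, and from [nu] to any
   generic [mu] along a line. *)
have [c c0 cP] := locally_constant nc_compact lam00 pB sB.
have [nu [nu0 nuc Gnu]] := generic_near nc gG lam00 c0.
apply: (generic_count_constant nc_compact nc_connected _ nu0 mu0 Gnu Gmu).
  by move=> xi _; apply: good.
by apply: (cP lam0) => //; rewrite subrr nrm0.
Qed.

End BlockStep.

(** With [f0] last, removing index 0 keeps it until one element is left. The last clause lets the
    value zero pass through the induction; [e = 1] is an exception, since a single loop has beta
    invariant zero but no proper nonempty subset to separate it. *)
Theorem generic_count_beta e k (A : 'M[C]_(k, e)) (f0 : 'I_e) : f0.+1 = e :> nat ->
  exists d : nat, [/\ d%:Z = beta (linear_matroid A), generic_count A f0 d &
    d = 0%N -> separable (linear_matroid A) \/ e = 1%N].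
Proof.
elim: e k A f0 => [|e IH] k A f0; first by case: f0.
case: (posnP e) IH A f0 => [-> _ A f0 _|e0 IH A f0 f0e].
  exists (\rank A); rewrite beta_one //; split=> //; last by right.
  exact: generic_count_one.
have [f0' f0E] : exists f0', f0 = @rshift 1 e f0'.
  case: (@split_ordP 1 e f0) => j f0j; last by exists j.
  by move: f0e; rewrite f0j ord1 /= => -[E]; rewrite -E in e0.
have f0'e : f0'.+1 = e :> nat by move: f0e; rewrite f0E /= add1n => -[].
have [A0|A0] := eqVneq (@lsubmx _ _ 1 e A) 0.
  have sA := separable_loop e0 A0; exists 0%N; rewrite (beta_loop A0); split=> //.
    exact: generic_count_separable.
  by left.
have [a [A2 AB]] := block_exists A0.
have bB : beta (linear_matroid (block a A2)) = beta (linear_matroid A).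
  by apply: beta_eq => S; apply: col_rank_eqmx; apply: eqmx_sym.
have sepB : separable (linear_matroid (block a A2)) -> separable (linear_matroid A).
  by apply: separable_eq => S; apply: col_rank_eqmx; apply: eqmx_sym.
have [aA|aA] := boolP (a <= A2)%MS.
  have sA := sepB (separable_coloop e0 aA).
  exists 0%N; rewrite -bB beta_block_coloop //; split=> //; last by left.
  exact: generic_count_separable.
have [d1 [b1 c1 z1]] := IH _ A2 f0' f0'e.
have [d2 [b2 c2 z2]] := IH _ (col_mx a A2) f0' f0'e.
have bd : (d1 + d2)%:Z = beta (linear_matroid A).
  by rewrite -bB beta_block_main // -b1 -b2 PoszD.
exists (d1 + d2)%N; case: (posnP (d1 + d2)) => [d0|d0]; last first.
  split=> [//||E]; last by rewrite E in d0.
  by rewrite f0E; apply: generic_count_eqmx (eqmx_sym AB) _; apply: block_step.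
have [d10 d20] : d1 = 0%N /\ d2 = 0%N by move/eqP: d0; rewrite addn_eq0 => /andP[/eqP-> /eqP->].
suff sA : separable (linear_matroid A).
  by rewrite d0 in bd *; split=> //; [apply: generic_count_separable|left].
(* On one element the deletion would have beta invariant equal to its rank, which is positive by
   [rank_del], against [d2 = 0]. *)
have e1 : e <> 1%N.
  move=> e1; move: (beta_one (col_mx a A2) e1); rewrite -b2 d20 rank_del //.
by apply/sepB/separable_block => //; [have [] := z1 d10|have [] := z2 d20].
Qed.

End GenericCount.

(** * The scaled Segre variety *)

Lemma mderivXU (C : nzRingType) n (i k : 'I_n) : 'X_i^`M(k) = (i == k)%:R%:MP :> {mpoly C[n]}.
Proof.
rewrite mderivX mnm1E; case: eqVneq => [->|_]; last by rewrite scale0r mpolyC0.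
have -> : (U_(k) - U_(k))%MM = 0%MM by apply/mnmP => j; rewrite mnmBE subnn mnm0E.
by rewrite scale1r mpolyX0.
Qed.

(** Chain rule along a polynomial curve, for differentiating members of the ideal along curves in
    the variety. *)
Lemma deriv_mmap (C : fieldType) n (h : 'I_n -> {poly C}) (f : {mpoly C[n]}) :
  (mmap polyC h f)^`() = \sum_k mmap polyC h f^`M(k) * (h k)^`().
Proof.
pose P f := (mmap polyC h f)^`() = \sum_k mmap polyC h f^`M(k) * (h k)^`().
have PM f1 f2 : P f1 -> P f2 -> P (f1 * f2).
  rewrite /P rmorphM derivM => -> ->.
  rewrite mulr_suml mulr_sumr -big_split; apply: eq_bigr => k _ /=.
  by rewrite mderivM rmorphD !rmorphM /=; ring.
have P1 : P 1.
  rewrite /P rmorph1 derivC big1 // => k _.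
  by rewrite -[1]/(1%:MP) mderivC rmorph0 mul0r.
have PX i : P 'X_i.
  rewrite /P mmapX mmap1U (bigD1 i) //= mderivXU eqxx rmorph1 mul1r.
  rewrite big1 ?addr0 // => k ki.
  by rewrite mderivXU eq_sym (negPf ki) mpolyC0 rmorph0 mul0r.
have PXm m : P 'X_[m].
  rewrite mpolyXE_id; elim/big_ind: _ => // i _.
  by elim: (m i) => [|j IH]; rewrite ?expr0 // exprS; apply: PM.
elim/mpolyind: f => [|c m p _ _ IH].
  by rewrite rmorph0 linear0 big1 // => k _; rewrite mderiv0 rmorph0 mul0r.
rewrite rmorphD derivD /= mmapZ mul_polyC derivZ PXm IH scaler_sumr -big_split.
apply: eq_bigr => k _ /=; rewrite mderivD mderivZ rmorphD /= mmapZ mul_polyC mulrDl.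
by rewrite scalerAl.
Qed.

Section SegreVariety.
Variables (C : fieldType) (m n : nat) (w : 'M[C]_(m, n)).
Hypothesis w0 : forall i j, w i j != 0.
Hypothesis Cinf : forall q : {poly C}, q != 0 -> exists t, q.[t] != 0.
Implicit Types (s : 'rV[C]_m) (t : 'rV[C]_n) (p q v : 'M[C]_(m, n)).

Lemma coordsE p i j : coords p (mxvec_index i j) = p i j.
Proof. by rewrite /coords mxvecE. Qed.

(** A 2 by 2 minor of the matrix [p_ij / w_ij], with denominators cleared. *)
Definition minor i j k l : {mpoly C[m * n]} :=
  (w i l * w k j) *: ('X_(mxvec_index i j) * 'X_(mxvec_index k l)) -
  (w i j * w k l) *: ('X_(mxvec_index i l) * 'X_(mxvec_index k j)).

Lemma minor_eval i j k l p : (minor i j k l).@[coords p] =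
  w i l * w k j * (p i j * p k l) - w i j * w k l * (p i l * p k j).
Proof. by rewrite mevalB !mevalZ !mevalM !mevalXU !coordsE. Qed.

Lemma minor_ideal i j k l : segre_ideal w (minor i j k l).
Proof.
split; last by move=> s t _ _; rewrite minor_eval !mxE; ring.
have quad x y : ('X_x * 'X_y : {mpoly C[m * n]}) \is 2.-homog.
  by rewrite -[2%N]/(1 + 1)%N; apply: dhomogM; rewrite dhomogX /= mdeg1.
by exists 2%N; apply: rpredB; apply: rpredZ.
Qed.

Lemma segre_map_neq0 s t : s != 0 -> t != 0 -> segre_map w s t != 0.
Proof.
move=> /matrix0Pn[i0 [i si]] /matrix0Pn[j0 [j tj]]; apply/matrix0Pn; exists i, j.
by move: si tj; rewrite (ord1 i0) (ord1 j0) mxE => si tj; rewrite !mulf_neq0.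
Qed.

Lemma segre_map_variety s t : s != 0 -> t != 0 -> segre_variety w (segre_map w s t).
Proof. by move=> s0 t0; split=> [|f [_ fP]]; [exact: segre_map_neq0|exact: fP]. Qed.

(** The image is already closed: the minors through a nonzero entry [(k, l)] determine [p_ij / w_ij]
    from its row [k] and its column [l]. *)
Lemma segre_varietyP p : segre_variety w p ->
  exists s t, [/\ s != 0, t != 0 & p = segre_map w s t].
Proof.
move=> [/matrix0Pn[k [l pkl]] pI].
pose s : 'rV_m := \row_i (p i l / w i l / (p k l / w k l)).
pose t : 'rV_n := \row_j (p k j / w k j).
exists s, t; split.
- apply/matrix0Pn; exists 0, k; rewrite mxE divff ?oner_eq0 // mulf_neq0 // invr_eq0 //.
- by apply/matrix0Pn; exists 0, l; rewrite mxE mulf_neq0 // invr_eq0.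
apply/matrixP => i j; rewrite !mxE.
have := pI _ (minor_ideal i j k l); rewrite minor_eval => /eqP; rewrite subr_eq0 => /eqP E.
apply: (mulfI (mulf_neq0 (mulf_neq0 (w0 i l) (w0 k j)) pkl)).
transitivity (w i l * w k j * (p i j * p k l)); first by ring.
rewrite E; field.
by rewrite !w0 pkl.
Qed.

Definition segre_tangent s t (a : 'rV[C]_m) (b : 'rV[C]_n) : 'M[C]_(m, n) :=
  \matrix_(i, j) (w i j * (a 0 i * t 0 j + s 0 i * b 0 j)).

(** Differentiate [f] at 0 along the image of [(s + x a, t + x b)]. It vanishes wherever both
    vectors are nonzero, that is for all but finitely many [x], hence identically on the curve. *)
Lemma segre_tangentP s t (a : 'rV_m) (b : 'rV_n) : s != 0 -> t != 0 ->
  tangent w (segre_map w s t) (segre_tangent s t a b).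
Proof.
move=> s0 t0 f [_ fP].
pose h k : {poly C} := mxvec (\matrix_(i, j) ((w i j)%:P *
   ((s 0 i)%:P + (a 0 i)%:P * 'X) * ((t 0 j)%:P + (b 0 j)%:P * 'X))) 0 k.
have hE x k : (h k).[x] = coords (segre_map w (s + x *: a) (t + x *: b)) k.
  by case/mxvec_indexP: k => i j; rewrite /h /coords !mxvecE !mxE !hornerE; ring.
have hd k : (h k)^`().[0] = coords (segre_tangent s t a b) k.
  case/mxvec_indexP: k => i j; rewrite /h /coords !mxvecE !mxE !derivE !hornerE /=.
  by ring.
have h0 k : (h k).[0] = coords (segre_map w s t) k by rewrite hE !scale0r !addr0.
pose F := mmap polyC h f.
have F0 : F = 0.
  apply/eqP; apply: contraT => F0.
  have [[i0 [i si]] [j0 [j tj]]] := (matrix0Pn s s0, matrix0Pn t t0).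
  pose ps := (s 0 i)%:P + (a 0 i)%:P * 'X; pose pt := (t 0 j)%:P + (b 0 j)%:P * 'X.
  have ps0 : ps != 0.
    apply: contraNneq si => /(congr1 (horner^~ 0)).
    by rewrite (ord1 i0) !hornerE => ->.
  have pt0 : pt != 0.
    apply: contraNneq tj => /(congr1 (horner^~ 0)).
    by rewrite (ord1 j0) !hornerE => ->.
  have [x] := Cinf (mulf_neq0 (mulf_neq0 ps0 pt0) F0).
  rewrite !hornerM !mulf_eq0 !negb_or => /andP[/andP[sx tx]] /negP[].
  rewrite /F horner_mmap; apply/eqP; transitivity (f.@[coords (segre_map w (s + x *: a) (t + x *: b))]).
    by apply: meval_eq => k; rewrite hE.
  apply: fP; apply/matrix0Pn; [exists 0, i; move: sx|exists 0, j; move: tx];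
    by rewrite !hornerE !mxE mulrC.
have := congr1 (fun q : {poly C} => q^`().[0]) F0.
rewrite /F deriv_mmap linear0 horner0 horner_sum => E; rewrite -[RHS]E.
apply: eq_bigr => k _; rewrite hornerM hd horner_mmap; congr (_ * _).
by apply: meval_eq => l; rewrite h0.
Qed.

Lemma minor_tangent i j k l p v : tangent w p v ->
  w i l * w k j * (v i j * p k l + p i j * v k l) =
  w i j * w k l * (v i l * p k j + p i l * v k j).
Proof.
move=> /(_ _ (minor_ideal i j k l)).
have sumX (x : 'I_(m * n)) (c : C) :
    \sum_(y < m * n) (x == y)%:R * c * coords v y = c * coords v x.
  rewrite (bigD1 x) //= eqxx mul1r big1 ?addr0 // => y yx.
  by rewrite eq_sym (negPf yx) !mul0r.
under eq_bigr => y _.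
  rewrite /minor mderivB !mderivZ !mderivM !mderivXU.
  rewrite mevalB !mevalZ !mevalD !mevalM !mevalC !mevalXU !coordsE.
  rewrite mulrBl -!mulrA !mulrDl !mulrDr.
  over.
move=> /= E.
pose S x c := \sum_(y < m * n) (x == y)%:R * c * coords v y.
have {}E : w i l * w k j * (S (mxvec_index i j) (p k l) + S (mxvec_index k l) (p i j)) -
   w i j * w k l * (S (mxvec_index i l) (p k j) + S (mxvec_index k j) (p i l)) = 0.
  rewrite -[RHS]E /S -!big_split !mulr_sumr -sumrB; apply: eq_bigr => y _ /=.
  by ring.
move/eqP: E; rewrite subr_eq0 /S !sumX !coordsE => /eqP E.
by transitivity (w i l * w k j * (p k l * v i j + p i j * v k l)); [ring|rewrite E; ring].
Qed.

(** At such a point the differentials of the minors through [(k, l)] determine [v] from its row [k]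
    and its column [l]. The pair [(a, b)], unique up to multiples of [(s, - t)], is the one with
    [b_l = 0]. *)
Lemma tangent_torus s t v : (0 < m)%N -> (0 < n)%N ->
  (forall i, s 0 i != 0) -> (forall j, t 0 j != 0) ->
  tangent w (segre_map w s t) v -> exists a b, v = segre_tangent s t a b.
Proof.
move=> m0 n0 s0 t0 vT; pose k := Ordinal m0; pose l := Ordinal n0.
exists (\row_i (v i l / (w i l * t 0 l))), (\row_j ((v k j / w k j - v k l / w k l * t 0 j / t 0 l) / s 0 k)).
apply/matrixP => i j; rewrite !mxE.
have := minor_tangent i j k l vT; rewrite !mxE => E.
have c0 : w i l * w k j * (w k l * s 0 k * t 0 l) != 0 by rewrite !mulf_neq0.
apply: (mulfI c0).
have -> : w i l * w k j * (w k l * s 0 k * t 0 l) * v i j =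
  w i l * w k j * (v i j * (w k l * s 0 k * t 0 l) + w i j * s 0 i * t 0 j * v k l) -
  w i l * w k j * (w i j * s 0 i * t 0 j * v k l) by ring.
rewrite E; field.
by rewrite !w0 s0 t0.
Qed.

(** At every point the tangent space contains the image of [(a, b)] under [segre_tangent], whose
    kernel is the line of [(s, - t)]; on the torus it equals that image. So the dimension is
    [m + n - 1] there and at least that elsewhere. *)
Lemma regular_torus s t : (0 < m)%N -> (0 < n)%N ->
  (forall i, s 0 i != 0) -> (forall j, t 0 j != 0) -> regular_locus w (segre_map w s t).
Proof.
move=> m0 n0 s0 t0.
have s00 : s != 0 by apply/matrix0Pn; exists 0, (Ordinal m0).
have t00 : t != 0 by apply/matrix0Pn; exists 0, (Ordinal n0).
split; first exact: segre_map_variety.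
move=> q V W /segre_varietyP[s' [t' [s'0 t'0 ->]]] VE WE.
pose T s t (ab : 'rV[C]_(m + n)) := segre_tangent s t (lsubmx ab) (rsubmx ab).
have Tlin s1 t1 : linear (T s1 t1).
  by move=> c x y; apply/matrixP => i j; rewrite !mxE; ring.
pose Tl s1 t1 : {linear 'rV[C]_(m + n) -> 'M[C]_(m, n)} :=
  HB.pack (T s1 t1) (GRing.isLinear.Build _ _ _ _ _ (Tlin s1 t1)).
pose L s1 t1 := linfun (Tl s1 t1).
have LE s1 t1 ab : L s1 t1 ab = T s1 t1 ab by rewrite lfunE.
have VT : (V <= limg (L s t))%VS.
  apply/subvP => v vV; have : tangent w (segre_map w s t) v by rewrite -VE.
  move=> /(tangent_torus m0 n0 s0 t0)[a [b ->]]; apply/memv_imgP.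
  by exists (row_mx a b); rewrite ?memvf // LE /T row_mxKl row_mxKr.
have WT : (limg (L s' t') <= W)%VS.
  apply/subvP => v /memv_imgP[ab _ ->]; rewrite LE.
  have : tangent w (segre_map w s' t') (T s' t' ab) by apply: segre_tangentP.
  by rewrite -WE.
apply: leq_trans (dimvS VT) (leq_trans _ (dimvS WT)).
have := limg_ker_dim (L s t) fullv; have := limg_ker_dim (L s' t') fullv.
rewrite !capfv.
have ker1 : (0 < \dim (lker (L s t)))%N.
  rewrite lt0n dimv_eq0; apply/eqP => k0.
  have : row_mx s (- t) \in lker (L s t).
    rewrite memv_ker LE /T row_mxKl row_mxKr; apply/eqP/matrixP => i j; rewrite !mxE; ring.
  rewrite k0 memv0 => /eqP; rewrite -[RHS]row_mx0 => /eq_row_mx[E _].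
  by rewrite E eqxx in s00.
have ker2 : (\dim (lker (L s' t')) <= 1)%N.
  have [/matrix0Pn[k0 [k sk]] /matrix0Pn[l0 [l tl]]] := (s'0, t'0).
  rewrite (ord1 k0) in sk; rewrite (ord1 l0) in tl.
  apply: leq_trans (dimvS _ : (_ <= \dim <[row_mx s' (- t')]>)%N) _; last first.
    by rewrite dim_vline; case: (_ != 0).
  apply/subvP => ab; rewrite memv_ker LE => /eqP /matrixP E.
  apply/vlineP; exists (lsubmx ab 0 k / s' 0 k).
  have E' i j : lsubmx ab 0 i * t' 0 j + s' 0 i * rsubmx ab 0 j = 0.
    have := E i j; rewrite mxE [RHS]mxE => /eqP.
    by rewrite mulf_eq0 (negPf (w0 i j)) => /eqP.
  have bE j : rsubmx ab 0 j = - (lsubmx ab 0 k / s' 0 k) * t' 0 j.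
    have /eqP := E' k j; rewrite addrC addr_eq0 => /eqP Ej.
    by apply: (mulfI sk); rewrite Ej; field.
  rewrite -{1}[ab]hsubmxK scale_row_mx; congr row_mx; apply/rowP => i; rewrite [RHS]mxE.
    have /eqP := E' i l; rewrite bE addr_eq0 => /eqP Ei.
    by apply: (mulIf tl); rewrite Ei; ring.
  by rewrite [X in _ = _ * X]mxE bE; ring.
move=> <- E; rewrite -(leq_add2l (\dim (lker (L s t)))) E leq_add2r.
exact: leq_trans ker2 ker1.
Qed.

End SegreVariety.

Lemma beta_iso (E1 E2 : finType) (M1 : matroid E1) (M2 : matroid E2) :
  matroid_iso M1 M2 -> beta M1 = beta M2.
Proof.
move=> [f fbij fM]; have [h fK hK] := fbij; have fI := can_inj fK.
have fh (S : {set E2}) : (f @: (h @: S) = S)%SET.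
  by rewrite -imset_comp -[RHS]imset_id; apply: eq_imset => x /=.
have hf (S : {set E1}) : (h @: (f @: S) = S)%SET.
  by rewrite -imset_comp -[RHS]imset_id; apply: eq_imset => x /=.
have fT : (f @: [set: E1] = [set: E2])%SET.
  by apply/finset.setP => y; rewrite !inE -[y]hK finset.mem_imset // inE.
rewrite /beta -fT fM; congr (_ * _).
rewrite [RHS](reindex (fun S : {set E1} => f @: S)%SET); last first.
  by exists (fun S : {set E2} => h @: S)%SET => S _.
by apply: eq_bigr => S _; rewrite card_imset // fM.
Qed.

(** * Critical points *)

Section CriticalPoints.
Local Notation total := Defs.total.
Variables (C : fieldType) (m n : nat) (w : 'M[C]_(m, n)).
Hypotheses (m0 : (0 < m)%N) (n0 : (0 < n)%N).
Hypothesis w0 : forall i j, w i j != 0.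
Hypothesis Cinf : forall q : {poly C}, q != 0 -> exists t, q.[t] != 0.
Variables (u : 'M[nat]_(m, n)) (j0 : 'I_n).
Let uC i j : C := (u i j)%:R.
Let r i : C := \sum_j uC i j.
Let c j : C := \sum_i uC i j.
Let U : C := (total u)%:R.
Hypotheses (r0 : forall i, r i != 0) (c0 : forall j, c j != 0) (U0 : U != 0).
Implicit Types (s : 'rV[C]_m) (t : 'rV[C]_n) (p v : 'M[C]_(m, n)).

Lemma U_rows : U = \sum_i r i.
Proof. by rewrite /U /Defs.total natr_sum; apply: eq_bigr => i _; rewrite natr_sum. Qed.

(** In the logarithmic directions [al_i + be_j] the differential pairs [al] and [be] with the
    differences between the margins of [u] and of [U p]. Criticality is therefore equality of
    margins. *)
Lemma dloglik_scaled p (al : 'I_m -> C) (be : 'I_n -> C) :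
  (forall i j, p i j != 0) -> total p = 1 ->
  dloglik u p (\matrix_(i, j) (p i j * (al i + be j))) =
  \sum_i al i * (r i - U * \sum_j p i j) + \sum_j be j * (c j - U * \sum_i p i j).
Proof.
move=> p0 p1; rewrite /dloglik p1 divr1 -/U.
have -> : \sum_i \sum_j (u i j)%:R * ((\matrix_(i, j) (p i j * (al i + be j))) i j / p i j) =
  \sum_i al i * r i + \sum_j be j * c j.
  transitivity (\sum_i \sum_j (al i * uC i j + be j * uC i j)).
    apply: eq_bigr => i _; apply: eq_bigr => j _; rewrite mxE mulrC [p i j * _]mulrC mulfK //.
    by rewrite mulrDl.
  under eq_bigr do rewrite big_split.
  rewrite big_split /=; congr (_ + _); first by apply: eq_bigr => i _; rewrite mulr_sumr.
  by rewrite exchange_big; apply: eq_bigr => j _; rewrite mulr_sumr.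
have -> : total (\matrix_(i, j) (p i j * (al i + be j))) =
  \sum_i al i * \sum_j p i j + \sum_j be j * \sum_i p i j.
  transitivity (\sum_i \sum_j (al i * p i j + be j * p i j)).
    by apply: eq_bigr => i _; apply: eq_bigr => j _; rewrite mxE mulrC mulrDl.
  under eq_bigr do rewrite big_split.
  rewrite big_split /=; congr (_ + _); first by apply: eq_bigr => i _; rewrite mulr_sumr.
  by rewrite exchange_big; apply: eq_bigr => j _; rewrite mulr_sumr.
under [X in _ = X + _]eq_bigr do rewrite mulrBr mulrCA.
under [X in _ = _ + X]eq_bigr do rewrite mulrBr mulrCA.
by rewrite !sumrB -!mulr_sumr; ring.
Qed.

(* The equations of the critical points in the coordinates [p = w s t / U], with [s]
   and [t] normalized by [sum_i s_i w_(i, j0) = 1]. *)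
Definition reduced_system (st : 'rV[C]_m * 'rV[C]_n) :=
  [/\ (st.1 *m w) 0 j0 = 1, forall i, st.1 0 i * (st.2 *m w^T) 0 i = r i &
      forall j, (st.1 *m w) 0 j * st.2 0 j = c j].

Definition reduced_point (st : 'rV[C]_m * 'rV[C]_n) := segre_map w (U^-1 *: st.1) st.2.

Lemma reduced_row_sum s t i :
  \sum_j reduced_point (s, t) i j = U^-1 * (s 0 i * (t *m w^T) 0 i).
Proof.
rewrite [(t *m _) 0 i]mxE !mulr_sumr; apply: eq_bigr => j _; rewrite !mxE; ring.
Qed.

Lemma reduced_col_sum s t j :
  \sum_i reduced_point (s, t) i j = U^-1 * ((s *m w) 0 j * t 0 j).
Proof.
rewrite [(s *m w) 0 j]mxE mulr_suml mulr_sumr; apply: eq_bigr => i _; rewrite !mxE; ring.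
Qed.

Lemma reduced_critical st : reduced_system st -> critical_points w u (reduced_point st).
Proof.
case: st => s t [/= s1 sr tc].
have s0 i : s 0 i != 0 by apply: contraNneq (r0 i) => si; rewrite -sr si mul0r.
have t0 j : t 0 j != 0 by apply: contraNneq (c0 j) => tj; rewrite -tc tj mulr0.
have s0' i : (U^-1 *: s) 0 i != 0 by rewrite mxE mulf_neq0 ?invr_eq0.
have p0 i j : reduced_point (s, t) i j != 0 by rewrite mxE !mulf_neq0.
have p1 : total (reduced_point (s, t)) = 1.
  rewrite /Defs.total; under eq_bigr do rewrite reduced_row_sum sr.
  by rewrite -mulr_sumr -U_rows mulVf.
split=> //; first exact: regular_torus.
move=> v /(tangent_torus w0 m0 n0 s0' t0)[a [b ->]].
have -> : segre_tangent w (U^-1 *: s) t a b =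
    \matrix_(i, j) (reduced_point (s, t) i j * (a 0 i / (U^-1 *: s) 0 i + b 0 j / t 0 j)).
  by apply/matrixP => i j; rewrite mxE [RHS]mxE [reduced_point _ _ _]mxE; field; rewrite s0' t0.
rewrite dloglik_scaled // !big1 ?addr0 // => i _.
  by rewrite reduced_col_sum tc mulrA mulfV // mul1r subrr mulr0.
by rewrite reduced_row_sum sr mulrA mulfV // mul1r subrr mulr0.
Qed.

Lemma critical_reduced p : critical_points w u p ->
  exists2 st, reduced_system st & p = reduced_point st.
Proof.
move=> [[/(segre_varietyP w0)[s [t [s0 t0 pE]]] _] p0 p1 pT].
have sum_delta k (i : 'I_k) (F : 'I_k -> C) : \sum_l (l == i)%:R * F l = F i.
  by rewrite (bigD1 i) //= eqxx mul1r big1 ?addr0 // => l /negPf->; rewrite mul0r.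
have sum_zero k (F : 'I_k -> C) : \sum_l 0 * F l = 0.
  by rewrite big1 // => l _; rewrite mul0r.
(* The tangent vector that rescales row [i] alone isolates the [i]-th row sum. *)
have rowE i : r i = U * \sum_j p i j.
  have T : tangent w p (segre_tangent w s t (\row_l (s 0 i * (l == i)%:R)) 0).
    by rewrite pE; apply: segre_tangentP.
  have TE : segre_tangent w s t (\row_l (s 0 i * (l == i)%:R)) 0 =
      \matrix_(l, j) (p l j * ((l == i)%:R + 0)).
    apply/matrixP => l j; rewrite !mxE pE mxE.
    by case: eqVneq => [->|_] /=; ring.
  have := pT _ T; rewrite TE (dloglik_scaled (fun l => (l == i)%:R) (fun=> 0)) //.
  by rewrite sum_delta sum_zero addr0 => /eqP; rewrite subr_eq0 => /eqP.
have colE j : c j = U * \sum_i p i j.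
  have T : tangent w p (segre_tangent w s t 0 (\row_l (t 0 j * (l == j)%:R))).
    by rewrite pE; apply: segre_tangentP.
  have TE : segre_tangent w s t 0 (\row_l (t 0 j * (l == j)%:R)) =
      \matrix_(i, l) (p i l * (0 + (l == j)%:R)).
    apply/matrixP => i l; rewrite !mxE pE mxE.
    by case: eqVneq => [->|_] /=; ring.
  have := pT _ T; rewrite TE (dloglik_scaled (fun=> 0) (fun l => (l == j)%:R)) //.
  by rewrite sum_delta sum_zero add0r => /eqP; rewrite subr_eq0 => /eqP.
(* Division by [ka] normalizes [s]; the factor [ka U] on [t] compensates for it and for the [U^-1]
   in [reduced_point]. *)
pose ka := (s *m w) 0 j0.
have colS j : \sum_i p i j = (s *m w) 0 j * t 0 j.
  by rewrite [(s *m w) 0 j]mxE mulr_suml pE; apply: eq_bigr => i _; rewrite !mxE; ring.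
have rowS i : \sum_j p i j = s 0 i * (t *m w^T) 0 i.
  by rewrite [(t *m w^T) 0 i]mxE mulr_sumr pE; apply: eq_bigr => j _; rewrite !mxE; ring.
have ka0 : ka != 0.
  by apply: contraNneq (c0 j0) => k0; rewrite colE colS -/ka k0 mul0r mulr0.
exists (ka^-1 *: s, (ka * U) *: t).
  have scE l (v : 'rV[C]_l) a i : (a *: v) 0 i = a * v 0 i by rewrite mxE.
  split=> /= [|i|j]; rewrite -!scalemxAl !scE.
  - by rewrite mulVf.
  - by rewrite rowE rowS; field.
  - by rewrite colE colS; field.
by rewrite {1}pE; apply/matrixP => i j; rewrite !mxE; field; rewrite ka0 U0.
Qed.

Lemma reduced_point_inj st st' : reduced_system st -> reduced_system st' ->
  reduced_point st = reduced_point st' -> st = st'.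
Proof.
case: st st' => [s t] [s' t'] [/= s1 sr tc] [/= s1' sr' tc'] /matrixP E.
have st i j : s 0 i * t 0 j = s' 0 i * t' 0 j.
  have := E i j; rewrite !mxE => E'.
  apply: (mulfI (w0 i j)); apply: (mulfI (invr_neq0 U0)).
  by transitivity (w i j * (U^-1 * s 0 i) * t 0 j); [ring|rewrite E'; ring].
have t0 j : t 0 j != 0 by apply: contraNneq (c0 j) => tj; rewrite -tc tj mulr0.
have s0 i : s 0 i != 0 by apply: contraNneq (r0 i) => si; rewrite -sr si mul0r.
have tj0 : t 0 j0 = t' 0 j0.
  rewrite -[LHS]mul1r -[RHS]mul1r -{1}s1 -s1' !mxE !mulr_suml.
  by apply: eq_bigr => i _; rewrite mulrAC st mulrAC.
have sE : s = s'.
  by apply/rowP => i; apply: (mulIf (t0 j0)); rewrite st tj0.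
congr pair => //; apply/rowP => j.
by apply: (mulfI (s0 (Ordinal m0))); rewrite st -sE.
Qed.

(** Row sums carry a minus sign because [y] starts with [- t w^T]; this also gives the total sum
    zero. *)
Definition margins : 'rV[C]_(m + n) := row_mx (\row_i - r i) (\row_j c j).

Lemma sol_reduced xy : sol (row_mx 1%:M w) (rshift m j0) margins xy <->
  exists2 st, reduced_system st &
    xy = (row_mx st.1 (st.1 *m w), row_mx (- (st.2 *m w^T)) st.2).
Proof.
split=> [|[[s t] [/= s1 sr tc] ->]].
  case: xy => x y [/= /submxP[s ->]]; rewrite -[y]hsubmxK; set t := rsubmx y; set y' := lsubmx y.
  rewrite mul_mx_row mulmx1 tr_row_mx mul_row_col trmx1 mulmx1 row_mxEr => yA s1 xy.
  have y'E : y' = - (t *m w^T) by apply/eqP; rewrite -addr_eq0 yA.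
  exists (s, t); last by rewrite y'E.
  split=> //= [i|j].
    have := xy (lshift n i); rewrite !row_mxEl y'E [X in _ = X]mxE.
    by rewrite [X in _ * X]mxE mulrN => /oppr_inj.
  by have := xy (rshift m j); rewrite !row_mxEr => ->; rewrite mxE.
split=> /=.
- by apply/submxP; exists s; rewrite mul_mx_row mulmx1.
- by rewrite tr_row_mx mul_row_col trmx1 mulmx1 addNr.
- by rewrite row_mxEr.
- move=> i; case: (split_ordP i) => j ->.
    by rewrite !row_mxEl [X in _ * X]mxE [RHS]mxE -sr mulrN.
  by rewrite !row_mxEr tc mxE.
Qed.

Lemma counted_critical d : counted (sol (row_mx 1%:M w) (rshift m j0) margins) d ->
  counted (critical_points w u) d.
Proof.
move=> cs.
have : counted reduced_system d.
  apply: (counted_transfer (r := fun xy st =>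
     xy = (row_mx st.1 (st.1 *m w), row_mx (- (st.2 *m w^T)) st.2))) cs.
  - by move=> xy /sol_reduced.
  - move=> st sst; eexists; last reflexivity.
    by apply/sol_reduced; exists st.
  - by move=> xy [s t] [s' t'] _ _ _ -> [/eq_row_mx[-> _] /eq_row_mx[_ ->]].
  - by move=> xy xy' st _ _ _ -> ->.
apply: (counted_transfer (r := fun st p => p = reduced_point st)).
- by move=> st sst; exists (reduced_point st) => //; apply: reduced_critical.
- by move=> p /critical_reduced.
- by move=> st p p' _ _ _ -> ->.
- by move=> st st' p sst sst' _ ->; apply: reduced_point_inj.
Qed.

End CriticalPoints.

Lemma counted_card (T : choiceType) (A : classical_sets.set T) d : counted A d -> (A #= `I_d)%card.
Proof.
move=> [s [us sd sP]].
have -> : A = [set` [fset x in s]%fset]%classic.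
  by apply/classical_sets.seteqP; split=> x /=; rewrite inE => /sP.
by apply/card_eq_fsetP; rewrite card_fseq undup_id.
Qed.

(** * Existence, uniqueness and value of the ML degree *)

Section MLDegree.
Variables (R : realType) (C : fieldType) (nc : absval R C).
Hypothesis nc_compact : locally_compact nc.
Hypothesis nc_connected : punctured_connected nc.
Hypothesis char0 : forall k : nat, k%:R = 0 :> C -> k = 0%N.

Lemma natr_inj : injective (fun k : nat => k%:R : C).
Proof.
move=> i j; wlog ij : i j / (i <= j)%N => [H|/esym/eqP].
  by case/orP: (leq_total i j) => /H{}H E; [|symmetry]; apply: H.
rewrite -subr_eq0 -natrB // => /eqP/char0/eqP; rewrite subn_eq0 => ji.
by apply/eqP; rewrite eqn_leq ij.
Qed.

(** Kronecker's substitution at a natural number yields a natural point, and characteristic zero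
    provides more natural numbers than roots. *)
Lemma mpoly_nat_nonvanishing N (p : {mpoly C[N]}) : p != 0 ->
  exists v : 'I_N -> nat, p.@[fun i => (v i)%:R] != 0.
Proof.
move=> /mpoly_kronecker[D [q [q0 qE]]].
suff [k qk] : exists k : nat, q.[k%:R] != 0.
  exists (fun i => (k ^ (D ^ i))%N); rewrite qE in qk; apply: contraNneq qk => <-.
  by apply/eqP/meval_eq => i; rewrite natrX.
apply: contrapT => noroot.
have kr k : root q k%:R.
  by apply/rootP/eqP; apply: contraT => qk; case: noroot; exists k.
have := @max_poly_roots _ q [seq k%:R | k <- iota 0 (size q)] q0.
rewrite map_inj_uniq ?iota_uniq; last exact: natr_inj.
rewrite size_map size_iota ltnn => H.
by have : false by apply: H => //; apply/allP => x /mapP[k _ ->].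
Qed.

Variables (m n : nat) (hm : (0 < m)%N) (hn : (0 < n)%N).

Lemma mx_nat_nonvanishing (p : {mpoly C[m * n]}) : p != 0 ->
  exists u : 'M[nat]_(m, n), p.@[coords (map_mx (fun x => x%:R) u)] != 0.
Proof.
move=> /mpoly_nat_nonvanishing[v pv]; exists (vec_mx (\row_k v k)).
apply: contraNneq pv => <-; apply/eqP/meval_eq => k.
by case/mxvec_indexP: k => i j; rewrite coordsE !mxE.
Qed.

Variable w : 'M[C]_(m, n).

Lemma is_mldeg_uniq d d' : is_mldeg w d -> is_mldeg w d' -> d = d'.
Proof.
move=> [g g0 gP] [g' g'0 g'P].
have [u] := mx_nat_nonvanishing (mulf_neq0 g0 g'0).
rewrite mevalM mulf_eq0 negb_or => /andP[/gP cu /g'P cu'].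
apply/card_eq_II; apply: card_eq_trans cu'.
by rewrite card_eq_sym.
Qed.

Definition row_sum_poly i : {mpoly C[m * n]} := \sum_(j < n) 'X_(mxvec_index i j).
Definition col_sum_poly j : {mpoly C[m * n]} := \sum_(i < m) 'X_(mxvec_index i j).
Definition margin_poly (k : 'I_(m + n)) : {mpoly C[m * n]} :=
  match split k with inl i => - row_sum_poly i | inr j => col_sum_poly j end.

Lemma row_sum_polyE i (M : 'M[C]_(m, n)) : (row_sum_poly i).@[coords M] = \sum_j M i j.
Proof. by rewrite raddf_sum; apply: eq_bigr => j _; rewrite /= mevalXU coordsE. Qed.

Lemma col_sum_polyE j (M : 'M[C]_(m, n)) : (col_sum_poly j).@[coords M] = \sum_i M i j.
Proof. by rewrite raddf_sum; apply: eq_bigr => i _; rewrite /= mevalXU coordsE. Qed.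

Lemma margin_polyE k (M : 'M[C]_(m, n)) : (margin_poly k).@[coords M] =
  row_mx (\row_i - \sum_j M i j) (\row_j \sum_i M i j) 0 k.
Proof.
rewrite /margin_poly -{2}[k]splitK; case: (split k) => i /=.
  by rewrite mevalN row_sum_polyE row_mxEl mxE.
by rewrite col_sum_polyE row_mxEr mxE.
Qed.

(** The witness is supported on row [i0] and column [j0]. Surjectivity ensures that a polynomial not
    vanishing on the hyperplane pulls back to a nonzero polynomial in the data. *)
Lemma margins_surj (lam : 'rV[C]_(m + n)) : \sum_k lam 0 k = 0 ->
  exists M : 'M[C]_(m, n), row_mx (\row_i - \sum_j M i j) (\row_j \sum_i M i j) = lam.
Proof.
rewrite big_split_ord /= => lam0; pose i0 := Ordinal hm; pose j0 := Ordinal hn.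
set a := \sum_i _ in lam0; set b := \sum_j lam 0 (rshift m j) in lam0.
exists (\matrix_(i, j) ((i == i0)%:R * (lam 0 (rshift m j) - (j == j0)%:R * b) -
                        (j == j0)%:R * lam 0 (lshift n i))).
have delta k (l : 'I_k) (F : 'I_k -> C) : \sum_x (x == l)%:R * F x = F l.
  by rewrite (bigD1 l) //= eqxx mul1r big1 ?addr0 // => x /negPf->; rewrite mul0r.
rewrite -[RHS]hsubmxK; congr row_mx; apply/rowP => x; rewrite !mxE.
  under eq_bigr do rewrite mxE.
  rewrite sumrB -mulr_sumr sumrB (delta _ j0 (fun=> b)) -/b subrr mulr0.
  by rewrite (delta _ j0 (fun=> lam 0 (lshift n x))) sub0r opprK.
under eq_bigr do rewrite mxE.
rewrite sumrB (delta _ i0 (fun=> lam 0 (rshift m x) - (x == j0)%:R * b)) -mulr_sumr -/a.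
by move/eqP: lam0; rewrite addr_eq0 => /eqP ->; ring.
Qed.

Lemma mldeg_exists : (forall i j, w i j != 0) ->
  exists2 d : nat, is_mldeg w d & d%:Z = beta (segre_matroid w).
Proof.
move=> w0; have n1 : (n.-1 < n)%N by rewrite prednK.
(* The last column, so that [f0] is the last index, as [generic_count_beta] requires. *)
pose j0 := Ordinal n1; pose f0 : 'I_(m + n) := rshift m j0.
have f0E : f0.+1 = (m + n)%N :> nat by rewrite /= -addnS prednK.
have [d [bd [G [lam1 l1 G1] GP] _]] :=
  generic_count_beta nc_compact nc_connected (row_mx 1%:M w) f0E.
exists d => //.
pose GM := mmap (@mpolyC _ C) margin_poly G.
have GME M : GM.@[coords M] =
    G.@[row_mx (\row_i - \sum_j M i j) (\row_j \sum_i M i j) 0].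
  rewrite [RHS]mevalE /GM /mmap raddf_sum /=; apply: eq_bigr => x _.
  rewrite mevalM mevalC /mmap1 rmorph_prod; congr (_ * _).
  by apply: eq_bigr => i _; rewrite rmorphXn /= margin_polyE.
have nz (k : nat) : (0 < k)%N -> k%:R != 0 :> C.
  by move=> k0; apply/eqP => /char0 k00; rewrite k00 in k0.
pose one : 'M[C]_(m, n) := const_mx 1.
have oneE i : \sum_j one i j = n%:R.
  by under eq_bigr do rewrite mxE; rewrite sumr_const card_ord.
have oneE' j : \sum_i one i j = m%:R.
  by under eq_bigr do rewrite mxE; rewrite sumr_const card_ord.
(* The first factor makes the margins generic; the others make the row sums, column sums and total
   nonzero, for [counted_critical]. The all-ones matrix shows that these others are nonzero
   polynomials. *)
pose g := GM * \prod_i row_sum_poly i * \prod_j col_sum_poly j * \sum_i row_sum_poly i.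
have g0 : g != 0.
  rewrite /g !mulf_neq0 //.
  - have [M ME] := margins_surj l1; apply: contraNneq G1 => GM0.
    by rewrite -ME -GME GM0 meval0.
  - apply/prodf_neq0 => i _; apply: contraNneq (nz n hn) => E.
    by rewrite -(oneE i) -row_sum_polyE E meval0.
  - apply/prodf_neq0 => j _; apply: contraNneq (nz m hm) => E.
    by rewrite -(oneE' j) -col_sum_polyE E meval0.
  - apply: contraNneq (mulf_neq0 (nz m hm) (nz n hn)) => E.
    have := congr1 (meval (coords one)) E; rewrite meval0 raddf_sum /=.
    under eq_bigr do rewrite row_sum_polyE oneE.
    by rewrite sumr_const card_ord mulr_natl => ->.
exists g => // u; set M := map_mx _ u.
rewrite !mevalM !mulf_eq0 !negb_or => /andP[/andP[/andP[]]].
rewrite GME !rmorph_prod !prodf_seq_neq0 /= => Gu /allP ru /allP cu.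
have ME i j : M i j = (u i j)%:R by rewrite mxE.
have ru' i : \sum_j (u i j)%:R != 0 :> C.
  by have := ru i (mem_index_enum i); rewrite row_sum_polyE; under eq_bigr do rewrite ME.
have cu' j : \sum_i (u i j)%:R != 0 :> C.
  by have := cu j (mem_index_enum j); rewrite col_sum_polyE; under eq_bigr do rewrite ME.
rewrite raddf_sum /= => Uu.
have Uu' : (Defs.total u)%:R != 0 :> C.
  rewrite U_rows; move: Uu; congr (_ != 0); apply: eq_bigr => i _.
  by rewrite row_sum_polyE; apply: eq_bigr => j _.
have mE : row_mx (\row_i - \sum_j M i j) (\row_j \sum_i M i j) = margins C u.
  by congr row_mx; apply/rowP => x; rewrite !mxE; [congr (- _)|]; apply: eq_bigr => y _.
rewrite mE in Gu.
have sum0 : \sum_k margins C u 0 k = 0.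
  rewrite big_split_ord /=; under eq_bigr do rewrite row_mxEl mxE.
  under [X in _ + X]eq_bigr do rewrite row_mxEr mxE.
  by rewrite sumrN exchange_big addNr.
have [cnt _] := GP _ sum0 Gu.
apply: counted_card.
apply: (counted_critical hm hn w0 _ ru' cu' Uu' cnt).
by move=> q q0; apply: (nonroot_exists nc q0).
Qed.

Lemma mldegE : (forall i j, w i j != 0) ->
  is_mldeg w (mldeg w) /\ (mldeg w)%:Z = beta (segre_matroid w).
Proof.
move=> /mldeg_exists[d dd bd]; have dm : is_mldeg w (mldeg w) by apply: xgetI dd.
by rewrite (is_mldeg_uniq dm dd).
Qed.

End MLDegree.

(** Invariance is deduced from the formula, as beta is invariant under isomorphism. The clause
    [is_mldeg w (mldeg w)] ensures that [mldeg w] is a genuine count and not the default value of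
    [xget]. *)
Theorem theorem1p3 (R : realType) (m n : nat) (hm : (0 < m)%N) (hn : (0 < n)%N) :
  (forall v w : 'M[R[i]]_(m, n),
     (forall i j, v i j != 0) -> (forall i j, w i j != 0) ->
     matroid_iso (segre_matroid v) (segre_matroid w) ->
     mldeg v = mldeg w)
  /\
  (forall w : 'M[R[i]]_(m, n), (forall i j, w i j != 0) ->
     is_mldeg w (mldeg w) /\ (mldeg w)%:Z = beta (segre_matroid w)).
Proof.
have char0 k : k%:R = 0 :> R[i] -> k = 0%N by move=> /eqP; rewrite pnatr_eq0 => /eqP.
have mldeg_beta (w : 'M[R[i]]_(m, n)) : (forall i j, w i j != 0) ->
    is_mldeg w (mldeg w) /\ (mldeg w)%:Z = beta (segre_matroid w).
  exact: (mldegE (@complex_locally_compact R) (@complex_punctured_connected R) char0 hm hn).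
have PoszI (a b : nat) : a%:Z = b%:Z -> a = b by case.
split=> [v w v0 w0 iso_vw|w]; last exact: mldeg_beta.
have [_ bv] := mldeg_beta v v0; have [_ bw] := mldeg_beta w w0.
exact: PoszI (etrans bv (etrans (beta_iso iso_vw) (esym bw))).
Qed.
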